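(* There exists an orientation-preserving $C^1$ diffeomorphism $f:\mathbb S^1\to\mathbb S^1$ of the circle $\mathbb S^1=\mathbb R/\mathbb Z$ possessing a minimal invariant Cantor set $K\subset\mathbb S^1$ with the following property: if $\lambda_1\geq\lambda_2\geq\cdots$ are the lengths of the connected components of $\mathbb S^1\setminus K$, arranged in decreasing order (with multiplicity), then $$\limsup_{i\to\infty}\frac{\lambda_i}{\lambda_{i+1}}>1;$$ in particular, $\lambda_i/\lambda_{i+1}$ does not converge to $1$ as $i\to\infty$.
   Context: A minimal invariant Cantor set for $f$ is a subset $K\subset \mathbb S^1$ homeomorphic to the Cantor set, with $f(K)=K$, such that the action of $f$ on $K$ is minimal (every orbit of $f|_K$ is dense in $K$). The connected components of $\mathbb S^1\setminus K$ are countably infinitely many open arcs. *)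

(* Defs.v *)
From HB Require Import structures.
From mathcomp Require Import all_boot all_order all_algebra.
From mathcomp Require Import all_classical all_reals all_analysis.

Set Implicit Arguments.
Unset Strict Implicit.
Unset Printing Implicit Defensive.

Import Order.TTheory GRing.Theory Num.Theory.
Import numFieldNormedType.Exports.

Local Open Scope classical_set_scope.
Local Open Scope quotient_scope.
Local Open Scope ring_scope.

Section Circle.
Variable R : realType.

Definition circle_rel (x y : R) : bool := x - y \is a Num.int.

Lemma circle_rel_refl : reflexive circle_rel.
Proof. by move=> x; rewrite /circle_rel subrr rpred0. Qed.

Lemma circle_rel_sym : symmetric circle_rel.
Proof. by move=> x y; rewrite /circle_rel -[x - y]opprB rpredN. Qed.

Lemma circle_rel_trans : transitive circle_rel.
Proof. by move=> y x z xy yz; rewrite /circle_rel -(subrKA y) rpredD. Qed.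

Canonical circle_equiv :=
  EquivRel circle_rel circle_rel_refl circle_rel_sym circle_rel_trans.

Definition circle : Type := quotient_topology {eq_quot circle_equiv}.

HB.instance Definition _ := PointedTopological.on circle.
HB.instance Definition _ := Quotient.on circle.

Definition circle_proj (x : R) : circle := \pi_circle x.

(* The translates F + k, with k an integer, of a continuous lift F are the
   other continuous lifts of the same map, so that the definitions by lifts
   below do not depend on which one is chosen. *)
Definition is_lift (F : R -> R) (f : circle -> circle) : Prop :=
  continuous F /\ forall x, circle_proj (F x) = f (circle_proj x).

Definition circle_C1 (f : circle -> circle) : Prop :=
  exists F : R -> R,
    [/\ is_lift F f, forall x, derivable F x 1 & continuous (F^`())%classic].

Definition circle_C1_diffeo (f : circle -> circle) : Prop :=
  exists g : circle -> circle,
    [/\ cancel f g, cancel g f, circle_C1 f & circle_C1 g].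

Definition orientation_preserving (f : circle -> circle) : Prop :=
  exists F : R -> R, is_lift F f /\ {homo F : x y / x < y}.

(* The bound l <= 1 makes the projection of the interval injective, so that l
   is the length of the arc and not that of an interval wrapping around. *)
Definition open_arc_of_length (J : set circle) (l : R) : Prop :=
  0 < l <= 1 /\ exists a : R, J = circle_proj @` `]a, a + l[.

End Circle.

Definition homeomorphic_sets (T U : topologicalType) (A : set T)
    (B : set U) : Prop :=
  exists (h : T -> U) (g : U -> T),
    [/\ set_bij A B h, {within A, continuous h}, {within B, continuous g}
      & forall x, A x -> g (h x) = x].

Section Dynamics.
Variable T : topologicalType.

(* For a bijection f this is {f^n x | n an integer}. *)
Definition full_orbit (f : T -> T) (x : T) : set T :=
  [set y | exists n : nat, y = iter n f x \/ x = iter n f y].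

Definition minimal_on (f : T -> T) (K : set T) : Prop :=
  forall x, K x -> K `<=` closure (full_orbit f x).

Definition minimal_invariant_Cantor_set (f : T -> T) (K : set T) : Prop :=
  [/\ homeomorphic_sets [set: cantor_space] K, f @` K = K & minimal_on f K].

Definition components (A : set T) : set (set T) :=
  [set connected_component A x | x in A].

End Dynamics.

(* Each component is listed exactly once, so lengths come with multiplicity;
   the largest length has index 0. *)
Definition decreasing_gap_lengths (R : realType) (K : set (circle R))
    (lambda : nat -> R) : Prop :=
  exists J : nat -> set (circle R),
    [/\ set_bij [set: nat] (components (~` K)) J,
        forall i, open_arc_of_length (J i) (lambda i)
      & forall i, lambda i.+1 <= lambda i].

(* Main.v *)
Require Import Defs.
From HB Require Import structures.
From mathcomp Require Import all_boot all_order all_algebra.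
From mathcomp Require Import all_classical all_reals all_analysis.
From mathcomp Require Import zify ring lra.

Set Implicit Arguments.
Unset Strict Implicit.
Unset Printing Implicit Defensive.

Import Order.TTheory GRing.Theory Num.Theory.
Import numFieldNormedType.Exports.

Local Open Scope classical_set_scope.
Local Open Scope ring_scope.

(** The map is a Denjoy counterexample that blows up two orbits of a
    rotation instead of one.

    Take the circle of length 2, the rotation by [alpha], and the orbits of 0
    and 1.  They consist of the points [m + n alpha], the parity of [m] telling
    the orbits apart.  Replace each point by an arc (a gap) of length
    [w (m, n)].  A homeomorphism that maps each gap to the next one of its
    orbit has a derivative of mean [w (m, n + 1) / w (m, n)] on the gap
    [(m, n)], so it can be made C1 as soon as this ratio is asymptotic, for
    large [n], to a continuous function of the position.  In the usual example
    the limit is 1, and the lengths then thin out so slowly that consecutive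
    ones have ratios tending to 1.  With two orbits the limit may be any
    function that jumps only at the points 0 and 1, since each of these has
    become an arc on which the derivative can interpolate.  The limit used
    here is [slope], which is 1/2 on one half of the circle and 2 on the other.

    The logarithms of the lengths of the two orbits are therefore, up to a
    slowly varying height, plus and minus the Birkhoff sums of the sign [chi]
    that is 1 on the first half of the circle and -1 on the second.  For a
    suitable Liouville number [alpha] these sums draw tents: they rise with
    slope 1/q up to time about 4 q^3 and come back near 0 at time 8 q^3, for
    infinitely many q ([liouville_rotation], [tent_sum_rise],
    [tent_sum_return]).  While a tent is tall one orbit has much shorter gaps
    and the other much longer ones, and meanwhile the common height can cross
    unnoticed: no gap has its length strictly between [eta] and [2 * eta]
    ([level_avoids_window], [weight_window]).  Such empty windows exist at
    arbitrarily small scales, and the two consecutive lengths on both sides of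
    a window have ratio at least 2 ([ratio_ge2]).  Between the tents the height
    grows fast enough to make the lengths summable ([height_dominates],
    [weight_decay]), and slowly enough to leave the limit of the ratios
    unchanged ([height_step]).

    It remains to realize given lengths.  The left end [lpt d] of a gap is the
    total length of the gaps that precede it.  The derivative [p] of the lift
    is [base], equal to 1/2 and 2 off the two initial gaps, plus on each gap a
    bump that corrects the mean.  The bumps tend to 0 uniformly, so [p] is
    continuous ([p_continuous]).  On the union of the gaps, which is dense
    ([gaps_dense]), an antiderivative is written down by hand.  Its increments
    obey the mean value bounds because they are sums of increments over gaps,
    and this extends it to an antiderivative on the line ([glue_diff_across],
    [antiderivative_from_dense]).  The complement of the open gaps is
    invariant, minimal because the orbits of the rotation are dense
    ([cantor_circle_minimal]), and a Cantor set because it is compact, perfect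
    and without interior ([homeomorphic_cantor_subset]). *)

(** * Parity sums over residues *)

(** The character of order 2 of the additive group of integers. *)
Definition par (z : int) : int := 1 - 2 * (z %% 2)%Z.

Lemma parS (z : int) : par (z + 1) = - par z.
Proof. by rewrite /par; lia. Qed.

Lemma par_double (z y : int) : par (z + 2 * y) = par z.
Proof. by rewrite /par; lia. Qed.

Lemma par_pm (z : int) : par z = 1 \/ par z = -1.
Proof. by rewrite /par; lia. Qed.

Section ResidueSums.
Variable q : nat.
Hypothesis q_gt0 : (0 < q)%N.

Lemma periodicZ (H : int -> int) : (forall z, H (z + q%:Z) = H z) ->
  forall k z, H (z + k * q%:Z) = H z.
Proof.
move=> Hq; have Hn (n : nat) z : H (z + n%:Z * q%:Z) = H z.
  elim: n z => [|n IH] z; first by congr H; lia.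
  by rewrite -[RHS]IH -[RHS]Hq; congr H; lia.
case=> n z; first exact: Hn.
by rewrite -[LHS](Hn n.+1); congr H; lia.
Qed.

(** Multiplication by [c] permutes the residues modulo [q], and a translation
    too, so both reorder the sum over a period. *)
Lemma sum_residues (H : int -> int) (c z : int) :
  coprimez q c -> (forall z, H (z + q%:Z) = H z) ->
  \sum_(i < q) H (z + c * i%:Z) = \sum_(i < q) H i%:Z.
Proof.
move=> cop Hq.
have rP (i : 'I_q) : (`|((z + c * i%:Z) %% q%:Z)%Z| < q)%N.
  by have := @ltz_pmod (z + c * i%:Z) q; have := @modz_ge0 (z + c * i%:Z) q; lia.
pose r i := Ordinal (rP i).
have r_inj : injective r.
  move=> i j /(congr1 val)/= e.
  have : ((z + c * i%:Z) == (z + c * j%:Z) %[mod q%:Z])%Z.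
    have := @modz_ge0 (z + c * i%:Z) q; have := @modz_ge0 (z + c * j%:Z) q.
    by move=> /(_ ltac:(lia)) ? /(_ ltac:(lia)) ?; apply/eqP; lia.
  rewrite eqz_mod_dvd opprD addrACA subrr add0r -mulrBr Gauss_dvdzr//.
  move=> /dvdzP[k kE]; apply/val_inj => /=.
  have := ltn_ord i; have := ltn_ord j; move: kE; case: (ltrgtP k 0); nia.
rewrite [RHS](reindex_inj r_inj)/=; apply: eq_bigr => i _.
rewrite {1}(divz_eq (z + c * i%:Z) q%:Z) addrC (periodicZ Hq).
by congr H; have := @modz_ge0 (z + c * i%:Z) q; lia.
Qed.

(** The value of the half-circle sign at the point [k / q]: it is 1 for
    [0 <= k < q] and -1 for [q <= k < 2 * q]. *)
Definition half_sign (k : int) : int := par (k %/ q%:Z)%Z.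

Lemma half_signDq (k : int) : half_sign (k + q%:Z) = - half_sign k.
Proof.
rewrite /half_sign -parS; congr par.
by rewrite addrC -[X in (X + k)%R]mul1r divzMDl; [lia|lia].
Qed.

Lemma half_signD2q (k : int) : half_sign (k + 2 * q%:Z) = half_sign k.
Proof. by rewrite mulrDl mul1r addrA !half_signDq opprK. Qed.

Hypothesis q_odd : odd q.
Variable p : nat.
Hypothesis pq : coprime q p.

(** The points [(k + 2 i) / q] are equally spaced, and their number [q] is odd,
    so the two halves of the circle cannot share them evenly: one half has one
    point more, and a move of all the points by [1 / q] exchanges the roles. *)
Lemma sum_half_sign_step2 (k : int) :
  \sum_(i < q) half_sign (k + 2 * i%:Z) = par k.
Proof.
have stepk (l : int) : \sum_(i < q) half_sign (l + 2 + 2 * i%:Z) =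
               \sum_(i < q) half_sign (l + 2 * i%:Z).
  have -> : \sum_(i < q) half_sign (l + 2 + 2 * i%:Z) =
            \sum_(i < q) half_sign (l + 2 * i.+1%:Z).
    by apply: eq_bigr => i _; congr half_sign; lia.
  pose f (i : nat) := half_sign (l + 2 * i%:Z).
  have e : \sum_(i < q.+1) f i = \sum_(i < q.+1) f i by [].
  rewrite {1}big_ord_recr big_ord_recl/= /f in e.
  rewrite half_signD2q [l + 2 * 0]addr0 addrC in e.
  exact: (esym (addrI _ e)).
have stepn (n : nat) (l : int) : \sum_(i < q) half_sign (l + 2 * n%:Z + 2 * i%:Z) =
               \sum_(i < q) half_sign (l + 2 * i%:Z).
  elim: n l => [|n IH] l; first by rewrite addr0.
  rewrite -[RHS]stepk -[RHS]IH.
  by apply: eq_bigr => i _; congr half_sign; lia.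
have stepz (z l : int) : \sum_(i < q) half_sign (l + 2 * z + 2 * i%:Z) =
               \sum_(i < q) half_sign (l + 2 * i%:Z).
  case: z => n; first exact: stepn.
  rewrite -[LHS](stepn n.+1).
  by apply: eq_bigr => i _; congr half_sign; lia.
have even0 : \sum_(i < q) half_sign (2 * i%:Z) = 1.
  have qE : q = (q./2 + q./2.+1)%N by have := odd_double_half q; lia.
  have F i : half_sign (2 * i%:Z) = (if (i < q./2.+1)%N then 1 else -1) \/ (q <= i)%N.
    rewrite /half_sign /par; case: ltnP => hi.
      by rewrite divz_small; [left|lia].
    case: (leqP q i) => hq; [by right|left].
    have -> : 2 * i%:Z = 1 * q%:Z + (2 * i%:Z - q%:Z) by lia.
    by rewrite divzMDl ?divz_small; lia.
  have -> : \sum_(i < q) half_sign (2 * i%:Z) =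
            \sum_(i < q) (if (i < q./2.+1)%N then 1 else -1 : int).
    by apply: eq_bigr => i _; case: (F i) => //; rewrite leqNgt ltn_ord.
  rewrite -(big_mkord predT (fun i => if (i < q./2.+1)%N then 1 else -1 : int)).
  rewrite (@big_cat_nat _ _ _ q./2.+1)//=; last by lia.
  rewrite (eq_big_nat _ _ (F2 := fun=> 1)); last by move=> i /andP[_ ->].
  rewrite [X in _ + X](eq_big_nat _ _ (F2 := fun=> -1)); last first.
    by move=> i /andP[]; rewrite leqNgt => /negbTE ->.
  rewrite !big_const_nat !iter_addr_0 -mulr_natr.
  by rewrite mulNrn; lia.
have odd1 : \sum_(i < q) half_sign (1 + 2 * i%:Z) = -1.
  rewrite -[LHS](stepz q./2%:Z) -[in RHS]even0 -sumrN; apply: eq_bigr => i _.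
  by rewrite -half_signDq; congr half_sign; have := odd_double_half q; lia.
have kE := divz_eq k 2; rewrite kE.
have -> : \sum_(i < q) half_sign ((k %/ 2)%Z * 2 + (k %% 2)%Z + 2 * i%:Z) =
  \sum_(i < q) half_sign ((k %% 2)%Z + 2 * i%:Z).
  rewrite -[RHS](stepz (k %/ 2)%Z).
  by apply: eq_bigr => i _; congr half_sign; lia.
rewrite /par; have [->|->] : (k %% 2)%Z = 0 \/ (k %% 2)%Z = 1 by lia.
  under eq_bigr do rewrite add0r.
  by rewrite even0; lia.
by rewrite odd1; lia.
Qed.

(** The rational rotation by [2 p / q] visits the equally spaced points in
    another order. *)
Lemma sum_half_sign (k : int) :
  \sum_(j < q) half_sign (k + 2 * p%:Z * j%:Z) = par k.
Proof.
rewrite -sum_half_sign_step2.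
have := @sum_residues (fun y => half_sign (k + 2 * y)) p 0 pq.
move=> <-; last by move=> y; rewrite mulrDr addrA half_signD2q.
by apply: eq_bigr => i _; congr half_sign; lia.
Qed.

(** Whether [half_sign] changes from [y] to [y + 1] depends only on the residue
    of [y], and only the residue -1 makes it change. *)
Lemma sum_half_sign_jump (k : int) :
  \sum_(j < q) ((half_sign (k + 1 + 2 * p%:Z * j%:Z)
                  != half_sign (k + 2 * p%:Z * j%:Z)) : nat)%:Z = 1.
Proof.
pose H (y : int) : int := ((half_sign (y + 1) != half_sign y) : nat)%:Z.
have Hq (y : int) : H (y + q%:Z) = H y.
  by rewrite /H (addrAC y) !half_signDq eqr_opp.
have cop : coprimez q (2 * p%:Z).
  by rewrite coprimezE abszM coprimeMr pq andbT coprimen2.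
have := @sum_residues H (2 * p%:Z) k cop Hq.
rewrite /H; under eq_bigr do rewrite (addrAC k).
move=> ->.
have qE : (q.-1.+1 = q)%N by rewrite prednK.
pose G (i : nat) : int := ((half_sign (i%:Z + 1) != half_sign i%:Z) : nat)%:Z.
rewrite -(big_mkord predT G) -qE big_nat_recr//= big_nat big1 ?add0r; last first.
  move=> i /andP[_ iq]; rewrite /G /half_sign !divz_small ?eqxx//; lia.
rewrite /G (_ : q.-1%:Z + 1 = 0 + q%:Z); last by lia.
have z0 : half_sign 0 = 1 by rewrite /half_sign divz_small; [|lia].
have z1 : half_sign q.-1%:Z = 1 by rewrite /half_sign divz_small; [|lia].
by rewrite half_signDq z0 z1.
Qed.

End ResidueSums.

(** * Birkhoff sums of the half-circle sign *)

Section RotationSums.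
Variable R : realType.

(** The circle is that of length 2, and 0 and 1 separate its halves. *)
Definition chi (x : R) : int := par (Num.floor x).

Lemma chi_pm x : chi x = 1 \/ chi x = -1.
Proof. exact: par_pm. Qed.

Lemma chi_double (x : R) (k : int) : chi (x + 2 * k%:~R) = chi x.
Proof.
rewrite /chi floorDrz; last by rewrite -(intrM R 2) intr_int.
by rewrite -(intrM R 2) intrKfloor par_double.
Qed.

Variable alpha : R.

Definition orbit_sum (z : R) (n : nat) : int :=
  \sum_(j < n) chi (z + j%:R * alpha).

Lemma orbit_sumD z m n :
  orbit_sum z (m + n) = orbit_sum z m + orbit_sum (z + m%:R * alpha) n.
Proof.
rewrite /orbit_sum big_split_ord/=; congr (_ + _).
by apply: eq_bigr => j _; rewrite natrD mulrDl addrA.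
Qed.

Lemma orbit_sumS z n :
  orbit_sum z n.+1 = orbit_sum z n + chi (z + n%:R * alpha).
Proof. by rewrite /orbit_sum big_ord_recr. Qed.

Lemma orbit_sum_le z n : - n%:Z <= orbit_sum z n <= n%:Z.
Proof.
elim: n => [|n IH]; first by rewrite /orbit_sum big_ord0.
by rewrite orbit_sumS; have := chi_pm (z + n%:R * alpha); lia.
Qed.

Variables (q p : nat) (rho : R).
Hypotheses (q_odd : odd q) (pq : coprime q p) (rho_gt0 : 0 < rho).
Hypothesis alphaE : q%:R * alpha = 2 * p%:R + rho.

Let q_gt0 : (0 < q)%N. Proof. by case: q q_odd. Qed.
Let qR_gt0 : 0 < q%:R :> R. Proof. by rewrite ltr0n. Qed.

Lemma floor_divq (x : R) : Num.floor x = (Num.floor (q%:R * x) %/ q%:Z)%Z.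
Proof.
have := floor_itv (q%:R * x); set f := Num.floor _ => /andP[fl fu].
have := divz_eq f q; have := @ltz_pmod f q; have := @modz_ge0 f q.
set r := (f %% q)%Z; set m := (f %/ q)%Z => r0 rq fE.
apply: floor_def; apply/andP; split.
  rewrite -(ler_pM2l qR_gt0); apply: le_trans fl.
  by rewrite -[q%:R]/(q%:Z%:~R) -intrM ler_int; lia.
rewrite -(ltr_pM2l qR_gt0); apply: lt_le_trans fu _.
by rewrite -[q%:R]/(q%:Z%:~R) -intrM ler_int; nia.
Qed.

(** Since [q alpha] is [rho] up to a multiple of 2, the orbit is that of the
    rotation by [2 p / q] with a small drift.  The drift matters only through
    the integer part of [q] times the starting point plus the drift. *)
Lemma chi_orbit z (j : nat) :
  chi (z + j%:R * alpha) =
  half_sign q (Num.floor (q%:R * z + j%:R * rho) + 2 * p%:Z * j%:Z).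
Proof.
rewrite /chi /half_sign floor_divq; congr (par (_ %/ _)%Z).
have -> : q%:R * (z + j%:R * alpha) =
    q%:R * z + j%:R * rho + (2 * p%:Z * j%:Z)%:~R.
  by rewrite !intrM mulrDr mulrCA alphaE; ring.
by rewrite floorDrz ?intr_int// intrKfloor.
Qed.

(** If the drift does not reach the next multiple of [1 / q] during [q] steps,
    then the block is one period of the rational rotation. *)
Lemma block_sum_regular z :
  q%:R * z + q%:R * rho <= (Num.floor (q%:R * z) + 1)%:~R ->
  orbit_sum z q = par (Num.floor (q%:R * z)).
Proof.
move=> zle; rewrite -(sum_half_sign q_gt0 q_odd pq); apply: eq_bigr => j _.
rewrite chi_orbit; congr (half_sign _ (_ + _)); apply: floor_def.
have jq : j%:R * rho < q%:R * rho by rewrite ltr_pM2r// ltr_nat.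
have j0 : 0 <= j%:R * rho by rewrite mulr_ge0// ltW.
have := floor_le (q%:R * z); apply/implyP; lra.
Qed.

Hypothesis rho_small : q%:R * rho < 1.

(** In general the drift crosses at most one multiple of [1 / q], which alters
    at most one of the [q] signs, hence the sum by at most 2. *)
Lemma block_sum_bound z : -3 <= orbit_sum z q <= 3.
Proof.
have [Z ZE] : exists Z, Z = Num.floor (q%:R * z) by exists (Num.floor (q%:R * z)).
have key (j : 'I_q) :
    let h := half_sign q (Z + 2 * p%:Z * j%:Z) in
    let h' := half_sign q (Z + 1 + 2 * p%:Z * j%:Z) in
    let d := ((h' != h) : nat)%:Z in
    h - 2 * d <= chi (z + j%:R * alpha) <= h + 2 * d.
  move=> h h' d; rewrite chi_orbit.
  set f := Num.floor _; have : f = Z \/ f = Z + 1.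
    have jq : j%:R * rho < q%:R * rho by rewrite ltr_pM2r// ltr_nat.
    have j0 : 0 <= j%:R * rho by rewrite mulr_ge0// ltW.
    have /andP[f1 f2] := floor_itv (q%:R * z + j%:R * rho).
    have /andP[f3 f4] := floor_itv (q%:R * z).
    rewrite -/f in f1 f2; rewrite -ZE in f3 f4.
    have : Z < f + 1.
      by rewrite -(ltr_int R); apply: (le_lt_trans f3); apply: le_lt_trans f2; lra.
    have : f < Z + 1 + 1.
      by rewrite -(ltr_int R) [X in _ < X]intrD mulr1z;
        apply: (le_lt_trans f1); rewrite (lt_trans (ltrD f4 jq))// ltrD2l.
    by lia.
  move=> [->|->]; rewrite -/h -/h' /d.
    by case: eqP => /=; lia.
  have : h = 1 \/ h = -1 by exact: par_pm.
  have : h' = 1 \/ h' = -1 by exact: par_pm.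
  by case: eqP => /=; lia.
have e1 := sum_half_sign q_gt0 q_odd pq Z.
have e2 := sum_half_sign_jump q_gt0 q_odd pq Z.
have : par Z = 1 \/ par Z = -1 by exact: par_pm.
move=> par1; apply/andP; split.
  apply: (@le_trans _ _ (\sum_(j < q) (half_sign q (Z + 2 * p%:Z * j%:Z) -
    2 * ((half_sign q (Z + 1 + 2 * p%:Z * j%:Z) != half_sign q (Z + 2 * p%:Z * j%:Z)) : nat)%:Z))).
    by rewrite sumrB -mulr_sumr e2 e1; case: par1 => ->.
  by apply: ler_sum => j _; case/andP: (key j).
apply: (@le_trans _ _ (\sum_(j < q) (half_sign q (Z + 2 * p%:Z * j%:Z) +
    2 * ((half_sign q (Z + 1 + 2 * p%:Z * j%:Z) != half_sign q (Z + 2 * p%:Z * j%:Z)) : nat)%:Z))).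
  by apply: ler_sum => j _; case/andP: (key j).
by rewrite big_split/= -mulr_sumr e2 e1; case: par1 => ->.
Qed.

Lemma orbit_sum_blocks z b : - (3 * b%:Z) <= orbit_sum z (q * b) <= 3 * b%:Z.
Proof.
elim: b => [|b IH]; first by rewrite muln0 /orbit_sum big_ord0.
rewrite mulnS addnC orbit_sumD.
by have := block_sum_bound (z + (q * b)%:R * alpha); lia.
Qed.

(** The block bound 3 gives slope at most [3 / q]; the term [q * q] accounts for
    the last incomplete block. *)
Lemma orbit_sum_linear_bound z n :
  - (3 * n%:Z + q%:Z * q%:Z) <= q%:Z * orbit_sum z n <= 3 * n%:Z + q%:Z * q%:Z.
Proof.
rewrite (divn_eq n q) mulnC orbit_sumD.
have := orbit_sum_blocks z (n %/ q).
have := orbit_sum_le (z + (q * (n %/ q))%:R * alpha) (n %% q).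
by have := ltn_pmod n q_gt0; nia.
Qed.

Lemma orbit_sum_double z (k : int) n :
  orbit_sum (z + 2 * k%:~R) n = orbit_sum z n.
Proof.
by apply: eq_bigr => j _; rewrite addrAC chi_double.
Qed.

Lemma orbit_sum_block_start b :
  orbit_sum ((q * b)%:R * alpha) q = orbit_sum (b%:R * rho) q.
Proof.
rewrite -[RHS](orbit_sum_double _ (p%:Z * b%:Z)); congr orbit_sum.
by rewrite natrM mulrAC alphaE intrM; ring.
Qed.

(* [B] blocks drift from 0 to just below [1 / q], through the first of the cells
   cut out by the multiples of [1 / q]. *)
Variable B : nat.
Hypotheses (B_lt : B%:R * (q%:R * rho) < 1) (B_gt : 1 < (B%:R + 1) * (q%:R * rho)).

Let qrho_gt0 : 0 < q%:R * rho. Proof. exact: mulr_gt0. Qed.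

(** Each of the first [B] blocks starts in the cell of 0 and contributes 1. *)
Lemma orbit_sum_rise b : (b <= B)%N -> orbit_sum 0 (q * b) = b%:Z.
Proof.
elim: b => [|b IH] bB; first by rewrite muln0 /orbit_sum big_ord0.
rewrite mulnS addnC orbit_sumD IH; last exact: ltnW.
rewrite add0r orbit_sum_block_start.
have f0 : Num.floor (q%:R * (b%:R * rho)) = 0.
  apply: floor_def; rewrite mulrCA.
  have : b%:R * (q%:R * rho) <= B%:R * (q%:R * rho).
    by rewrite ler_pM2r// ler_nat ltnW.
  have : 0 <= b%:R * (q%:R * rho) by rewrite mulr_ge0// ltW.
  by move=> -> /le_lt_trans -> //.
rewrite block_sum_regular f0; first by rewrite /par; lia.
have : b.+1%:R * (q%:R * rho) <= B%:R * (q%:R * rho).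
  by rewrite ler_pM2r// ler_nat.
by have := B_lt; rewrite mulrCA -natr1 mulrDl; lra.
Qed.

(** After one block that meets the boundary of a cell, and contributes between
    -3 and 3, the next [B - 1] blocks start in the cell of [1 / q] and
    contribute -1 each. *)
Lemma orbit_sum_fall : (0 < B)%N -> -2 <= orbit_sum 0 (q * (2 * B)) <= 4.
Proof.
move=> B0.
have H b : (b < B)%N ->
    B%:Z - 3 - b%:Z <= orbit_sum 0 (q * (B + b.+1)) <= B%:Z + 3 - b%:Z.
  elim: b => [|b IH] bB.
    rewrite addn1 mulnS addnC orbit_sumD orbit_sum_rise//.
    have := block_sum_bound (0 + (q * B)%:R * alpha); rewrite !subr0.
    by case/andP=> l u; rewrite !lerD2l l u.
  have -> : (q * (B + b.+2) = q * (B + b.+1) + q)%N by lia.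
  rewrite orbit_sumD add0r orbit_sum_block_start.
  suff -> : orbit_sum ((B + b.+1)%:R * rho) q = -1 by have := IH (ltnW bB); lia.
  have l1 : (B%:R + 1) * (q%:R * rho) <= (B + b.+1)%:R * (q%:R * rho).
    by rewrite ler_pM2r// natr1 ler_nat; lia.
  have l2 : (B + b.+1)%:R * (q%:R * rho) + q%:R * rho <= 2 * B%:R * (q%:R * rho).
    by rewrite -[X in _ + X]mul1r -mulrDl ler_pM2r// natr1 -natrM ler_nat; lia.
  have f1 : Num.floor (q%:R * ((B + b.+1)%:R * rho)) = 1.
    by apply: floor_def; rewrite mulrCA; have := B_lt; have := B_gt; have := qrho_gt0; lra.
  rewrite block_sum_regular f1; first by rewrite /par; lia.
  by rewrite mulrCA; have := B_lt; lra.
have := H B.-1 ltac:(lia).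
have -> : (B + B.-1.+1 = 2 * B)%N by lia.
by lia.
Qed.

Lemma orbit_sum_tent n : (n <= q * B)%N ->
  n%:Z - q%:Z * q%:Z <= q%:Z * orbit_sum 0 n <= n%:Z + q%:Z * q%:Z.
Proof.
move=> nB.
have dB : (n %/ q <= B)%N by have := leq_div2r q nB; rewrite mulKn.
have nE : n = (q * (n %/ q) + n %% q)%N by rewrite mulnC -divn_eq.
have := orbit_sum_le (0 + (q * (n %/ q))%:R * alpha) (n %% q).
have := ltn_pmod n q_gt0; move: dB nE.
move: (n %% q)%N (n %/ q)%N => r b bB nE rq; rewrite nE.
rewrite orbit_sumD orbit_sum_rise//; move: (orbit_sum _ r) => o le_o.
have l1 : (r * q + r <= q * q)%N by nia.
have : - (q%:Z * r%:Z) <= q%:Z * o <= q%:Z * r%:Z by nia.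
by rewrite !PoszD !PoszM mulrDr; nia.
Qed.

End RotationSums.

(** * A rotation with tent-shaped Birkhoff sums *)

(** [2 * ps k / qs k] are the partial sums of a series of terms
    [2 / qs k] that determines [alpha].  The recurrence makes [qs k.+1]
    asymptotic to [8 * qs k ^ 4], so that [qs k * alpha - 2 * ps k] is close to
    [1 / (4 * qs k ^ 3)].  The start 17 is odd and large enough for
    the estimates on the heights. *)
Fixpoint qs (k : nat) : nat :=
  if k is k'.+1 then (qs k' ^ 2 * (8 * qs k' ^ 2 + 1))%N else 17%N.

Fixpoint ps (k : nat) : nat :=
  if k is k'.+1 then (ps k' * (qs k' * (8 * qs k' ^ 2 + 1)) + 1)%N else 1%N.

Lemma qsS k : qs k.+1 = (qs k ^ 2 * (8 * qs k ^ 2 + 1))%N. Proof. by []. Qed.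

Lemma psS k : ps k.+1 = (ps k * (qs k * (8 * qs k ^ 2 + 1)) + 1)%N.
Proof. by []. Qed.

Arguments qs : simpl never.
Arguments ps : simpl never.

Lemma qs_odd k : odd (qs k).
Proof.
elim: k => // k IH; rewrite qsS oddM oddX IH orbT/=.
by rewrite addn1 /= oddM.
Qed.

Lemma qs_ge17 k : (17 <= qs k)%N.
Proof. by elim: k => // k IH; rewrite qsS; nia. Qed.

Lemma qs_gt0 k : (0 < qs k)%N.
Proof. exact: leq_trans (qs_ge17 k). Qed.

Lemma qs_growth k : (8 * qs k ^ 4 <= qs k.+1)%N.
Proof. by rewrite qsS (_ : (qs k ^ 4 = qs k ^ 2 * qs k ^ 2)%N) -?expnD//; nia. Qed.

Lemma qs_double k : (2 * qs k <= qs k.+1)%N.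
Proof. by have := qs_ge17 k; rewrite qsS; nia. Qed.

Lemma qs_gt k : (k < qs k)%N.
Proof. by elim: k => // k IH; have := qs_double k; have := qs_ge17 k; lia. Qed.

Lemma leq_qs j k : (j <= k)%N -> (qs j <= qs k)%N.
Proof.
move=> jk; rewrite -(subnK jk); elim: (k - j)%N => // n IH.
by rewrite (leq_trans IH)// addSn; have := qs_double (n + j); lia.
Qed.

Lemma qs_coprime k : coprime (qs k) (ps k).
Proof.
case: k => [|k]; first by [].
rewrite qsS psS coprimeMl; apply/andP; split.
  by apply: coprimeXl; rewrite mulnCA mulnC /coprime gcdnMDl gcdn1.
by rewrite mulnA /coprime gcdnMDl gcdn1.
Qed.

Section Liouville.
Variable R : realType.

(** The bounds say that [1 / (qs k * rho)] lies between [4 * qs k ^ 2] and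
    [4 * qs k ^ 2 + 1]: a block drifts by [rho], and [4 * qs k ^ 2] is the
    number of blocks that fit into one cell. *)
Definition liouville (alpha : R) : Prop := forall k,
  let rho := (qs k)%:R * alpha - 2 * (ps k)%:R in
  [/\ 0 < rho, (4 * qs k ^ 2)%:R * ((qs k)%:R * rho) < 1
    & 1 < ((4 * qs k ^ 2)%:R + 1) * ((qs k)%:R * rho)].

(** The first term of the tail of the series is
    [2 / (qs k ^ 2 * (8 * qs k ^ 2 + 1))].  It gives
    [qs k * rho = 2 / (8 * qs k ^ 2 + 1)], the harmonic mean of the two bounds,
    and the remaining terms are too small to leave the interval. *)
Lemma liouville_rotation : exists alpha : R, liouville alpha.
Proof.
have q0 k : 0 < (qs k)%:R :> R by rewrite ltr0n qs_gt0.
pose x k : R := 2 * (ps k)%:R / (qs k)%:R.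
have xS k : x k.+1 = x k + 2 / (qs k.+1)%:R.
  rewrite /x qsS psS !(natrD, natrM, natrX).
  by field; have := q0 k; nra.
have x_bound k j : x (j + k)%N <= x k + 4 / (qs k.+1)%:R - 4 / (qs (j + k).+1)%:R.
  elim: j => [|j IH]; first by rewrite add0n addrK.
  rewrite addSn xS; apply: le_trans (lerD IH (lexx _)) _.
  have : 4 / (qs (j + k).+2)%:R <= 2 / (qs (j + k).+1)%:R :> R.
    rewrite ler_pdivrMr// mulrAC ler_pdivlMr//.
    by have := qs_double (j + k).+1; rewrite -(ler_nat R) natrM; lra.
  by lra.
have x_le j k : (j <= k)%N -> x j <= x k.
  move=> /subnK <-; elim: (k - j)%N => // n IH.
  by rewrite addSn xS (le_trans IH)// lerDl divr_ge0// ltW.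
have x_ub k n : x n <= x k + 4 / (qs k.+1)%:R.
  have [nk|/ltnW kn] := leqP n k.
    by rewrite (le_trans (x_le _ _ nk))// lerDl divr_ge0// ltW.
  rewrite -(subnK kn) (le_trans (x_bound _ _))//.
  by rewrite lerBlDr lerDl divr_ge0// ltW.
pose E := [set x k | k in [set: nat]].
have Esup : has_sup E.
  by split; [exists (x 0%N), 0%N|exists (x 0%N + 4 / (qs 1)%:R) => _ [n _ <-]; exact: x_ub].
pose alpha := sup E.
have lo k : x k <= alpha by apply: sup_upper_bound => //; exists k.
have up k : alpha <= x k + 4 / (qs k.+1)%:R.
  by apply: ge_sup; [case: Esup|move=> _ [n _ <-]; exact: x_ub].
exists alpha => k rho.
have rhoE : rho = (qs k)%:R * (alpha - x k).
  by rewrite /rho /x; field; rewrite lt0r_neq0.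
have q2n : (qs k.+2)%:R != 0 :> R by rewrite lt0r_neq0.
set q : R := (qs k)%:R in rhoE *.
have q3 : 3 <= q by rewrite ler_nat (leq_trans _ (qs_ge17 k)).
have qn0 : q != 0 by rewrite lt0r_neq0//; lra.
have wn0 : 8 * q ^+ 2 + 1 != 0 by rewrite lt0r_neq0//; nra.
have q1E : (qs k.+1)%:R = q ^+ 2 * (8 * q ^+ 2 + 1) :> R.
  by rewrite qsS !(natrD, natrM, natrX).
have l1 : 2 / (q ^+ 2 * (8 * q ^+ 2 + 1)) <= alpha - x k.
  by have := lo k.+1; rewrite xS q1E; lra.
have u1 : alpha - x k <= 2 / (q ^+ 2 * (8 * q ^+ 2 + 1)) + 4 / (qs k.+2)%:R.
  by have := up k.+1; rewrite xS q1E; lra.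
have B : (4 * qs k ^ 2)%:R = 4 * q ^+ 2 :> R by rewrite natrM natrX.
have d0 : 0 < alpha - x k.
  by apply: lt_le_trans l1; rewrite divr_gt0// mulr_gt0 ?exprn_gt0//; nra.
have big : 16 * q ^+ 4 * (8 * q ^+ 2 + 1) < (qs k.+2)%:R.
  have := qs_growth k.+1; rewrite -(ler_nat R) natrM natrX q1E.
  apply: lt_le_trans.
  have -> : 16 * q ^+ 4 * (8 * q ^+ 2 + 1) = 8 * (q ^+ 2 * (8 * q ^+ 2 + 1)) * (2 * q ^+ 2).
    by ring.
  set z := q ^+ 2 * _.
  have zq : 2 * q ^+ 2 < z.
    by rewrite /z mulrC ltr_pM2l ?exprn_gt0//; [nra|lra].
  have z1 : 1 <= z by nra.
  have -> : 8 * z ^+ 4 = 8 * z * (z ^+ 3) by ring.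
  rewrite ltr_pM2l; last by lra.
  by apply: (lt_le_trans zq); rewrite ler_eXnr.
rewrite B rhoE; split; first by rewrite mulr_gt0// (lt_le_trans _ q3).
  apply: (@le_lt_trans _ _ (4 * q ^+ 4 * (2 / (q ^+ 2 * (8 * q ^+ 2 + 1)) + 4 / (qs k.+2)%:R))).
    rewrite (_ : 4 * q ^+ 2 * _ = 4 * q ^+ 4 * (alpha - x k)); last by ring.
    by rewrite ler_pM2l// mulr_gt0// exprn_gt0//; lra.
  have : 16 * q ^+ 4 / (qs k.+2)%:R < 1 / (8 * q ^+ 2 + 1).
    by rewrite ltr_pdivrMr// mulrAC ltr_pdivlMr ?mul1r//; nra.
  have -> : 4 * q ^+ 4 * (2 / (q ^+ 2 * (8 * q ^+ 2 + 1)) + 4 / (qs k.+2)%:R) =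
     8 * q ^+ 2 / (8 * q ^+ 2 + 1) + 16 * q ^+ 4 / (qs k.+2)%:R.
    by field; rewrite qn0 wn0 q2n.
  have -> : 8 * q ^+ 2 / (8 * q ^+ 2 + 1) = 1 - 1 / (8 * q ^+ 2 + 1).
    by field; rewrite wn0.
  by lra.
apply: (@lt_le_trans _ _ ((4 * q ^+ 2 + 1) * (q ^+ 2 * (2 / (q ^+ 2 * (8 * q ^+ 2 + 1)))))).
  have -> : (4 * q ^+ 2 + 1) * (q ^+ 2 * (2 / (q ^+ 2 * (8 * q ^+ 2 + 1)))) =
    (8 * q ^+ 2 + 2) / (8 * q ^+ 2 + 1).
    by field; rewrite qn0 wn0.
  by rewrite ltr_pdivlMr; nra.
rewrite (mulrA q q) -expr2 ler_pM2l; last by nra.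
by rewrite ler_pM2l// exprn_gt0//; lra.
Qed.

End Liouville.

Section Tents.
Variables (R : realType) (alpha : R).
Hypothesis alphaP : liouville alpha.

Let rho k : R := (qs k)%:R * alpha - 2 * (ps k)%:R.

Let alphaE k : (qs k)%:R * alpha = 2 * (ps k)%:R + rho k.
Proof. by rewrite /rho addrC subrK. Qed.

Let rho_gt0 k : 0 < rho k. Proof. by have [] := alphaP k. Qed.

Lemma rho_lt k : (4 * qs k ^ 3)%:R * rho k < 1.
Proof.
have [_ + _] := alphaP k; apply: le_lt_trans.
by rewrite mulrA -natrM expnSr mulnA.
Qed.

Let rho_small k : (qs k)%:R * rho k < 1.
Proof.
apply: le_lt_trans (rho_lt k); rewrite ler_pM2r// ler_nat.
by have := qs_ge17 k; nia.
Qed.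

Lemma rho_lt_inv k : rho k < k.+1%:R^-1.
Proof.
rewrite -[X in _ < X]mul1r ltr_pdivlMr// mulrC; apply: le_lt_trans (rho_lt k).
by rewrite ler_pM2r// ler_nat; have := qs_gt k; nia.
Qed.

Lemma rotation_small eps : 0 < eps ->
  exists a n : int, 0 < 2 * a%:~R + n%:~R * alpha < eps.
Proof.
move=> e0; exists (- (ps (Num.truncn eps^-1))%:Z), (qs (Num.truncn eps^-1))%:Z.
set k := Num.truncn _.
have -> : 2 * (- (ps k)%:Z)%:~R + (qs k)%:Z%:~R * alpha = rho k.
  by rewrite /rho intrN -!pmulrn; ring.
rewrite rho_gt0 (lt_trans (rho_lt_inv k))// invf_plt ?posrE//.
by have /andP[] := truncn_itv (ltW (etrans (invr_gt0 eps) e0)).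
Qed.

(** If [n * alpha] were an integer, then [n * rho k] would be one for all [k], but
    it is nonzero and of absolute value below 1 for [k = |n|]. *)
Lemma rotation_irrational (m n : int) : m%:~R + n%:~R * alpha = 0 -> n = 0.
Proof.
move=> mn; apply/eqP; apply: contraTT isT => n0.
pose k := `|n|%N.
have e : n%:~R * rho k = (- (qs k)%:Z * m - 2 * (ps k)%:Z * n)%:~R.
  rewrite intrB !intrM intrN -!pmulrn /rho; apply/eqP; rewrite -subr_eq0; apply/eqP.
  by transitivity ((qs k)%:R * (m%:~R + n%:~R * alpha)); [ring|rewrite mn mulr0].
have : `|n%:~R * rho k| < 1.
  rewrite normrM (gtr0_norm (rho_gt0 k)) -intr_norm.
  apply: (@lt_le_trans _ _ (`|n|%:~R * k.+1%:R^-1)).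
    by rewrite ltr_pM2l ?rho_lt_inv// ltr0z normr_gt0.
  by rewrite ler_pdivrMr// mul1r /k [leRHS]pmulrn ler_int; lia.
have : n%:~R * rho k != 0 by rewrite mulf_neq0 ?intr_eq0// lt0r_neq0.
rewrite e; move: (_ - _) => z; rewrite intr_eq0 -intr_norm ltrz1; lia.
Qed.

(** The sum starts at [alpha], not at 0: the gaps over 0 and 1 and their images
    get the same length, so that the sign at 0 does not count. *)
Definition tent_sum (N : nat) : int := orbit_sum alpha alpha N.

Let tent_sumE N : orbit_sum alpha 0 N.+1 = 1 + tent_sum N.
Proof.
rewrite -add1n orbit_sumD add0r mul1r; congr (_ + _).
by rewrite /orbit_sum big_ord1 add0r mul0r /chi floor0.
Qed.

Lemma tent_sum_le N : - N%:Z <= tent_sum N <= N%:Z.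
Proof. exact: orbit_sum_le. Qed.

(** On the first half of the [k]-th tent, which lasts [8 * qs k ^ 3] steps, the
    sum is [N / qs k] up to [qs k + 1]. *)
Lemma tent_sum_rise k N : (N < 4 * qs k ^ 3)%N ->
  N%:Z - (qs k)%:Z * (qs k)%:Z - (qs k)%:Z <= (qs k)%:Z * tent_sum N
    <= N%:Z + (qs k)%:Z * (qs k)%:Z.
Proof.
move=> Nk.
have Nk' : (N.+1 <= qs k * (4 * qs k ^ 2))%N by rewrite mulnCA -expnS.
have [_ B1 B2] := alphaP k.
have := orbit_sum_tent (qs_odd k) (qs_coprime k) (rho_gt0 k) (alphaE k) (rho_small k) B1 B2 Nk'.
by rewrite tent_sumE mulrDr mulr1; have := qs_ge17 k; lia.
Qed.

Lemma tent_sum_return k : -4 <= tent_sum (8 * qs k ^ 3) <= 4.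
Proof.
have [_ B1 B2] := alphaP k.
have B0 : (0 < 4 * qs k ^ 2)%N by rewrite muln_gt0 expn_gt0 qs_gt0.
have := orbit_sum_fall (qs_odd k) (qs_coprime k) (rho_gt0 k) (alphaE k) (rho_small k) B1 B2 B0.
have -> : (qs k * (2 * (4 * qs k ^ 2)) = 8 * qs k ^ 3)%N.
  by rewrite [(_ ^ 3)%N]expnS !mulnA; lia.
have := tent_sumE (8 * qs k ^ 3); rewrite orbit_sumS.
have := chi_pm (0 + (8 * qs k ^ 3)%:R * alpha).
move: (orbit_sum _ _ _) (chi _) (tent_sum _) => a b c; lia.
Qed.

Lemma tent_sum_variation k M N :
  - (3 * N%:Z + (qs k)%:Z * (qs k)%:Z) <=
  (qs k)%:Z * (tent_sum (M + N) - tent_sum M) <= 3 * N%:Z + (qs k)%:Z * (qs k)%:Z.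
Proof.
rewrite /tent_sum orbit_sumD addrAC subrr add0r.
exact: (orbit_sum_linear_bound (qs_odd k) (qs_coprime k) (rho_gt0 k) (alphaE k) (rho_small k)).
Qed.

End Tents.

(** * The height profile *)

Section Height.
Variable R : realType.

(** The piecewise linear function of slope 1 on [a, b] and constant elsewhere. *)
Definition ramp (a b N : nat) : nat := (minn N b - minn N a)%N.

Lemma ramp_mono a b M N : (a <= b)%N -> (M <= N)%N -> (ramp a b M <= ramp a b N)%N.
Proof. by rewrite /ramp; lia. Qed.

Lemma ramp_flat a b M N : (M <= N)%N -> (N <= a)%N \/ (a <= b <= M)%N ->
  ramp a b M = ramp a b N.
Proof. by rewrite /ramp; lia. Qed.

(** The stages of the [k]-th tent.  At [t_rise] the sum is about [qs k ^ 2].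
    From [t_lift] to [t_top] it exceeds [tent_margin], and the height may go up
    by [2 * tent_margin] there; it is constant from [t_rise] to [t_lift] and
    from [t_top] to [t_end], when the sums cross the margin. *)
Definition t_rise k := (qs k ^ 3)%N.
Definition t_lift k := (qs k ^ 3 + 2 * qs k ^ 2 + 2 * qs k)%N.
Definition t_top k := (3 * qs k ^ 3)%N.
Definition t_end k := (8 * qs k ^ 3)%N.
Definition tent_margin k := (qs k ^ 2 + qs k)%N.

Lemma t_order k :
  [/\ (t_rise k <= t_lift k)%N, (t_lift k < t_top k)%N, (t_top k <= t_end k)%N,
      (t_end k <= t_rise k.+1)%N & (k < t_rise k)%N].
Proof.
have q17 := qs_ge17 k; have := qs_growth k; have := qs_gt k.
rewrite /t_rise /t_lift /t_top /t_end.
move: (qs k) (qs k.+1) q17 => q q' q17 kq qq'.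
have q'q : (8 * q <= q')%N by rewrite (leq_trans _ qq')// leq_pmul2l// expnS; nia.
rewrite !expnS !expn0 !muln1; split; nia.
Qed.

Lemma t_rise_le j k : (j <= k)%N -> (t_rise j <= t_rise k)%N.
Proof. by move=> /leq_qs jk; rewrite leq_exp2r. Qed.

Lemma t_endrise j k : (j < k)%N -> (t_end j <= t_rise k)%N.
Proof.
move=> /t_rise_le; apply: leq_trans.
by have [] := t_order j.
Qed.

Lemma t_end_le j k : (j <= k)%N -> (t_end j <= t_end k)%N.
Proof. by move=> /leq_qs jk; rewrite leq_mul2l leq_exp2r// jk. Qed.

Lemma t_lift_le j k : (j <= k)%N -> (t_lift j <= t_lift k)%N.
Proof. by move=> /leq_qs jk; rewrite !leq_add ?leq_mul ?leq_exp2r. Qed.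

Lemma t_top_le j k : (j <= k)%N -> (t_top j <= t_top k)%N.
Proof. by move=> /leq_qs jk; rewrite leq_mul2l leq_exp2r// jk. Qed.

Definition lift_slope k : R := 2 * (tent_margin k)%:R / (t_top k - t_lift k)%:R.

(** Two growths for each [k]: the fast recovery after the [k]-th tent, whose
    slope [4 / qs k] beats the slope [3 / qs k] of the sums, and the lift during
    that tent. *)
Definition height_term k (N : nat) : R :=
  4 / (qs k)%:R * (ramp (t_end k) (t_rise k.+1) N)%:R +
  lift_slope k * (ramp (t_lift k) (t_top k) N)%:R.

(** The terms of index at least [N] vanish at [N], so the sum is over all [k]. *)
Definition height (N : nat) : R := \sum_(k < N) height_term k N.

Let q0 k : 0 < (qs k)%:R :> R. Proof. by rewrite ltr0n qs_gt0. Qed.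

Lemma lift_slope_bound k : 0 <= lift_slope k <= 4 / (qs k)%:R.
Proof.
have [_ h _ _ _] := t_order k.
have p : 0 < (t_top k - t_lift k)%:R :> R by rewrite ltr0n subn_gt0.
rewrite /lift_slope divr_ge0 ?mulr_ge0 ?ler0n//=.
rewrite ler_pdivrMr// mulrAC ler_pdivlMr// -!natrM ler_nat.
move: h; rewrite /t_top /t_lift /tent_margin; have := qs_ge17 k.
move: (qs k) => q q17 _; rewrite !expnS !expn0 !muln1.
have : (17 * (q * q) <= q * (q * q))%N by nia.
have : (17 * q <= q * q)%N by nia.
nia.
Qed.

Lemma height_term_mono k M N : (M <= N)%N -> height_term k M <= height_term k N.
Proof.
move=> MN; have [_ /ltnW h1 _ h2 _] := t_order k.
by rewrite lerD// ler_wpM2l ?ler_nat ?ramp_mono ?divr_ge0.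
Qed.

Lemma height_term0 k N : (N <= k)%N -> height_term k N = 0.
Proof.
move=> Nk; have [h1 h2 h3 h4 h5] := t_order k.
by rewrite /height_term /ramp (_ : (_ - _)%N = 0%N) 1?(_ : (minn N (t_top k) - _)%N = 0%N)
  ?mulr0 ?addr0//; lia.
Qed.

Lemma height_term_ge0 k N : 0 <= height_term k N.
Proof. by rewrite -(height_term0 (leq0n k)) height_term_mono. Qed.

Lemma heightE N M : (N <= M)%N -> height N = \sum_(k < M) height_term k N.
Proof.
move=> NM; rewrite /height -!(big_mkord predT (height_term^~ N)).
rewrite [RHS](@big_cat_nat _ _ _ N)//= [X in _ + X]big_nat [X in _ + X]big1 ?addr0//.
by move=> i /andP[+ _]; exact: height_term0.
Qed.

Lemma height_diff M N : (M <= N)%N ->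
  height N - height M = \sum_(k < N) (height_term k N - height_term k M).
Proof. by move=> MN; rewrite (heightE MN) sumrB. Qed.

Lemma height_mono M N : (M <= N)%N -> height M <= height N.
Proof.
move=> MN; rewrite -subr_ge0 height_diff// sumr_ge0// => k _.
by rewrite subr_ge0 height_term_mono.
Qed.

Lemma height_ge0 N : 0 <= height N.
Proof. by apply: sumr_ge0 => k _; exact: height_term_ge0. Qed.

Lemma height_grow k M N : (M <= N)%N ->
  height M + (height_term k N - height_term k M) <= height N.
Proof.
move=> MN; rewrite -lerBrDl height_diff//.
have [kN|Nk] := ltnP k N; last first.
  rewrite !height_term0// ?(leq_trans MN)// subrr sumr_ge0// => i _.
  by rewrite subr_ge0 height_term_mono.
rewrite (bigD1 (Ordinal kN))//= lerDl sumr_ge0// => i _.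
by rewrite subr_ge0 height_term_mono.
Qed.

Lemma height_flat M N : (M <= N)%N ->
  (forall k, height_term k N = height_term k M) -> height N = height M.
Proof.
move=> MN e; apply/eqP; rewrite -subr_eq0 height_diff//; apply/eqP.
by apply: big1 => k _; rewrite e subrr.
Qed.

Lemma height_flat_rise k N : (t_rise k <= N <= t_lift k)%N ->
  height N = height (t_rise k).
Proof.
move=> /andP[N1 N2]; apply: height_flat => // j.
have [h1 h2 h3 h4 h5] := t_order k; have [g1 g2 g3 g4 g5] := t_order j.
rewrite /height_term; congr (_ * _%:R + _ * _%:R); apply/esym/ramp_flat => //.
  have [jk|kj] := ltnP j k; [right|left].
    by rewrite g4 /=; exact: t_rise_le.
  by have := t_end_le kj; lia.
have [jk|kj] := ltnP j k; [right|left].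
  by have := t_endrise jk; lia.
by have := t_lift_le kj; lia.
Qed.

Lemma height_flat_top k N : (t_top k <= N <= t_end k)%N ->
  height N = height (t_top k).
Proof.
move=> /andP[N1 N2]; apply: height_flat => // j.
have [h1 h2 h3 h4 h5] := t_order k; have [g1 g2 g3 g4 g5] := t_order j.
rewrite /height_term; congr (_ * _%:R + _ * _%:R); apply/esym/ramp_flat => //.
  have [jk|kj] := ltnP j k; [right|left].
    by have := t_rise_le jk; lia.
  by have := t_end_le kj; lia.
have [jk|kj] := leqP j k; [right|left].
  by have := t_top_le jk; lia.
by have := t_endrise kj; lia.
Qed.

Lemma height_lift k : height (t_top k) = height (t_rise k) + 2 * (tent_margin k)%:R.
Proof.
have [h1 h2 h3 h4 h5] := t_order k.
rewrite -(@height_flat_rise k (t_lift k)) ?h1 ?leqnn//.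
apply/eqP; rewrite addrC -subr_eq height_diff; last exact: ltnW.
have kt : (k < t_top k)%N by lia.
rewrite (bigD1 (Ordinal kt))//= big1 ?addr0 => [|j jk].
  have p : (t_top k - t_lift k)%:R != 0 :> R by rewrite lt0r_neq0// ltr0n subn_gt0.
  have [e1 e2] : ramp (t_end k) (t_rise k.+1) (t_top k) = 0%N /\
    ramp (t_end k) (t_rise k.+1) (t_lift k) = 0%N by rewrite /ramp; lia.
  have [e3 e4] : ramp (t_lift k) (t_top k) (t_top k) = (t_top k - t_lift k)%N /\
    ramp (t_lift k) (t_top k) (t_lift k) = 0%N by rewrite /ramp; lia.
  rewrite /height_term e1 e2 e3 e4 /lift_slope !mulr0 !add0r subr0.
  by rewrite divfK.
have [g1 g2 g3 g4 g5] := t_order j.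
apply/eqP; rewrite subr_eq0; apply/eqP; rewrite /height_term.
have /eqP {}jk : (j != k :> nat) by apply: contra jk => /eqP e; apply/eqP/val_inj.
have h2' := ltnW h2.
congr (_ * _%:R + _ * _%:R); apply/esym/ramp_flat => //.
  have [jk'|kj] := ltnP j k; [right|left].
    by have := t_rise_le jk'; lia.
  by have := t_end_le kj; lia.
have [jk'|kj] := ltnP j k; [right|left].
  by have := t_endrise jk'; lia.
by have := @t_endrise k j; lia.
Qed.

Lemma height_recover k N : (t_end k <= N <= t_rise k.+1)%N ->
  height (t_end k) + 4 / (qs k)%:R * (N - t_end k)%:R <= height N.
Proof.
move=> /andP[N1 N2]; apply: le_trans (height_grow k N1); rewrite lerD2l.
have [h1 h2 h3 h4 h5] := t_order k.
rewrite /height_term (_ : ramp (t_lift k) (t_top k) N = ramp (t_lift k) (t_top k) (t_end k));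
  last by rewrite /ramp; lia.
rewrite [X in _ <= X](_ : _ = 4 / (qs k)%:R * ((ramp (t_end k) (t_rise k.+1) N)%:R -
  (ramp (t_end k) (t_rise k.+1) (t_end k))%:R)); last by ring.
rewrite (_ : ramp _ _ N = (N - t_end k)%N); last by rewrite /ramp; lia.
by rewrite (_ : ramp _ _ (t_end k) = 0%N) ?subr0// /ramp; lia.
Qed.

Lemma sum_inv_qs K n :
  \sum_(K <= k < K + n) (qs k)%:R^-1 <= 2 / (qs K)%:R - 2 / (qs (K + n))%:R :> R.
Proof.
elim: n => [|n IH]; first by rewrite addn0 big_geq// subrr.
rewrite addnS big_nat_recr ?leq_addr//=; apply: le_trans (lerD IH (lexx _)) _.
have : 2 / (qs (K + n).+1)%:R <= (qs (K + n))%:R^-1 :> R.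
  rewrite ler_pdivrMr// ler_pdivlMl// -natrM ler_nat mulnC; exact: qs_double.
by lra.
Qed.

(** All active ramps have slopes that decrease geometrically in [k].  The
    bound for [K = 0] holds from the start. *)
Lemma height_step K N : (K = 0)%N \/ (t_end K <= N)%N ->
  height N.+1 - height N <= 16 / (qs K)%:R.
Proof.
move=> KN; rewrite height_diff//.
rewrite -(big_mkord predT (fun k => height_term k N.+1 - height_term k N)).
have F k : height_term k N.+1 - height_term k N <= (K <= k)%N%:R * (8 / (qs k)%:R).
  have /andP[s1 s2] := lift_slope_bound k.
  have [h1 h2 h3 h4 h5] := t_order k.
  have [Kk|kK] := leqP K k.
    rewrite mul1r /height_term opprD addrACA -!mulrBr.
    have r1 a b : (a <= b)%N -> (ramp a b N.+1)%:R - (ramp a b N)%:R <= 1 :> R.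
      move=> ab; rewrite lerBlDl natr1 ler_nat /ramp; lia.
    have := ler_wpM2l (divr_ge0 (ler0n R 4) (ltW (q0 k))) (r1 _ _ h4).
    by have := ler_wpM2l s1 (r1 _ _ (ltnW h2)); rewrite !mulr1; lra.
  case: KN => [K0|KN]; first by move: kK; rewrite K0.
  rewrite mul0r subr_le0 /height_term.
  have := t_rise_le kK; have := t_endrise kK; have [] := t_order K => *.
  by rewrite (@ramp_flat _ _ N N.+1)// ?(@ramp_flat (t_lift k) _ N N.+1)//; lia.
apply: le_trans (ler_sum _ (fun k _ => F k)) _.
have [KN1|NK] := leqP K N.+1; last first.
  rewrite big_nat big1 ?divr_ge0// => i /andP[_ iN].
  by rewrite leqNgt (ltn_trans iN NK) mul0r.
rewrite (@big_cat_nat _ _ _ K)//= big_nat big1 ?add0r; last first.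
  by move=> i /andP[_ iK]; rewrite leqNgt iK mul0r.
rewrite (eq_big_nat _ _ (F2 := fun k => 8 * (qs k)%:R^-1)); last first.
  by move=> i /andP[-> _]; rewrite mul1r.
rewrite -mulr_sumr -(subnKC KN1); have := sum_inv_qs K (N.+1 - K).
have : 0 <= 2 / (qs (K + (N.+1 - K)))%:R :> R by rewrite divr_ge0.
by move=> ? /(ler_wpM2l (ler0n R 8)); lra.
Qed.

End Height.

(** * Levels that avoid windows *)

Section Levels.
Variables (R : realType) (alpha : R).
Hypothesis alphaP : liouville alpha.

Let s N : R := (tent_sum alpha N)%:~R.
Let q0 k : 0 < (qs k)%:R :> R. Proof. by rewrite ltr0n qs_gt0. Qed.

Let s_rise k N : (N < 4 * qs k ^ 3)%N ->
  N%:R - (qs k)%:R ^+ 2 - (qs k)%:R <= (qs k)%:R * s N <= N%:R + (qs k)%:R ^+ 2.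
Proof.
move=> /(tent_sum_rise alphaP) /andP[]; rewrite -!(ler_int R) !(intrD, intrB, intrM) -!pmulrn => l u.
by rewrite expr2 /s; apply/andP; split; lra.
Qed.

Let s_var k M N :
  - (3 * N%:R + (qs k)%:R ^+ 2) <= (qs k)%:R * (s (M + N) - s M) <= 3 * N%:R + (qs k)%:R ^+ 2.
Proof.
have /andP[] := tent_sum_variation alphaP k M N.
rewrite -!(ler_int R) !(intrD, intrB, intrM, intrN) -!pmulrn => l u.
by rewrite expr2 /s; apply/andP; split; lra.
Qed.

Let s_ret k : -4 <= s (t_end k) <= 4.
Proof.
have /andP[] := tent_sum_return alphaP k.
by rewrite -!(ler_int R) /s => l u; apply/andP; split; lra.
Qed.

(** The lower end of the window of length 1 that no level enters. *)
Definition window k : R := height R (t_rise k) + (tent_margin k)%:R.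

(** After the [k]-th tent the sums vary with slope at most [3 / qs k] and the
    height grows with slope [4 / qs k], until the start of the next tent.
    During that tent the sums reach at most [25 * qs k.+1 ^ 2], while the height
    has already exceeded a multiple of [qs k.+1 ^ 3 / qs k], which is
    larger. *)
Lemma height_dominates k N : (t_end k <= N <= t_end k.+1)%N ->
  window k + 1 <= height R N - `|s N| /\ N%:R / (16 * (qs k)%:R) <= height R N - `|s N|.
Proof.
move=> /andP[N1 N2].
have [h1 h2 h3 h4 h5] := t_order k.
have hk : height R (t_end k) = window k + (tent_margin k)%:R.
  rewrite (height_flat_top R (k := k)) ?leqnn ?h3// height_lift /window; lra.
have w0 : 0 <= height R (t_rise k) := height_ge0 R _.
have q17 : 17 <= (qs k)%:R :> R by rewrite ler_nat qs_ge17.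
have cE : (tent_margin k)%:R = (qs k)%:R ^+ 2 + (qs k)%:R :> R.
  by rewrite /tent_margin natrD natrX.
have eE : (t_end k)%:R = 8 * (qs k)%:R ^+ 3 :> R by rewrite natrM natrX.
have NkR : (t_end k)%:R <= N%:R :> R by rewrite ler_nat.
have [Nr|rN] := leqP N (t_rise k.+1).
  have := height_recover R (k := k) (N := N); rewrite N1 Nr => /(_ isT).
  rewrite natrB// hk => hN.
  have /andP[l4 u4] := s_ret k.
  have := s_var k (t_end k) (N - t_end k); rewrite subnKC// natrB//.
  set d : R := N%:R - (t_end k)%:R in hN *.
  have d0 : 0 <= d by rewrite subr_ge0.
  move=> /andP[l u].
  have sb : `|s N| <= 4 + (3 / (qs k)%:R * d + (qs k)%:R).
    have t1 : s N - s (t_end k) <= 3 / (qs k)%:R * d + (qs k)%:R.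
      rewrite -(ler_pM2l (q0 k)) (le_trans u)// le_eqVlt; apply/orP; left; apply/eqP.
      by field; rewrite lt0r_neq0.
    have t2 : - (3 / (qs k)%:R * d + (qs k)%:R) <= s N - s (t_end k).
      rewrite -(ler_pM2l (q0 k)) (le_trans _ l)// le_eqVlt; apply/orP; left; apply/eqP.
      by field; rewrite lt0r_neq0.
    by rewrite ler_norml; lra.
  have dq : 0 <= (qs k)%:R^-1 * d :> R by rewrite mulr_ge0// invr_ge0 ltW.
  have q2 : 17 * (qs k)%:R <= (qs k)%:R ^+ 2 :> R by rewrite expr2 ler_pM2r.
  split; first by rewrite cE in hN; lra.
  have -> : N%:R / (16 * (qs k)%:R) = ((qs k)%:R^-1 * d) / 16 + (qs k)%:R ^+ 2 / 2 :> R.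
    rewrite (_ : N%:R = d + 8 * (qs k)%:R ^+ 3); first by field; rewrite lt0r_neq0.
    by rewrite /d eE; ring.
  by rewrite cE /window cE in hN; lra.
have hr := height_recover R (k := k) (N := t_rise k.+1).
rewrite h4 leqnn natrB// in hr; have {}hr := hr isT.
have hN := height_mono R (ltnW rN).
have := s_var k.+1 0 N; rewrite add0n {2 4}/s /tent_sum /orbit_sum big_ord0 subr0.
move: hr; rewrite hk cE eE {1}/t_rise natrX.
have : N%:R <= 8 * (qs k.+1)%:R ^+ 3 :> R.
  by rewrite -natrX -natrM ler_nat.
have qq : 8 * (qs k)%:R ^+ 4 <= (qs k.+1)%:R :> R.
  by rewrite -natrX -natrM ler_nat qs_growth.
have w1 : 0 <= window k by rewrite addr_ge0.
move: (q0 k.+1) (q0 k) qq q17 hN w1.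
set Q : R := (qs k.+1)%:R; set q : R := (qs k)%:R; set n : R := N%:R.
set w := window k; move=> Qp qp qq q17 hN w1 nQ hr /andP[l u].
have sb : `|s N| <= 25 * Q ^+ 2.
  have Q1 : 1 <= Q.
    apply: le_trans qq; have q41 : 1 <= q ^+ 4 by rewrite exprn_ege1//; lra.
    lra.
  have QQ : Q <= Q ^+ 2 by rewrite expr2 ler_peMl// ltW.
  have e3 : Q * (24 * Q ^+ 2 + Q) = 24 * Q ^+ 3 + Q ^+ 2 by ring.
  have t1 : s N <= 24 * Q ^+ 2 + Q.
    by rewrite -(ler_pM2l Qp) e3; apply: le_trans u _; lra.
  have t2 : - (24 * Q ^+ 2 + Q) <= s N.
    by rewrite -(ler_pM2l Qp) mulrN e3; apply: le_trans l; lra.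
  by rewrite ler_norml; lra.
have big : 32 * q ^+ 3 * Q ^+ 2 <= 4 / q * Q ^+ 3.
  rewrite [leRHS]mulrAC ler_pdivlMr//.
  have -> : 32 * q ^+ 3 * Q ^+ 2 * q = 4 * (8 * q ^+ 4) * Q ^+ 2 by ring.
  have -> : 4 * Q ^+ 3 = 4 * Q * Q ^+ 2 by ring.
  by rewrite ler_pM2r ?exprn_gt0// ler_pM2l.
have e1 : 4 / q * (8 * q ^+ 3) = 32 * q ^+ 2 by field; lra.
have Q2 : q ^+ 2 <= Q ^+ 2.
  rewrite ler_pXn2r ?nnegrE ?(ltW qp) ?(ltW Qp)//; apply: le_trans qq.
  have : 1 <= q ^+ 3 by rewrite exprn_ege1//; lra.
  by move=> q31; rewrite exprS; nra.
have Q20 : 1 <= Q ^+ 2 by apply: le_trans Q2; rewrite exprn_ege1//; lra.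
have q3 : 289 * 17 <= q ^+ 3.
  rewrite (_ : 289 * 17 = 17 ^+ 3); last by ring.
  by rewrite ler_pXn2r ?nnegrE//; lra.
have q3Q : 289 * 17 * Q ^+ 2 <= q ^+ 3 * Q ^+ 2 by rewrite ler_pM2r// exprn_gt0.
rewrite mulrBr e1 in hr.
split; first by lra.
apply: (@le_trans _ _ (4 / q * Q ^+ 3 / 8)); last by lra.
rewrite ler_pdivrMr; last by lra.
have -> : 4 / q * Q ^+ 3 / 8 * (16 * q) = 8 * Q ^+ 3 by field; lra.
exact: nQ.
Qed.

Lemma window_mono j k : (j <= k)%N -> window j <= window k.
Proof.
move=> jk; rewrite lerD//; first exact/height_mono/t_rise_le.
by rewrite ler_nat /tent_margin leq_add// ?leq_exp2r// leq_qs.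
Qed.

Lemma window_escape k N : (t_end k <= N)%N -> window k + 1 <= height R N - `|s N|.
Proof.
move=> kN; have [j] : exists j, (N < t_end j)%N.
  by exists N; have [] := t_order N; lia.
elim: j => [|j IH] Nj.
  by have := t_end_le (leq0n k); lia.
have [Nj'|jN] := ltnP N (t_end j); first exact: IH.
have [|h _] := @height_dominates j N; first by rewrite jN ltnW.
apply: le_trans h; rewrite lerD2r window_mono// leqNgt; apply/negP => jk.
by have := t_end_le jk; lia.
Qed.

(** The levels cross the window by jumping over it.  Before [t_rise] both
    orbits are below.  While the height is constant, at distance [tent_margin]
    below or above [window k], the levels are [window k] plus integers, and so
    cannot be strictly inside.  While the height moves, the sum exceeds
    [tent_margin], and the two orbits are on different sides.  After [t_end] both are
    above. *)
Lemma level_avoids_window k N (e : int) : e = 1 \/ e = -1 ->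
  height R N + e%:~R * s N <= window k \/ window k + 1 <= height R N + e%:~R * s N.
Proof.
move=> e1.
have es : `|e%:~R * s N| = `|s N| by case: e1 => ->; rewrite normrM ?normrN normr1 mul1r.
have [h1 h2 h3 h4 h5] := t_order k.
have lev (c : int) : height R N = window k + c%:~R ->
    height R N + e%:~R * s N <= window k \/ window k + 1 <= height R N + e%:~R * s N.
  move=> ->; rewrite -addrA -intrM -intrD.
  case: (ltrP 0 (c + e * tent_sum alpha N)) => le0; [right|left].
    by rewrite lerD2l -[1]/(1%:~R) ler_int; lia.
  by rewrite gerDl lerz0.
have q17 : 17 <= (qs k)%:R :> R by rewrite ler_nat qs_ge17.
have cE : (tent_margin k)%:R = (qs k)%:R ^+ 2 + (qs k)%:R :> R.
  by rewrite /tent_margin natrD natrX.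
have [Nr|rN] := leqP N (t_rise k).
  left; rewrite lerD ?height_mono// (le_trans (ler_norm _))// es.
  have /s_rise/andP[l u] : (N < 4 * qs k ^ 3)%N.
    have : (0 < qs k ^ 3)%N by rewrite expn_gt0 qs_gt0.
    by move: Nr; rewrite /t_rise; lia.
  have N3 : N%:R <= (qs k)%:R ^+ 3 :> R by rewrite -natrX ler_nat.
  rewrite cE ler_norml; apply/andP; split.
    rewrite -(ler_pM2l (q0 k)); apply: le_trans l.
    have : (qs k)%:R <= (qs k)%:R ^+ 3 :> R by rewrite ler_eXnr//; lra.
    have : 0 <= N%:R :> R by [].
    by rewrite mulrN mulrDr -exprS -expr2; lra.
  rewrite -(ler_pM2l (q0 k)); apply: le_trans u _.
  by rewrite mulrDr -exprS -expr2; lra.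
have [Nl|lN] := leqP N (t_lift k).
  apply: (lev (- (tent_margin k)%:Z)).
  rewrite (height_flat_rise R (k := k)) ?Nl ?(ltnW rN)// /window intrN -pmulrn; lra.
have [Nt|tN] := leqP N (t_top k).
  have /s_rise/andP[l u] : (N < 4 * qs k ^ 3)%N.
    have : (0 < qs k ^ 3)%N by rewrite expn_gt0 qs_gt0.
    by move: Nt; rewrite /t_top; lia.
  have sc : (tent_margin k)%:R + 1 <= s N.
    have : (tent_margin k)%:R < s N.
      rewrite -(ltr_pM2l (q0 k)); apply: lt_le_trans l.
      have : (t_lift k)%:R < N%:R :> R by rewrite ltr_nat.
      by rewrite cE /t_lift !natrD !natrM ?natrX; lra.
    rewrite {1}/s -[(tent_margin k)%:R]/((tent_margin k)%:Z%:~R) ltr_int => lt.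
    by rewrite -[1]/(1%:~R) -intrD ler_int; lia.
  have hl : height R (t_rise k) <= height R N by rewrite height_mono// ltnW.
  have hu : height R N <= height R (t_rise k) + 2 * (tent_margin k)%:R.
    by rewrite -height_lift height_mono.
  by rewrite /window; case: e1 => ->; [right|left]; rewrite ?mulN1r ?mul1r; lra.
have [Ne|eN] := leqP N (t_end k).
  apply: (lev (tent_margin k)%:Z).
  rewrite (height_flat_top R (k := k)) ?Ne ?(ltnW tN)// height_lift /window -pmulrn; lra.
right; apply: le_trans (window_escape (ltnW eN)) _; rewrite lerD2l -es.
by rewrite lerNl; have := ler_norm (- (e%:~R * s N)); rewrite normrN.
Qed.

End Levels.

(** * Weights of the two orbits *)

Section Weights.
Variable R : realType.

(** The number of signs between the [n]-th gap and the initial ones: [n] and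
    [1 - n] have the same index. *)
Definition fold_index (n : int) : nat :=
  match n with Posz k => k.-1 | Negz k => k.+1 end.

(** The limit ratio of consecutive lengths; its logarithm has mean 0. *)
Definition slope (x : R) : R := 2 `^ (- (chi x)%:~R).

Lemma slopeE x : slope x = if chi x == 1 then 2^-1 else 2.
Proof.
rewrite /slope; case: (chi_pm x) => ->; rewrite ?eqxx/=.
  by rewrite powR_inv1.
by rewrite opprK powRr1.
Qed.

Lemma chiD (m : int) (x : R) : chi (m%:~R + x) = par m * chi x.
Proof.
rewrite /chi floorDzr ?intr_int// intrKfloor.
move: (Num.floor x) => f; rewrite /par; have [e|e] : (m %% 2)%Z = 0 \/ (m %% 2)%Z = 1 by lia.
all: by rewrite e; lia.
Qed.

Lemma chiN (x : R) : x \isn't a Num.int -> chi (- x) = - chi x.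
Proof.
move=> xi; rewrite /chi.
have -> : Num.floor (- x) = - Num.floor x - 1.
  have /andP[l u] := floor_itv x.
  have ne : (Num.floor x)%:~R != x by rewrite -intrEfloor.
  have l' : (Num.floor x)%:~R < x by rewrite lt_neqAle ne.
  apply: floor_def; rewrite subrK intrN intrB intrN.
  by move: u; rewrite intrD; lra.
by rewrite /par; lia.
Qed.

(** Turns the linear domination of the height into a decay of order [1 / n ^ 2]. *)
Lemma cube_le_exp2 (y : nat) : ((y + 1) ^ 3 <= 8 * 2 ^ y)%N.
Proof.
have [|y4] := leqP y 4; first by move: y; do 5 case=> //.
rewrite -(subnKC y4); elim: (y - 5)%N => // n IH.
rewrite addnS [(2 ^ _.+1)%N]expnS; move: IH; rewrite !expnS !expn0 !muln1.
move: (2 ^ (5 + n))%N => z; move: n => n; rewrite !addSn add0n.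
by nia.
Qed.

Variable alpha : R.
Hypothesis alphaP : liouville alpha.

Let level (m n : int) : R :=
  height R (fold_index n) + (par m)%:~R * (tent_sum alpha (fold_index n))%:~R.

(** The index [m] only matters through its parity, which exchanges [chi] and
    [- chi], so that the sums enter with opposite signs on the two orbits. *)
Definition weight (d : int * int) : R := 2 `^ (- level d.1 d.2).

Lemma weight_gt0 d : 0 < weight d. Proof. by rewrite powR_gt0. Qed.

Lemma weight_shift (k m n : int) : weight (m + 2 * k, n) = weight (m, n).
Proof. by rewrite /weight /level/= par_double. Qed.

Lemma weight00 m : weight (m, 0) = 1.
Proof.
rewrite /weight /level /= /height big_ord0 /tent_sum /orbit_sum big_ord0.
by rewrite mulr0 addr0 oppr0 powRr0.
Qed.

Lemma weight01 m : weight (m, 1) = 1.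
Proof. by rewrite -(weight00 m). Qed.

Let irrat (n : int) : n != 0 -> n%:~R * alpha \isn't a Num.int.
Proof.
move=> n0; apply/negP => /intrP[m e].
have := rotation_irrational alphaP (m := - m) (n := n).
rewrite e intrN addNr => /(_ erefl); exact/eqP.
Qed.

(** A step of [n] adds or removes one sign of the sum, namely the one at the
    gap itself: for negative [n] by the oddness of [chi].  The gap [(m, 0)] is
    the exception, as the sum does not contain its sign. *)
Lemma weight_step m n : n != 0 -> exists N : nat, exists delta : R,
  [/\ weight (m, n + 1) = weight (m, n) * slope (m%:~R + n%:~R * alpha) * 2 `^ delta,
      `|delta| = height R N.+1 - height R N & (`|n| <= N.+1)%N].
Proof.
have sS N : tent_sum alpha N.+1 = tent_sum alpha N + chi ((N%:Z + 1)%:~R * alpha).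
  rewrite /tent_sum orbit_sumS; congr (_ + chi _).
  by rewrite intrD mulrDl mul1r addrC.
have pw a b c d : a = b + c + d -> 2 `^ a = 2 `^ b * 2 `^ c * 2 `^ d :> R.
  by move=> ->; rewrite !powRD// pnatr_eq0 implybT.
have dh N : `|height R N.+1 - height R N| = height R N.+1 - height R N.
  by rewrite ger0_norm// subr_ge0 height_mono.
case: n => [[|N]|N] // n0.
  exists N, (- (height R N.+1 - height R N)); rewrite normrN dh; split => //.
  have e : N.+1%:Z + 1 = N.+2%:Z by lia.
  have e' : N%:Z + 1 = N.+1%:Z by lia.
  apply: pw; rewrite /level [fold_index (m, _).2]/= e /= !addn1 sS chiD e'.
  by rewrite !(intrD, intrM); ring.
exists N, (height R N.+1 - height R N); rewrite dh; split => //.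
apply: pw; rewrite /level/= chiD.
have -> : fold_index (Negz N + 1) = N.
  by case: N {n0} => // N; rewrite (_ : Negz N.+1 + 1 = Negz N)//; lia.
rewrite sS; have := @chiN ((N%:Z + 1)%:~R * alpha); rewrite irrat; last by lia.
rewrite (_ : Negz N = - (N%:Z + 1)); last by lia.
have -> : (- (N%:Z + 1))%:~R * alpha = - ((N%:Z + 1)%:~R * alpha) by rewrite intrN mulNr.
move=> /(_ isT) ->; move: (chi _) => c.
by rewrite !(intrD, intrM, intrN); ring.
Qed.

Lemma weight_ratio_bounds m n : n != 0 ->
  slope (m%:~R + n%:~R * alpha) / 2 <= weight (m, n + 1) / weight (m, n)
   <= 2 * slope (m%:~R + n%:~R * alpha).
Proof.
move=> /(weight_step m)[N [delta [-> dN _]]].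
have w0 := weight_gt0 (m, n).
rewrite (_ : _ / weight (m, n) = slope (m%:~R + n%:~R * alpha) * 2 `^ delta); last first.
  by field; rewrite lt0r_neq0.
have : `|delta| <= 1.
  rewrite dN (le_trans (@height_step R 0 N (or_introl erefl)))//.
  by rewrite ler_pdivrMr ?mul1r ?ltr0n// ler_nat (leq_trans _ (qs_ge17 0)).
rewrite ler_norml => /andP[d1 d2].
have s0 : 0 < slope (m%:~R + n%:~R * alpha) by rewrite powR_gt0.
rewrite [2 * _]mulrC !ler_pM2l//; apply/andP; split.
  by rewrite -powR_inv1// ler_powR ?ler1n.
by rewrite -[leRHS](powRr1 (ler0n R 2)) ler_powR ?ler1n.
Qed.

Lemma weight_ratio_cvg eps : 0 < eps -> exists N0 : nat, forall m n, (N0 < `|n|)%N ->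
  `|weight (m, n + 1) / weight (m, n) - slope (m%:~R + n%:~R * alpha)| <= eps.
Proof.
move=> e0.
have [eta eta0 etaP] : exists2 eta : R, 0 < eta & forall x, `|x| < eta -> `|2 `^ x - 1| < eps / 2.
  have c : {for 0, continuous (fun x : R => 2 `^ x)}.
    rewrite /powR pnatr_eq0/=; apply: continuous_comp; last exact: continuous_expR.
    exact: mulrr_continuous.
  have /cvgrPdist_lt/(_ (eps / 2) (divr_gt0 e0 (ltr0n _ 2))) := c.
  rewrite powRr0 => /nbhs_ballP[eta /= eta0 h]; exists eta => // x xe.
  by rewrite distrC; apply: h; rewrite /ball/= sub0r normrN.
have [K Keta] : exists K : nat, 16 / (qs K)%:R < eta.
  exists (Num.truncn (16 / eta)); set K := Num.truncn _.
  have /andP[_] := truncn_itv (divr_ge0 (ler0n R 16) (ltW eta0)).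
  rewrite ltr_pdivrMr// => h; rewrite ltr_pdivrMr ?ltr0n ?qs_gt0//.
  by rewrite (lt_le_trans h)// mulrC ler_pM2l// ler_nat qs_gt.
exists (t_end K).+1 => m n nK.
have n0 : n != 0 by apply: contraTneq nK => ->.
have [N [delta [-> dN Nn]]] := weight_step m n0.
have w0 := weight_gt0 (m, n).
rewrite (_ : _ - _ = slope (m%:~R + n%:~R * alpha) * (2 `^ delta - 1)); last first.
  by field; rewrite lt0r_neq0.
have s0 : 0 < slope (m%:~R + n%:~R * alpha) <= 2.
  by rewrite powR_gt0//= slopeE; case: ifP => _; lra.
have /etaP h : `|delta| < eta.
  rewrite dN; apply: le_lt_trans Keta; apply: height_step; right; lia.
rewrite normrM gtr0_norm; last by case/andP: s0.
case/andP: s0 => s0 s2; apply: (@le_trans _ _ (2 * (eps / 2))); last by lra.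
by rewrite ler_pM// ?ltW.
Qed.

(** Off the first tent the level is at least [N / (16 * qs k)], and it is also
    of order [qs k ^ 2] at least; together they bound [N ^ 2] by an
    exponential of the level. *)
Lemma weight_decay : exists2 C : R, 0 < C & forall m n,
  weight (m, n) <= C / (fold_index n).+1%:R ^+ 2.
Proof.
pose s N : R := (tent_sum alpha N)%:~R.
have [T TE] : exists T, T = t_end 0 by exists (t_end 0).
have w_le m n : weight (m, n) <= 2 `^ (`|s (fold_index n)| - height R (fold_index n)).
  rewrite ler_powR ?ler1n// opprD addrC lerD2r.
  rewrite /= -/(s (fold_index n)); move: (s _) => x.
  case: (par_pm m) => ->; last by rewrite intrN mulN1r opprK ler_norm.
  by rewrite mul1r -normrN ler_norm.
have [A AE] : exists A, A = 4096%N by exists 4096%N.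
have A0 : 0 < A%:R :> R by rewrite ltr0n AE.
pose C : R := A%:R + 2 `^ T%:R * T.+1%:R ^+ 2.
exists C => [|m n]; first by rewrite ltr_wpDr// mulr_ge0 ?powR_ge0 ?exprn_ge0.
apply: le_trans (w_le m n) _; set N := fold_index n.
have N0 : 0 < N.+1%:R ^+ 2 :> R by rewrite exprn_gt0.
rewrite ler_pdivlMr//.
have [NT|TN] := ltnP N T.
  apply: (@le_trans _ _ (2 `^ T%:R * T.+1%:R ^+ 2)); last by rewrite lerDr.
  rewrite ler_pM ?powR_ge0 ?exprn_ge0//; last by rewrite lerXn2r ?nnegrE ?ler_nat// ltnW.
  rewrite ler_powR ?ler1n//.
  have h0 := height_ge0 R N.
  have : `|s N| <= N%:R.
    have /andP[] := tent_sum_le alpha N; rewrite -!(ler_int R) intrN -pmulrn => l u.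
    by rewrite ler_norml; apply/andP; split.
  have NTR : N%:R <= T%:R :> R by rewrite ler_nat ltnW.
  lra.
have [k kN] : exists k, (t_end k <= N <= t_end k.+1)%N.
  have [j] : exists j, (N < t_end j)%N.
    by exists N; have [] := t_order N; lia.
  elim: j => [|j IH] Nj; first by move: TN; rewrite TE leqNgt Nj.
  have [|jN] := ltnP N (t_end j); first exact: IH.
  by exists j; rewrite jN ltnW.
have [_ hN] := height_dominates alphaP kN.
case/andP: kN => kN _.
pose y := (N %/ (16 * qs k))%N.
have q0 : (0 < 16 * qs k)%N by rewrite muln_gt0 qs_gt0.
have yN : (2 `^ y%:R : R) <= 2 `^ (height R N - `|s N|).
  rewrite ler_powR ?ler1n//; apply: le_trans hN.
  by rewrite ler_pdivlMr -?natrM ?ltr0n// ler_nat leq_divM.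
have key : (N.+1 ^ 2 <= A * 2 ^ y)%N.
  have c := cube_le_exp2 y.
  have Ny : (N.+1 <= 16 * qs k * (y + 1))%N by rewrite addn1 mulnC; exact: ltn_ceil.
  have qy : (qs k ^ 2 <= 2 * (y + 1))%N.
    have : (8 * qs k ^ 3 < 16 * qs k * (y + 1))%N by apply: leq_trans Ny.
    by rewrite expnS; have := qs_gt0 k; nia.
  apply: (@leq_trans ((16 * qs k * (y + 1)) ^ 2)); first by rewrite leq_exp2r.
  apply: (@leq_trans (512 * (y + 1) ^ 3)); last by lia.
  rewrite !expnMn (expnS _ 2).
  have -> : (16 ^ 2 = 256)%N by [].
  move: ((y + 1) ^ 2)%N (qs k ^ 2)%N qy => a b; nia.
apply: (@le_trans _ _ A%:R); last by rewrite lerDl mulr_ge0 ?powR_ge0 ?exprn_ge0.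
rewrite -opprB powRN mulrC ler_pdivrMr ?powR_gt0//.
apply: (@le_trans _ _ (A%:R * 2 `^ y%:R)); last by rewrite ler_pM2l.
by rewrite powR_mulrn ?ler0n// -!natrX -natrM ler_nat.
Qed.

Lemma weight_window eps : 0 < eps -> exists2 eta, 0 < eta < eps &
  forall d, weight d <= eta \/ 2 * eta <= weight d.
Proof.
move=> e0; pose k := Num.truncn eps^-1.
have wk : k%:R <= window R k.
  rewrite /window -[k%:R]add0r lerD ?height_ge0// ler_nat /tent_margin.
  by have := qs_gt k; lia.
exists (2 `^ (- (window R k + 1))).
  rewrite powR_gt0//= powRN invf_plt ?posrE ?powR_gt0//.
  have /andP[_ h] := truncn_itv (ltW (etrans (invr_gt0 eps) e0)).
  apply: lt_le_trans h _; rewrite -/k.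
  apply: (@le_trans _ _ (2 `^ k.+1%:R)).
    by rewrite powR_mulrn ?ler0n// -natrX ler_nat; exact/ltnW/ltn_expl.
  by rewrite ler_powR ?ler1n// -natr1; lra.
move=> [m n]; have := level_avoids_window alphaP k (fold_index n) (par_pm m).
rewrite -/(level m n) => -[h|h]; [right|left].
  rewrite -[X in X * _](powRr1 (ler0n R 2)) -powRD ?pnatr_eq0 ?implybT//.
  by rewrite ler_powR ?ler1n//=; lra.
by rewrite ler_powR ?ler1n//=; lra.
Qed.

End Weights.

(** * Distance to the nearest integer and truncation *)

Section NearestInteger.
Variable R : realType.
Implicit Types x y : R.

Definition dist_int x : R := `|x - (Num.floor (x + 2^-1))%:~R|.

Lemma dist_int_round x : `|x - (Num.floor (x + 2^-1))%:~R| <= 2^-1.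
Proof.
have /andP[l u] := floor_itv (x + 2^-1); rewrite intrD in u.
by rewrite ler_norml; apply/andP; split; lra.
Qed.

Lemma dist_int_le x (k : int) : dist_int x <= `|x - k%:~R|.
Proof.
have h := dist_int_round x; rewrite /dist_int; set r := Num.floor _ in h *.
have [->//|rk] := eqVneq k r.
have k1 : 1 <= `|(k - r)%:~R| :> R by rewrite -intr_norm ler1z; lia.
have := ler_normB (x - r%:~R) (x - k%:~R).
by rewrite (_ : _ - (x - k%:~R) = (k - r)%:~R); [lra|rewrite intrB; ring].
Qed.

Lemma dist_int_small x : `|x| <= 2^-1 -> dist_int x = `|x|.
Proof.
move=> x2; apply/eqP; rewrite eq_le; apply/andP; split.
  by have := dist_int_le x 0; rewrite subr0.
rewrite /dist_int; set r := Num.floor _.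
have [->|r0] := eqVneq r 0; first by rewrite subr0.
have r1 : 1 <= `|r%:~R| :> R by rewrite -intr_norm ler1z; lia.
have := ler_normB x (x - r%:~R).
by rewrite (_ : x - (x - r%:~R) = r%:~R); [lra|ring].
Qed.

Lemma dist_intD x (k : int) : dist_int (x + k%:~R) = dist_int x.
Proof.
rewrite /dist_int (addrAC x _ (2^-1)) floorDrz ?intr_int// intrKfloor intrD.
by congr `|_|; ring.
Qed.

Lemma dist_int_lip x y : dist_int x <= `|x - y| + dist_int y.
Proof.
rewrite [X in _ <= _ + X]/dist_int.
apply: le_trans (dist_int_le x (Num.floor (y + 2^-1))) _.
apply: le_trans (ler_normD _ _); rewrite le_eqVlt; apply/orP; left; apply/eqP.
by congr `|_|; ring.
Qed.

Lemma dist_int_continuous : continuous dist_int.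
Proof.
move=> x; apply/cvgrPdist_lt => e e0; near=> y.
have : `|x - y| < e by near: y; exact: cvgr_dist_lt.
have := dist_int_lip x y; have := dist_int_lip y x; rewrite (distrC y x).
by move=> *; rewrite ltr_norml; apply/andP; split; lra.
Unshelve. all: by end_near. Qed.

Definition pos_part x : R := (x + `|x|) / 2.

Lemma pos_part_ge0 x : 0 <= x -> pos_part x = x.
Proof. by move=> x0; rewrite /pos_part ger0_norm//; field. Qed.

Lemma pos_part_le0 x : x <= 0 -> pos_part x = 0.
Proof. by move=> x0; rewrite /pos_part ler0_norm// subrr mul0r. Qed.

Lemma pos_part_continuous : continuous pos_part.
Proof.
move=> x; apply: cvgM; last exact: cvg_cst.
by apply: cvgD; [exact: cvg_id|exact: norm_continuous].
Qed.

Definition clamp x : R := pos_part x - pos_part (x - 1).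

Lemma clamp_mid x : 0 <= x <= 1 -> clamp x = x.
Proof.
move=> /andP[x0 x1]; rewrite /clamp pos_part_ge0// pos_part_le0 ?subr0//.
by rewrite subr_le0.
Qed.

Lemma clamp_le0 x : x <= 0 -> clamp x = 0.
Proof. by move=> x0; rewrite /clamp !pos_part_le0 ?subrr//; lra. Qed.

Lemma clamp_ge1 x : 1 <= x -> clamp x = 1.
Proof. by move=> x1; rewrite /clamp !pos_part_ge0; lra. Qed.

Lemma clamp_itv x : 0 <= clamp x <= 1.
Proof.
have [x0|x0] := leP x 0; first by rewrite clamp_le0// lexx ler01.
have [x1|x1] := leP 1 x; first by rewrite clamp_ge1// ler01 lexx.
by rewrite clamp_mid ?ltW.
Qed.

Lemma clamp_continuous : continuous clamp.
Proof.
move=> x; apply: cvgB; first exact: pos_part_continuous.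
apply: (@continuous_comp _ _ _ (fun x => x - 1)); last exact: pos_part_continuous.
by apply: cvgB; [exact: cvg_id|exact: cvg_cst].
Qed.

End NearestInteger.

(** * Antiderivatives of functions known on a dense set *)

Section DenseAntiderivative.
Variables (R : realType) (V : set R) (F0 p : R -> R) (C : R).
Hypothesis V_dense : forall s t, s < t -> exists2 x, V x & s < x < t.
Hypothesis p_bound : forall x, 0 <= p x <= C.
Hypothesis p_cont : continuous p.
Hypothesis F0_diff : forall s t m M, V s -> V t -> s <= t ->
  (forall x, s <= x <= t -> m <= p x <= M) ->
  m * (t - s) <= F0 t - F0 s <= M * (t - s).

Let F0_lip s t : V s -> V t -> s <= t -> 0 <= F0 t - F0 s <= C * (t - s).
Proof.
by move=> Vs Vt st; have := F0_diff Vs Vt st (fun x _ => p_bound x); rewrite mul0r.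
Qed.

Let below x := [set F0 s | s in [set s | V s /\ s <= x]].
(* [F0] is monotone, so the supremum extends it. *)
Let F x := sup (below x).

Let below_sup x : has_sup (below x).
Proof.
split.
  have [|s Vs /andP[_ sx]] := @V_dense (x - 1) x; first by rewrite ltrBlDr ltrDl.
  by exists (F0 s), s => //; split => //; exact: ltW.
have [|t Vt /andP[xt _]] := @V_dense x (x + 1); first by rewrite ltrDl.
exists (F0 t) => _ [s [Vs sx] <-].
have := F0_lip Vs Vt (le_trans sx (ltW xt)); by rewrite subr_ge0 => /andP[].
Qed.

Let F_ge s x : V s -> s <= x -> F0 s <= F x.
Proof. by move=> Vs sx; apply: ub_le_sup; [case: (below_sup x)|exists s]. Qed.

Let F_le t x : V t -> x <= t -> F x <= F0 t.
Proof.
move=> Vt xt; apply: ge_sup; first by case: (below_sup x).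
move=> _ [s [Vs sx] <-]; have := F0_lip Vs Vt (le_trans sx xt).
by rewrite subr_ge0 => /andP[].
Qed.

Let F_V s : V s -> F s = F0 s.
Proof. by move=> Vs; apply/eqP; rewrite eq_le F_ge ?F_le. Qed.

Let F_mono x y : x <= y -> F x <= F y.
Proof.
move=> xy; apply: sup_le; [|by case: (below_sup x)|exact: below_sup].
move=> _ [s [Vs sx] <-]; exists (F0 s); split => //; exists s => //.
by split => //; exact: le_trans xy.
Qed.

(* The bounds on [p] over the interval survive the approximation of its ends
   by points of [V] from inside, and [F0] being Lipschitz controls the error. *)
Let F_diff x y m M : x < y -> (forall z, x <= z <= y -> m <= p z <= M) ->
  m * (y - x) <= F y - F x <= M * (y - x).
Proof.
move=> xy mM.
have C0 : 0 <= C by have /andP[/le_trans h /h] := p_bound 0.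
have M0 : 0 <= M.
  have /mM/andP[_] : x <= x <= y by rewrite lexx ltW.
  by apply: le_trans; have /andP[] := p_bound x.
have key d : 0 < d -> d < (y - x) / 2 ->
    F y - F x <= 4 * C * d + M * (y - x) /\
    exists2 e, y - x - 2 * d <= e <= y - x & m * e <= F y - F x.
  move=> d0 dxy.
  have [|s Vs /andP[s1 s2]] := @V_dense x (x + d); first by rewrite ltrDl.
  have [|s' Vs' /andP[s1' s2']] := @V_dense (x - d) x; first by rewrite ltrBlDr ltrDl.
  have [|t Vt /andP[t1 t2]] := @V_dense (y - d) y; first by rewrite ltrBlDr ltrDl.
  have [|t' Vt' /andP[t1' t2']] := @V_dense y (y + d); first by rewrite ltrDl.
  have st : s <= t by lra.
  have /(F0_diff Vs Vt st)/andP[l u] : forall z, s <= z <= t -> m <= p z <= M.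
    by move=> z /andP[z1 z2]; apply: mM; apply/andP; split; lra.
  have /andP[_ u1] := F0_lip Vt Vt' ltac:(lra).
  have /andP[_ u2] := F0_lip Vs' Vs ltac:(lra).
  have a1 := F_le Vt' (ltW t1'); have a2 := F_ge Vs' (ltW s2').
  have a3 := F_ge Vt (ltW t2); have a4 := F_le Vs (ltW s1).
  have b1 : C * (t' - t) <= C * (2 * d) by rewrite ler_wpM2l//; lra.
  have b2 : C * (s - s') <= C * (2 * d) by rewrite ler_wpM2l//; lra.
  have b3 : M * (t - s) <= M * (y - x) by rewrite ler_wpM2l//; lra.
  split; first lra.
  by exists (t - s); [apply/andP; split; lra|lra].
apply/andP; split; last first.
  apply/ler_addgt0Pr => e e0.
  pose d := Num.min (e / (4 * C + 1)) ((y - x) / 4).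
  have c1 : 0 < 4 * C + 1 by lra.
  have d0 : 0 < d by rewrite lt_min !divr_gt0// subr_gt0.
  have dy : d <= (y - x) / 4 by rewrite ge_min lexx orbT.
  have de : d * (4 * C + 1) <= e by rewrite -ler_pdivlMr// ge_min lexx.
  have [|h _] := key d d0; first by lra.
  by apply: le_trans h _; nra.
have [m0|m0] := leP m 0.
  by apply: (@le_trans _ _ 0); [rewrite mulr_le0_ge0// subr_ge0 ltW|rewrite subr_ge0 F_mono// ltW].
apply/ler_addgt0Pr => e e0.
pose d := Num.min (e / (2 * m)) ((y - x) / 4).
have c1 : 0 < 2 * m by lra.
have d0 : 0 < d by rewrite lt_min !divr_gt0// subr_gt0.
have dy : d <= (y - x) / 4 by rewrite ge_min lexx orbT.
have de : d * (2 * m) <= e by rewrite -ler_pdivlMr// ge_min lexx.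
have [|_ [f /andP[f1 f2] h]] := key d d0; first by lra.
have : m * (y - x - 2 * d) <= m * f by rewrite ler_pM2l.
by lra.
Qed.

(** [F0] satisfies the mean value inequality for [p] on [V], which passes to
    its monotone extension and, [p] being continuous, makes [p] the
    derivative of the extension. *)
Lemma antiderivative_from_dense : exists F : R -> R,
  (forall s, V s -> F s = F0 s) /\ forall x : R, is_derive x 1 F (p x).
Proof.
exists F; split=> [s|x]; first exact: F_V.
have lim : h^-1 *: (F (h *: 1 + x) - F x) @[h --> 0^'] --> p x.
  apply/cvgrPdist_le => e e0.
  have /cvgrPdist_le/(_ e e0) := @p_cont x.
  move=> /nbhs_ballP[d /= d0 pd].
  near=> h.
  have h0 : h != 0 by near: h; exact: nbhs_dnbhs_neq.
  have hd : `|h| < d by near: h; apply: dnbhs0_lt.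
  have pz z : `|z - x| <= `|h| -> p x - e <= p z <= p x + e.
    move=> zx; have : `|p x - p z| <= e.
      by apply: pd; rewrite /ball/= distrC (le_lt_trans zx).
    by rewrite ler_norml => /andP[]; move=> *; apply/andP; split; lra.
  rewrite /GRing.scale/= mulr1.
  have [hn|hp|h0'] := ltgtP h 0; last by rewrite h0' eqxx in h0.
    have /(F_diff (_ : h + x < x)) : forall z, h + x <= z <= x -> p x - e <= p z <= p x + e.
      move=> z /andP[z1 z2]; apply: pz; rewrite ler0_norm ?subr_le0// ltr0_norm//; lra.
    move=> /(_ ltac:(lra)) /andP[l u].
    rewrite ler_norml; apply/andP; split.
      rewrite lerNl opprB lerBlDr -(ler_nM2l hn) mulVKf//; lra.
    rewrite lerBlDr -lerBlDl -(ler_nM2l hn) mulVKf//; lra.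
  have /(F_diff (_ : x < h + x)) : forall z, x <= z <= h + x -> p x - e <= p z <= p x + e.
    move=> z /andP[z1 z2]; apply: pz; rewrite ger0_norm ?subr_ge0// gtr0_norm//; lra.
  move=> /(_ ltac:(lra)) /andP[l u].
  rewrite ler_norml; apply/andP; split.
    rewrite lerNl opprB lerBlDr -(ler_pM2l hp) mulVKf//; lra.
  rewrite lerBlDr -lerBlDl -(ler_pM2l hp) mulVKf//; lra.
apply: DeriveDef; first by apply: cvgP lim.
by apply: cvg_lim lim.
Unshelve. all: by end_near. Qed.

End DenseAntiderivative.

(** * Circle maps and their lifts *)

Lemma int_eq0 (k : int) : k < 1 -> -1 < k -> k = 0.
Proof. by lia. Qed.

Section CircleMaps.
Variable R : realType.
Local Open Scope quotient_scope.
Implicit Types (x y : R) (F G : R -> R).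

Lemma circle_projP x y : circle_proj x = circle_proj y <-> exists k : int, x = y + k%:~R.
Proof.
rewrite /circle_proj; split => [e|[k ->]].
  have /eqquotP : \pi_(circle R) x = \pi_(circle R) y by [].
  rewrite /=/circle_rel => /intrP[k kE]; exists k; rewrite -kE; ring.
apply/eqquotP; rewrite /=/circle_rel addrAC subrr add0r; exact: intr_int.
Qed.

Lemma circle_projD x (k : int) : circle_proj (x + k%:~R) = circle_proj x.
Proof. by apply/circle_projP; exists k. Qed.

Lemma circle_proj_repr (z : circle R) : circle_proj (repr z) = z.
Proof. exact: reprK. Qed.

Lemma circle_proj_continuous : continuous (@circle_proj R).
Proof. exact: pi_continuous. Qed.

Lemma circle_openP (A : set (circle R)) : open A <-> open (@circle_proj R @^-1` A).
Proof. by []. Qed.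

(** Independent of the representative when [F] commutes with the integer
    translations. *)
Definition circle_map F (z : circle R) : circle R := circle_proj (F (repr z)).

Lemma circle_mapE F : (forall x (k : int), F (x + k%:~R) = F x + k%:~R) ->
  forall x, circle_map F (circle_proj x) = circle_proj (F x).
Proof.
move=> FD x; rewrite /circle_map.
have [k ->] : exists k : int, repr (circle_proj x) = x + k%:~R.
  by apply/circle_projP; rewrite circle_proj_repr.
by rewrite FD circle_projD.
Qed.

End CircleMaps.

Section LiftDiffeo.
Variables (R : realType) (F p : R -> R) (c : R).
Hypothesis dF : forall x : R, is_derive x 1 F (p x).
Hypothesis p_cont : continuous p.
Hypothesis c_gt0 : 0 < c.
Hypothesis p_ge : forall x, c <= p x.
Hypothesis FD : forall x (k : int), F (x + k%:~R) = F x + k%:~R.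

Lemma lift_continuous : continuous F.
Proof. by move=> x; apply: differentiable_continuous; apply/derivable1_diffP; case: (dF x). Qed.

Lemma lift_mono : {mono F : x y / x < y}.
Proof.
apply/leW_mono/le_mono => x y xy.
have [|z zxy e] := MVT xy (fun z _ => dF z).
  exact/continuous_subspaceT/lift_continuous.
by rewrite -subr_gt0 e mulr_gt0 ?subr_gt0// (lt_le_trans c_gt0).
Qed.

Lemma lift_surj y : exists x, F x = y.
Proof.
pose k := Num.floor (y - F 0).
have /andP[l u] := floor_itv (y - F 0); rewrite -/k intrD in l u.
have e1 : F k%:~R = F 0 + k%:~R by have := FD 0 k; rewrite add0r.
have e2 : F (k%:~R + 1) = F 0 + k%:~R + 1 by rewrite -e1 (FD _ 1).
have [|||x _ <-] := @IVT _ F k%:~R (k%:~R + 1) y; last by exists x.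
- by rewrite lerDl.
- exact/continuous_subspaceT/lift_continuous.
- by rewrite ge_min le_max e1 e2; apply/andP; split; apply/orP; [left|right]; lra.
Qed.

Lemma lift_inverse : exists G : R -> R, [/\ cancel F G, cancel G F,
  forall x : R, is_derive x 1 G (p (G x))^-1, continuous G &
  forall x (k : int), G (x + k%:~R) = G x + k%:~R].
Proof.
have Finj : injective F.
  by apply: inc_inj; apply: le_mono => x y xy; rewrite lift_mono.
pose G y := projT1 (cid (lift_surj y)).
have GK : cancel G F by move=> y; exact: projT2 (cid (lift_surj y)).
have FK : cancel F G by move=> x; apply: Finj; rewrite GK.
have dG (x : R) : is_derive x 1 G (p (G x))^-1.
  rewrite -{1}(GK x); apply: is_derive_inverse.
  - by near=> y; exact: FK.
  - by near=> y; exact: lift_continuous.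
  - by rewrite lt0r_neq0// (lt_le_trans c_gt0).
exists G; split => //.
  by move=> x; apply: differentiable_continuous; apply/derivable1_diffP; case: (dG x).
by move=> x k; apply: Finj; rewrite FD !GK.
Unshelve. all: by end_near. Qed.

Lemma lift_circle_C1 : circle_C1 (circle_map F).
Proof.
exists F; split; first by split; [exact: lift_continuous|move=> x; rewrite circle_mapE].
  by move=> x; case: (dF x).
rewrite (_ : F^`()%classic = p)//; apply/funext => x.
by rewrite derive1E; apply: derive_val.
Qed.

End LiftDiffeo.

Lemma lift_circle_diffeo (R : realType) (F p : R -> R) (c : R) :
  (forall x : R, is_derive x 1 F (p x)) -> continuous p -> 0 < c ->
  (forall x, c <= p x) -> (forall x (k : int), F (x + k%:~R) = F x + k%:~R) ->
  circle_C1_diffeo (circle_map F) /\ orientation_preserving (circle_map F).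
Proof.
move=> dF pc c0 pge FD; have [G [FK GK dG Gc GD]] := lift_inverse dF c0 pge FD.
have Fm := lift_mono dF c0 pge.
split; last first.
  exists F; split; last by move=> x y; rewrite Fm.
  by split; [exact: lift_continuous dF|move=> x; rewrite circle_mapE].
exists (circle_map G); split.
- by move=> z; rewrite -(circle_proj_repr z) !circle_mapE// FK.
- by move=> z; rewrite -(circle_proj_repr z) !circle_mapE// GK.
- exact: lift_circle_C1 dF pc FD.
- apply: (lift_circle_C1 dG) => //; move=> x.
  apply: (@cvgV _ _ _ _ (p \o G)); first by rewrite lt0r_neq0// (lt_le_trans c0).
  by apply: continuous_comp; [exact: Gc|exact: pc].
Qed.

Lemma circle_proj_open (R : realType) (I : set R) :
  open I -> open (@circle_proj R @` I).
Proof.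
move=> oI; apply/circle_openP.
rewrite (_ : _ @^-1` _ = \bigcup_(k in [set: int]) ((fun t => t + k%:~R) @^-1` I)).
  apply: bigcup_open => k _; apply: open_comp => // x _.
  by apply: cvgD; [exact: cvg_id|exact: cvg_cst].
apply/seteqP; split => [t [s Is /circle_projP[k sE]]|t [k _ /= It]].
  by exists k => //=; rewrite -sE.
by exists (t + k%:~R) => //; rewrite circle_projD.
Qed.

(** * Cantor sets in the line *)

Section CantorSubset.
Variables (R : realType) (A : set R) (a0 : R).
Hypothesis Aa0 : A a0.
Hypothesis A_compact : compact A.
Hypothesis A_perfect : forall x eps, A x -> 0 < eps ->
  exists y, [/\ A y, y != x & `|x - y| < eps].
Hypothesis A_separated : forall x y, A x -> A y -> x < y ->
  exists c, ~ A c /\ x < c < y.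

#[local] HB.instance Definition _ :=
  isPointed.Build (set_type A) (exist _ a0 (mem_set Aa0)).

Local Notation T := (set_type A).

Let valA (x : T) : A (set_val x).
Proof. by apply: set_valP. Qed.

Let val_open (O : set R) : open O -> open (set_val @^-1` O : set T).
Proof. by move=> oO; exists O. Qed.

(* A point outside [A] cuts [A] into two clopen parts. *)
Let subset_zero_dimensional : zero_dimensional T.
Proof.
have sep (x y : T) : set_val x < set_val y ->
    exists U : set T, [/\ clopen U, U x & ~ U y].
  move=> xy; have [c [Ac /andP[xc cy]]] := A_separated (valA x) (valA y) xy.
  exists (set_val @^-1` [set t | t < c]); split => //=.
    split; first exact/val_open/open_lt.
    rewrite -openC (_ : ~` _ = set_val @^-1` [set t | c < t]); first exact/val_open/open_gt.
    apply/seteqP; split => z /=; last by move=> cz zc; have := lt_trans cz zc; rewrite ltxx.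
    move=> /negP; rewrite -leNgt le_eqVlt => /predU1P[cz|//].
    by case: Ac; rewrite cz; exact: valA.
  by apply/negP; rewrite -leNgt ltW.
move=> x y /eqP xy; case: (ltgtP (set_val x) (set_val y)) => [/sep//|/sep|/val_inj//].
move=> [U [[oU cU] Uy Ux]]; exists (~` U); split => //.
  by split; [exact: closed_openC|exact: open_closedC].
Qed.

Let subset_hausdorff : hausdorff_space T.
Proof.
rewrite open_hausdorff => x y xy.
have [U [[oU cU] Ux Uy]] := subset_zero_dimensional xy.
exists (U, ~` U) => /=; first by split; exact/mem_set.
by split => //; [exact: closed_openC|rewrite setICr].
Qed.

Let subset_compact : compact [set: T].
Proof.
move=> D PD _.
have [|x [Ax xD]] := @A_compact (set_val @ D) (fmap_proper_filter _ PD).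
  by apply: (@filterS _ D _ setT) => [z _ /=|]; [exact: valA|exact: filterT].
exists (exist _ x (mem_set Ax)); split => // B V DB [W [[Z oO <-] /= Ox] OV].
have [||_ [[b Bb <-] Ob]] := xD (set_val @` B) Z.
- by apply: (@filterS _ D _ B) DB => z Bz; exists z.
- by apply: open_nbhs_nbhs; split.
by exists b; split => //; apply: OV.
Qed.

Let subset_perfect : perfect_set [set: T].
Proof.
apply/perfectTP_ex => _ [Z oO <-] [x Ox].
have /nbhs_ballP[eps /= eps0 Oeps] : nbhs (set_val x) Z by apply: open_nbhs_nbhs; split.
have [y [Ay yx xy]] := A_perfect (valA x) eps0.
pose y' : T := exist _ y (mem_set Ay).
exists x, y'; split => //; first exact: Oeps.
by apply: contraNneq yx => /(congr1 set_val) /= ->.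
Qed.

(** Brouwer's characterization of the Cantor space, applied to the subtype of
    [A]. *)
Lemma homeomorphic_cantor_subset : homeomorphic_sets [set: cantor_space] A.
Proof.
have cT : cantor_like T by split.
have [f [fc fcl]] := homeomorphism_cantor_like cT.
pose g : T -> cantor_space := f^-1%FUN.
have gK x : g (f x) = x by rewrite /g funK ?inE.
have fK x : f (g x) = x by rewrite /g invK ?inE.
have gc : continuous g.
  apply/continuous_closedP => C cC; rewrite (_ : g @^-1` C = f @` C); first exact: fcl.
  by apply/seteqP; split => [x Cx|_ [y Cy <-]] /=; [exists (g x)|rewrite gK].
exists (set_val \o f), (valL g); split.
- split => [x _|x y _ _ /= /val_inj /(congr1 g)|x Ax]; first exact: valA.
    by rewrite !gK.
  by exists (g (exist _ x (mem_set Ax))) => //=; rewrite fK.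
- apply: continuous_subspaceT => x; apply: continuous_comp; first exact: fc.
  exact: initial_continuous.
- exact/subspace_valL_continuousP.
- move=> x _; rewrite -[RHS]gK -[in RHS](valLK point g).
  by [].
Qed.

End CantorSubset.

(** * Decreasing lists, ratios and arc lengths *)

Section Sorting.
Variables (R : realType) (T : choiceType).

Lemma finite_set_max (f : T -> R) (A : set T) c0 :
  finite_set A -> A c0 -> exists2 c, A c & forall c', A c' -> f c' <= f c.
Proof.
move=> finA Ac0; have /finite_seqP[s sA] := finA.
have As c : A c <-> c \in s by rewrite sA.
have s0 : s != [::] by apply: contraPneq Ac0 => s0 /As; rewrite s0.
suff [c cs h] : exists2 c, c \in s & forall c', c' \in s -> f c' <= f c.
  by exists c => [|c']; [exact/As|move=> /As; exact: h].
elim: s s0 {sA As} => // c s IH _; have [->|/IH[c1 c1s h]] := eqVneq s [::].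
  by exists c; rewrite ?mem_head// => c'; rewrite inE => /eqP ->.
have [cc|/ltW cc] := leP (f c) (f c1).
  by exists c1; [rewrite inE c1s orbT|move=> c'; rewrite inE => /predU1P[->//|/h]].
exists c; first by rewrite mem_head.
by move=> c'; rewrite inE => /predU1P[->//|/h /le_trans]; apply.
Qed.

Variables (D : set T) (f : T -> R).
Hypothesis D_infinite : infinite_set D.
Hypothesis f_gt0 : forall d, D d -> 0 < f d.
Hypothesis f_finite : forall eps, 0 < eps -> finite_set [set d | D d /\ eps <= f d].

Let remaining (s : seq T) : set T := D `\` [set` s].

Let has_next (s : seq T) :
  exists d, remaining s d /\ forall d', remaining s d' -> f d' <= f d.
Proof.
have [d0 rd0] : remaining s !=set0.
  by apply: infinite_setN0; apply: infinite_setD => //; exact: finite_seq.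
have fin : finite_set [set d | remaining s d /\ f d0 <= f d].
  apply: sub_finite_set (f_finite (f_gt0 rd0.1)) => d [[Dd _] dd]; by split.
have [d [rd dd] h] := finite_set_max f fin (conj rd0 (lexx _)).
exists d; split => // d' rd'; have [dd'|/ltW dd'] := leP (f d0) (f d'); first exact: h.
exact: le_trans dd.
Qed.

Let next (s : seq T) : T := projT1 (cid (has_next s)).
Let nextP s : remaining s (next s) /\ forall d', remaining s d' -> f d' <= f (next s).
Proof. exact: projT2 (cid (has_next s)). Qed.

Let prefix_of (n : nat) : seq T := iter n (fun s => next s :: s) [::].

Let mem_prefix n d : d \in prefix_of n <-> exists2 i, (i < n)%N & d = next (prefix_of i).
Proof.
elim: n => [|n IH]; first by split => // -[].
rewrite /= inE; split => [/predU1P[->|/IH[i iN ->]]|[i]].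
- by exists n.
- by exists i => //; exact: ltnW.
rewrite ltnS leq_eqVlt => /predU1P[->->|iN dE]; first by rewrite eqxx.
by apply/orP; right; apply/IH; exists i.
Qed.

(** Each step takes a largest remaining element.  An element [d] that is never
    taken would leave room for infinitely many elements of value at least
    [f d]. *)
Lemma decreasing_enumeration : exists s : nat -> T,
  set_bij [set: nat] D s /\ forall i, f (s i.+1) <= f (s i).
Proof.
pose s n := next (prefix_of n).
have s_new i j : (i < j)%N -> s i != s j.
  move=> ij; apply/eqP => sij; have [[_ +] _] := nextP (prefix_of j); apply.
  by apply/mem_prefix; exists i.
have s_inj : injective s.
  move=> i j sij; case: (ltngtP i j) => // /s_new; first by rewrite sij eqxx.
  by rewrite sij eqxx.
exists s; split; last first.
  move=> i; have [_ +] := nextP (prefix_of i); apply.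
  have [[Dd nd] _] := nextP (prefix_of i.+1); split => // /mem_prefix[j ji e].
  by apply: nd; apply/mem_prefix; exists j => //; exact: ltnW.
split => [i _|i j _ _|d Dd]; first by have [[]] := nextP (prefix_of i).
  exact: s_inj.
apply: contrapT => nd.
have ge i : f d <= f (s i).
  have [_ +] := nextP (prefix_of i); apply; split => // /mem_prefix[j _ e].
  by apply: nd; exists j.
apply: infinite_nat; rewrite -(preimage_setT s).
apply: (@sub_finite_set _ _ (s @^-1` [set d' | D d' /\ f d <= f d'])).
  by move=> i _; split => //; have [[]] := nextP (prefix_of i).
by apply: finite_preimage; [move=> i j _ _; exact: s_inj|exact/f_finite/f_gt0].
Qed.

End Sorting.

Section RatioLimsup.
Variables (R : realType) (lambda : nat -> R).
Hypothesis lambda_gt0 : forall i, 0 < lambda i.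
Hypothesis lambda_dec : forall i, lambda i.+1 <= lambda i.
Hypothesis lambda_window : forall eps, 0 < eps -> exists eta,
  [/\ 0 < eta, eta < eps, forall i, lambda i <= eta \/ 2 * eta <= lambda i &
      exists i, lambda i <= eta].

(** The last term above a window and the first one below it are consecutive,
    and a window below the [n]-th term comes after it. *)
Lemma ratio_ge2 n : exists2 i, (n <= i)%N & 2 <= lambda i / lambda i.+1.
Proof.
have [eta [eta0 etan H [j jeta]]] := lambda_window (lambda_gt0 n).
have dec k m : lambda (m + k)%N <= lambda m.
  by elim: k => [|k IH]; rewrite ?addn0// addnS (le_trans (lambda_dec _)).
have nj : (n <= j)%N.
  rewrite leqNgt; apply/negP => jn; have := dec (n - j)%N j.
  by rewrite subnKC ?(ltnW jn)//; lra.
have [i ni] : exists2 i, (n <= i)%N & 2 * eta <= lambda i /\ lambda i.+1 <= eta.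
  rewrite -(subnKC nj) in jeta; move: jeta; elim: (j - n)%N => [|k IH].
    by rewrite addn0; lra.
  rewrite addnS => h; case: (H (n + k)%N) => [/IH//|h']; exists (n + k)%N => //.
  exact: leq_addr.
move=> [h1 h2]; exists i => //; rewrite ler_pdivlMr//.
by apply: le_trans h1; rewrite ler_pM2l.
Qed.

Lemma ratio_limsup : (1 < limn_esup (fun i => (lambda i / lambda i.+1)%:E))%E.
Proof.
apply: (@lt_le_trans _ _ 2%:E); first by rewrite lte_fin ltr1n.
apply: le_ereal_inf_tmp => _ [V [n _ nV] <-].
have [i ni i2] := ratio_ge2 n.
apply: (@le_trans _ _ (lambda i / lambda i.+1)%:E); first by rewrite lee_fin.
by apply: ereal_sup_ubound; exists i => //; exact: nV.
Qed.

Lemma ratio_not_cvg1 : ~ ((fun i => lambda i / lambda i.+1) @ \oo --> (1 : R)).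
Proof.
move=> /cvgrPdist_lt/(_ _ ltr01) [n _ nV].
have [i ni i2] := ratio_ge2 n.
by have := nV i ni; rewrite /= ltr_norml; lra.
Qed.

End RatioLimsup.

Section ArcLength.
Variable R : realType.

(** A longer arc would contain an end of the arc of length [l], which is not a
    point of the latter because [l <= 1]. *)
Lemma arc_length_le (a b l m : R) : l <= 1 -> 0 < m ->
  @circle_proj R @` `]b, b + m[%classic `<=` @circle_proj R @` `]a, a + l[%classic ->
  m <= l.
Proof.
move=> l1 m0 sub.
have H t : b < t < b + m -> exists k : int, a + k%:~R < t < a + l + k%:~R.
  move=> tI; have [|s /= sI /circle_projP[k sE]] := sub (circle_proj t).
    by exists t => //=; rewrite in_itv.
  exists (- k); move: sI; rewrite in_itv/= sE intrN => /andP[? ?].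
  by apply/andP; split; lra.
have [|k /andP[k1 k2]] := H (b + m / 2); first by apply/andP; split; lra.
rewrite leNgt; apply/negP => lm.
have out t (j : int) : a + j%:~R < t -> t < a + l + j%:~R -> t = a + k%:~R \/ t = a + l + k%:~R -> False.
  move=> t1 t2 [tE|tE].
    have : j%:~R < k%:~R :> R by lra.
    rewrite ltr_int => jk; have : (j + 1)%:~R <= k%:~R :> R by rewrite ler_int; lia.
    by rewrite intrD; lra.
  have : k%:~R < j%:~R :> R by lra.
  have : j%:~R < k%:~R + 1 :> R by lra.
  by rewrite -[1]/(1%:~R) -intrD !ltr_int; lia.
have [h|h] := ltP b (a + k%:~R).
  have [|j /andP[j1 j2]] := H (a + k%:~R); first by apply/andP; split; lra.
  exact: out j1 j2 (or_introl erefl).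
have [|j /andP[j1 j2]] := H (a + l + k%:~R); first by apply/andP; split; lra.
exact: out j1 j2 (or_intror erefl).
Qed.

Lemma arc_length_unique (J : set (circle R)) (l m : R) :
  open_arc_of_length J l -> open_arc_of_length J m -> l = m.
Proof.
move=> [/andP[l0 l1] [a Ja]] [/andP[m0 m1] [b Jb]].
apply/eqP; rewrite eq_le; apply/andP; split.
  by apply: (@arc_length_le b a) => //; rewrite -Ja -Jb.
by apply: (@arc_length_le a b) => //; rewrite -Ja -Jb.
Qed.

End ArcLength.

Section ScaledSums.
Variable R : realType.

Lemma esum_scale_le (P : set (int * int)) (a b : int * int -> R) (K : R) : 0 <= K ->
  (forall c, 0 <= b c) -> (forall c, P c -> a c <= K * b c) ->
  (\esum_(c in P) (a c)%:E <= K%:E * \esum_(c in P) (b c)%:E)%E.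
Proof.
move=> K0 b0 ab; apply: ge_ereal_sup => _ [A [finA AP] <-].
apply: (@le_trans _ _ (\sum_(c \in A) (K * b c)%:E)%E).
  by apply: lee_fsum => // c Ac; rewrite lee_fin; exact/ab/AP.
rewrite (_ : (\sum_(c \in A) (K * b c)%:E = K%:E * \sum_(c \in A) (b c)%:E)%E); last first.
  rewrite ge0_mule_fsumr; last by move=> c; rewrite lee_fin.
  by apply: eq_fsbigr => c _; rewrite EFinM.
by rewrite lee_wpmul2l ?lee_fin//; apply: ereal_sup_ubound; exists A.
Qed.

End ScaledSums.

(** * Blowing up two orbits of a rotation *)

Section Blowup.
Variables (R : realType) (alpha : R) (w : int * int -> R).

(** The point of the line that is blown up into the gap [d].  The gaps that are
    indexed by [d] and [shift k d] lie over the same point of the circle of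
    length 2, and [step] is the rotation. *)
Definition th (d : int * int) : R := d.1%:~R + d.2%:~R * alpha.

Definition shift (k : int) (d : int * int) : int * int := (d.1 + 2 * k, d.2).

Definition step (d : int * int) : int * int := (d.1, d.2 + 1).

Definition between (x y : R) : set (int * int) := [set d | x <= th d < y].

Hypothesis irr : forall m n : int, m%:~R + n%:~R * alpha = 0 -> n = 0.
Hypothesis small : forall eps : R, 0 < eps ->
  exists a n : int, 0 < 2 * a%:~R + n%:~R * alpha < eps.
Hypothesis w_gt0 : forall d, 0 < w d.
Hypothesis w_shift : forall k d, w (shift k d) = w d.
Hypothesis w_total : (\esum_(d in between 0 2) (w d)%:E = 1)%E.

Let we0 d : (0 <= (w d)%:E)%E. Proof. by rewrite lee_fin ltW. Qed.

Lemma th_shift k d : th (shift k d) = th d + 2 * k%:~R.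
Proof. by rewrite /th /= intrD intrM; ring. Qed.

Lemma th_step d : th (step d) = th d + alpha.
Proof. by rewrite /th /= intrD mulrDl mul1r addrA. Qed.

Lemma shiftK k : cancel (shift k) (shift (- k)).
Proof. by case=> m n; rewrite /shift/= mulrN addrK. Qed.

Lemma shiftNK k : cancel (shift (- k)) (shift k).
Proof. by case=> m n; rewrite /shift/= mulrN subrK. Qed.

Lemma th_inj : injective th.
Proof.
case=> m n [m' n'] /eqP; rewrite /th /= -subr_eq0 => /eqP e.
have nn : n - n' = 0.
  by apply: (@irr (m - m')); rewrite -[RHS]e !intrB; ring.
have en : n = n' by lia.
move: e; rewrite en opprD addrACA subrr addr0 => /eqP.
by rewrite -intrB intr_eq0 subr_eq0 => /eqP ->.
Qed.

Lemma orbit_dense (x y : R) : x < y -> exists d, d.1 = 2 * (d.1 %/ 2)%Z /\ x < th d < y.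
Proof.
move=> xy; have [a [n /andP[g0 gxy]]] := small (etrans (subr_gt0 _ _) xy).
set g := _ + _ in g0 gxy; pose k := Num.floor (x / g) + 1.
exists (2 * (k * a), k * n); split=> /=; first by lia.
have -> : th (2 * (k * a), k * n) = k%:~R * g by rewrite /th/= !intrM /g; ring.
have /andP[l u] := floor_itv (x / g); apply/andP; split.
  by rewrite -ltr_pdivrMr.
rewrite /k intrD mulrDl mul1r; rewrite ler_pdivlMr// in l; lra.
Qed.

Definition mass (P : set (int * int)) : \bar R := \esum_(d in P) (w d)%:E.

Lemma mass_ge0 P : (0 <= mass P)%E. Proof. exact: esum_ge0. Qed.

Lemma mass_shift k P : mass (shift k @` P) = mass P.
Proof.
rewrite /mass esum_image; last by move=> d e _ _ /(can_inj (shiftK k)).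
by apply: eq_esum => d _; rewrite w_shift.
Qed.

Lemma massU P Q : [disjoint P & Q]%classic -> mass (P `|` Q) = (mass P + mass Q)%E.
Proof.
move=> /disj_setPS PQ; rewrite /mass (esumID P)//.
have -> : (P `|` Q) `&` P = P by apply/seteqP; split => [d []//|d Pd]; split => //; left.
have -> // : (P `|` Q) `&` ~` P = Q.
apply/seteqP; split => [d [[]//]|d Qd]; split; first by right.
by move=> Pd; exact: (PQ d).
Qed.

Lemma between_shift k x y : shift k @` between x y = between (x + 2 * k%:~R) (y + 2 * k%:~R).
Proof.
apply/seteqP; split => [_ [d /andP[xd dy] <-]|d /andP[xd dy]].
  by rewrite /between /= th_shift lerD2r ltrD2r xd.
exists (shift (- k) d); last exact: shiftNK.
by rewrite /between/= th_shift intrN mulrN lerBrDr ltrBlDr xd.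
Qed.

Lemma betweenU x y z : x <= y <= z -> between x z = between x y `|` between y z.
Proof.
move=> /andP[xy yz]; apply/seteqP; split => [d /andP[xd dz]|d].
  by have [dy|yd] := ltP (th d) y; [left|right]; rewrite /between/= ?xd ?yd ?dz ?dy.
by case=> /andP[xd dy]; rewrite /between/= ?xd ?(lt_le_trans dy)// (le_trans xy).
Qed.

Lemma mass_betweenU x y z : x <= y <= z ->
  mass (between x z) = (mass (between x y) + mass (between y z))%E.
Proof.
move=> xyz; rewrite (betweenU xyz) massU//; apply/disj_setPS => d [] /andP[_ dy] /andP[yd _].
by have := lt_le_trans dy yd; rewrite ltxx.
Qed.

Lemma mass_period x : mass (between x (x + 2)) = 1%E.
Proof.
have [y [k [-> y02]]] : exists y, exists k : int, x = y + 2 * k%:~R /\ 0 <= y < 2.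
  exists (x - 2 * (Num.floor (x / 2))%:~R), (Num.floor (x / 2)); split; first by rewrite subrK.
  have /andP[l u] := floor_itv (x / 2); move: u; rewrite intrD => u.
  by apply/andP; split; lra.
rewrite addrAC -between_shift mass_shift (@mass_betweenU _ 2); last by apply/andP; split; lra.
rewrite -(_ : shift 1 @` between 0 y = between 2 (y + 2)); last first.
  by rewrite between_shift; congr between; lra.
rewrite mass_shift addeC -mass_betweenU; first exact: w_total.
by apply/andP; split; lra.
Qed.

Lemma mass_fin x y : mass (between x y) \is a fin_num.
Proof.
have F n z : mass (between z (z + 2 * n%:R)) = n%:R%:E.
  elim: n z => [|n IH] z.
    rewrite mulr0 addr0 /mass (_ : between z z = set0) ?esum_set0//.
    by apply/seteqP; split => // d /andP[/le_lt_trans] /[apply]; rewrite ltxx.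
  rewrite (@mass_betweenU z (z + 2)).
    rewrite mass_period (_ : z + 2 * n.+1%:R = z + 2 + 2 * n%:R); last by rewrite -natr1; ring.
    by rewrite IH -EFinD nat1r.
  by rewrite lerDl lerD2l -natr1 ler_peMr//; have := ler0n R n; lra.
rewrite ge0_fin_numE ?mass_ge0//.
have [yx|xy] := leP y x.
  rewrite /mass (_ : between x y = set0) ?esum_set0//.
  apply/seteqP; split => // d /andP[/le_lt_trans] /[apply].
  by move=> /lt_le_trans /(_ yx); rewrite ltxx.
pose n := (Num.truncn (y - x)).+1.
have yn : y <= x + 2 * n%:R.
  have /andP[_] := truncn_itv (ltW (etrans (subr_gt0 x y) xy)); rewrite -/n.
  by have := ler0n R n; lra.
apply: (@le_lt_trans _ _ (mass (between x (x + 2 * n%:R)))); last by rewrite F ltry.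
by rewrite (@mass_betweenU x y (x + 2 * n%:R)) ?leeDl ?mass_ge0// (ltW xy).
Qed.

(** The total length of the gaps over the interval from [x] to [y]. *)
Definition mu (x y : R) : R := fine (mass (between x y)).

Lemma muE x y : mass (between x y) = (mu x y)%:E.
Proof. by rewrite /mu fineK// mass_fin. Qed.

Lemma mu_ge0 x y : 0 <= mu x y.
Proof. by rewrite fine_ge0// mass_ge0. Qed.

Lemma muD x y z : x <= y <= z -> mu x z = mu x y + mu y z.
Proof.
by move=> xyz; rewrite {1}/mu (mass_betweenU xyz) fineD ?mass_fin.
Qed.

Lemma mu_period x : mu x (x + 2) = 1.
Proof. by rewrite /mu mass_period. Qed.

(** The distribution function of the gap lengths, which sends a point to the
    left end of what replaces it.  Period 2 becomes period 1. *)
Definition pos (x : R) : R := if 0 <= x then mu 0 x else - mu x 0.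

Lemma posB x y : x <= y -> pos y - pos x = mu x y.
Proof.
rewrite /pos; case: (leP 0 y) => y0; case: (leP 0 x) => x0 xy.
- by rewrite (@muD 0 x y) ?x0 ?y0//; ring.
- by rewrite opprK addrC -muD ?(ltW x0) ?(ltW y0).
- by have := le_lt_trans x0 (le_lt_trans xy y0); rewrite ltxx.
- by rewrite (@muD x y 0) ?xy ?(ltW y0)//; ring.
Qed.

Lemma pos_mono x y : x <= y -> pos x <= pos y.
Proof. by move=> xy; rewrite -subr_ge0 posB// mu_ge0. Qed.

Lemma posD2 (k : int) x : pos (x + 2 * k%:~R) = pos x + k%:~R.
Proof.
have h y : pos (y + 2) = pos y + 1.
  have e : pos (y + 2) - pos y = 1 by rewrite posB ?mu_period// lerDl.
  lra.
have hn (n : nat) y : pos (y + 2 * n%:R) = pos y + n%:R.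
  elim: n => [|n IH]; first by rewrite mulr0 !addr0.
  by rewrite -(natr1 n) mulrDr mulr1 addrA h IH addrA.
case: k => n; first exact: hn.
have := hn n.+1 (x + 2 * (Negz n)%:~R).
by rewrite NegzE intrN mulrN -pmulrn subrK => ->; rewrite addrK.
Qed.

Definition lpt d : R := pos (th d).
Definition rpt d : R := lpt d + w d.

Lemma lt_lpt_rpt d : lpt d < rpt d.
Proof. by rewrite /rpt ltrDl w_gt0. Qed.

Lemma lpt_shift k d : lpt (shift k d) = lpt d + k%:~R.
Proof. by rewrite /lpt th_shift posD2. Qed.

Lemma rpt_shift k d : rpt (shift k d) = rpt d + k%:~R.
Proof. by rewrite /rpt lpt_shift w_shift addrAC. Qed.

Definition strictly_between d e : set (int * int) := [set c | th d < th c < th e].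

(** The gaps fill the space between two gaps, in measure. *)
Lemma mass_strictly_between d e : th d < th e ->
  mass (strictly_between d e) = (lpt e - rpt d)%:E.
Proof.
move=> de; rewrite /rpt opprD addrA /lpt posB ?(ltW de)// EFinB -muE.
have -> : between (th d) (th e) = [set d] `|` strictly_between d e.
  apply/seteqP; split => [c /andP[dc ce]|c [->|/andP[dc ce]]]; rewrite /between/= ?lexx ?de//.
    move: dc; rewrite le_eqVlt => /orP[/eqP/th_inj ->|dc]; first by left.
    by right; rewrite /strictly_between /= dc.
  by rewrite ltW.
rewrite massU; last first.
  by apply/disj_setPS => c [->]; rewrite /strictly_between/= ltxx.
by rewrite {2}/mass esum_set1// addeAC subee// ?add0e.
Qed.

(** Closed gaps are disjoint because other gaps, of positive length, lie between. *)
Lemma rpt_lt_lpt d e : th d < th e -> rpt d < lpt e.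
Proof.
move=> de; have [c [_ cde]] := orbit_dense de.
rewrite -subr_gt0 -lte_fin -mass_strictly_between//.
apply: (@lt_le_trans _ _ (w c)%:E); first by rewrite lte_fin.
apply: esum_ge; exists [set c]; last by rewrite fsbig_set1.
by split => // _ ->.
Qed.

(** * Density of the gaps *)

Lemma th_lt_lpt d e : (th d < th e) = (lpt d < lpt e).
Proof.
apply/idP/idP => [/rpt_lt_lpt|]; first exact: lt_trans (lt_lpt_rpt d).
by apply: contraTT; rewrite -!leNgt; exact: pos_mono.
Qed.

Definition gap d : set R := [set t | lpt d <= t <= rpt d].

Lemma gap_inj d e t : gap d t -> gap e t -> d = e.
Proof.
move=> /andP[d1 d2] /andP[e1 e2]; apply/th_inj/eqP.
by rewrite eq_le !leNgt; apply/andP; split; apply/negP => /rpt_lt_lpt; lra.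
Qed.

Lemma gap_shift k d t : gap (shift k d) (t + k%:~R) <-> gap d t.
Proof. by rewrite /gap/= lpt_shift rpt_shift !lerD2r. Qed.

(** Finitely many gaps left of [s] are among those before the last of them,
    whose total length is a difference of positions. *)
Lemma mass_below d s (P : set (int * int)) : lpt d <= s ->
  (forall c, P c -> th d <= th c /\ rpt c <= s) -> (mass P <= (s - lpt d)%:E)%E.
Proof.
move=> ds Ps; apply: ge_ereal_sup => _ [F [finF FP] <-].
have [F0|/set0P [f Ff]] := eqVneq F set0.
  by rewrite F0 fsbig_set0 lee_fin subr_ge0.
have [c cF h] := finite_set_max th finF Ff.
have [dc cs] := Ps _ (FP _ cF).
apply: (@le_trans _ _ (mass (between (th d) (th c) `|` [set c]))).
  apply: ereal_sup_ubound; exists F => //; split => // c' Fc'.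
  have := h _ Fc'; rewrite le_eqVlt => /orP[/eqP/th_inj ->|cc']; first by right.
  by left; rewrite /between/= cc' andbT; case: (Ps _ (FP _ Fc')).
rewrite massU; last first.
  by apply/disj_setPS => c' [/andP[_ +] /= e]; rewrite e ltxx.
rewrite {2}/mass esum_set1 ?lee_fin ?(ltW (w_gt0 c))// muE -posB//.
rewrite -EFinD lee_fin -/(lpt c) -/(lpt d).
by move: cs; rewrite /rpt; lra.
Qed.

Lemma mass_above e t (P : set (int * int)) : t <= lpt e ->
  (forall c, P c -> th c < th e /\ t <= lpt c) -> (mass P <= (lpt e - t)%:E)%E.
Proof.
move=> te Pt; apply: ge_ereal_sup => _ [F [finF FP] <-].
have [F0|/set0P [f Ff]] := eqVneq F set0.
  by rewrite F0 fsbig_set0 lee_fin subr_ge0.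
have [c cF h] := finite_set_max (fun c => - th c) finF Ff.
have [ce ct] := Pt _ (FP _ cF).
apply: (@le_trans _ _ (mass (between (th c) (th e)))).
  apply: ereal_sup_ubound; exists F => //; split => // c' Fc'.
  by rewrite /between/= -lerN2 h//; case: (Pt _ (FP _ Fc')).
by rewrite muE -posB; [rewrite lee_fin lerD2l lerN2|exact: ltW].
Qed.

(** The total length of the gaps between two gaps [d] and [e] is the distance
    from one to the other.  An interval without gaps between them would leave
    less room. *)
Lemma gaps_dense s t : s < t -> exists d, lpt d < t /\ s < rpt d.
Proof.
move=> st; apply: contrapT => no.
have nog d : rpt d <= s \/ t <= lpt d.
  have [|ds] := leP (rpt d) s; first by left.
  by have [|dt] := leP t (lpt d); [right|case: no; exists d].
have lpt0 k : lpt (2 * k, 0) = lpt (0, 0) + k%:~R.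
  by rewrite -lpt_shift /shift/= add0r.
have [d ds] : exists d, lpt d <= s.
  exists (2 * Num.floor (s - lpt (0, 0)), 0); rewrite lpt0.
  by have := floor_le (s - lpt (0, 0)); lra.
have [e te] : exists e, t <= lpt e.
  exists (2 * (Num.floor (t - lpt (0, 0)) + 1), 0); rewrite lpt0.
  by have := floorD1_gt (t - lpt (0, 0)); lra.
have de : th d < th e by rewrite th_lt_lpt; lra.
have : (lpt e - lpt d)%:E = mass (between (th d) (th e)).
  by rewrite /lpt posB ?muE// ltW.
set B := between _ _.
have -> : B = (B `&` [set c | rpt c <= s]) `|` (B `&` [set c | t <= lpt c]).
  apply/seteqP; split => [c Bc|c [][]//].
  by case: (nog c) => h; [left|right].
rewrite massU; last first.
  apply/disj_setPS => c [[_ /= c1] [_ /= c2]].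
  by have := lt_lpt_rpt c; lra.
move=> E.
have l1 : (mass (B `&` [set c | (rpt c <= s)%R]) <= (s - lpt d)%:E)%E.
  by apply: mass_below => // c [/andP[]].
have l2 : (mass (B `&` [set c | (t <= lpt c)%R]) <= (lpt e - t)%:E)%E.
  by apply: mass_above => // c [/andP[]].
have := leeD l1 l2; rewrite -E -EFinD lee_fin; lra.
Qed.

(** * The derivative of the lift *)

Hypothesis w01 : w (1, 0) = w (0, 0).
Hypothesis w_step0 : forall m, w (m, 1) = w (m, 0).
Hypothesis w_step_bounds : forall d, d.2 != 0 ->
  slope (th d) / 2 <= w (step d) / w d <= 2 * slope (th d).
Hypothesis w_step_cvg : forall eps, 0 < eps -> exists N0 : nat, forall d,
  (N0 < `|d.2|)%N -> `|w (step d) / w d - slope (th d)| <= eps.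

Definition w0 := w (0, 0).
Definition l1 := lpt (1, 0).
(** Centre and half-length of the arc between the gaps of 0 and 1. *)
Definition arc_c := (l1 + w0) / 2.
Definition arc_r := (l1 - w0) / 2.

Let w0_gt0 : 0 < w0. Proof. exact: w_gt0. Qed.

Lemma lpt00 : lpt (0, 0) = 0.
Proof.
have e : th (0, 0) = 0 by rewrite /th/= mul0r addr0.
by rewrite /lpt e; have := posB (lexx 0); rewrite subrr /pos lexx.
Qed.

Let w0_lt_l1 : w0 < l1.
Proof.
have : rpt (0, 0) < l1 by apply: rpt_lt_lpt; rewrite /th/= !mul0r !addr0 ltr01.
by rewrite /rpt lpt00 add0r.
Qed.

Let l1_lt1 : l1 + w0 < 1.
Proof.
have : rpt (1, 0) < lpt (shift 1 (0, 0)).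
  by apply: rpt_lt_lpt; rewrite th_shift /th/= !mul0r !addr0; lra.
by rewrite /rpt w01 lpt_shift lpt00 add0r.
Qed.

(** The continuous version of [slope] on the blown up circle: 1/2 on the arc
    from the gap of 0 to the gap of 1, 2 on the opposite arc, and linear on
    these two gaps. *)
Definition base (t : R) : R :=
  2^-1 + 3 / 2 * clamp ((dist_int (t - arc_c) - arc_r) / w0).

Lemma baseD (k : int) t : base (t + k%:~R) = base t.
Proof. by rewrite /base addrAC dist_intD. Qed.

Lemma base_continuous : continuous base.
Proof.
move=> t; apply: cvgD; first exact: cvg_cst.
apply: cvgM; first exact: cvg_cst.
apply: (@continuous_comp _ _ _ (fun t => (dist_int (t - arc_c) - arc_r) / w0)); last exact: clamp_continuous.
apply: cvgM; last exact: cvg_cst.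
apply: cvgB; last exact: cvg_cst.
apply: (@continuous_comp _ _ _ (fun t => t - arc_c)); last exact: dist_int_continuous.
by apply: cvgB; [exact: cvg_id|exact: cvg_cst].
Qed.

Lemma base_itv t : 2^-1 <= base t <= 2.
Proof.
rewrite /base; have := clamp_itv ((dist_int (t - arc_c) - arc_r) / w0).
by move: (clamp _) => c /andP[c0 c1]; apply/andP; split; lra.
Qed.

Let arc_bounds : [/\ 0 < arc_r, arc_r < arc_c, arc_c < 2^-1 & arc_c = arc_r + w0].
Proof.
have := w0_gt0; have := w0_lt_l1; have := l1_lt1; rewrite /arc_r /arc_c.
by move=> *; split; lra.
Qed.

Lemma base_arc1 t : w0 <= t <= l1 -> base t = 2^-1.
Proof.
move=> /andP[t1 t2]; have [r0 rc c2 cE] := arc_bounds.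
have tc : `|t - arc_c| <= arc_r.
  by rewrite ler_norml /arc_c /arc_r; apply/andP; split; lra.
rewrite /base dist_int_small; last by lra.
rewrite clamp_le0 ?mulr0 ?addr0//.
by rewrite pmulr_lle0 ?invr_gt0// subr_le0.
Qed.

Lemma base_arc2 t : l1 + w0 <= t <= 1 -> base t = 2.
Proof.
move=> /andP[t1 t2]; have [r0 rc c2 cE] := arc_bounds.
have x1 : arc_c <= t - arc_c by rewrite /arc_c; lra.
rewrite /base clamp_ge1; first by lra.
rewrite ler_pdivlMr// mul1r lerBrDl -cE /dist_int.
move: (Num.floor _) => k.
have [k0|k0] := leP k 0.
  rewrite ger0_norm; have : k%:~R <= 0 :> R by rewrite lerz0.
    by lra.
  by lra.
have : 1 <= k%:~R :> R by rewrite ler1z -gtz0_ge1.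
by rewrite distrC => k1; rewrite ger0_norm; lra.
Qed.

Lemma base_gap0 u : 0 <= u <= 1 -> base (u * w0) = 2 - 3 / 2 * u.
Proof.
move=> /andP[u0 u1]; have [r0 rc c2 cE] := arc_bounds.
have uw0 : 0 <= u * w0 by rewrite mulr_ge0// ltW.
have uw1 : u * w0 <= w0 by rewrite ler_piMl// ltW.
rewrite /base dist_int_small; last by rewrite ler0_norm; lra.
rewrite ler0_norm; last by lra.
rewrite (_ : _ / w0 = 1 - u); first by rewrite clamp_mid; [lra|apply/andP; split; lra].
by rewrite cE; field; rewrite lt0r_neq0.
Qed.

Lemma base_gap1 u : 0 <= u <= 1 -> base (l1 + u * w0) = 2^-1 + 3 / 2 * u.
Proof.
move=> /andP[u0 u1]; have [r0 rc c2 cE] := arc_bounds.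
have uw0 : 0 <= u * w0 by rewrite mulr_ge0// ltW.
have uw1 : u * w0 <= w0 by rewrite ler_piMl// ltW.
have xE : l1 + u * w0 - arc_c = arc_r + u * w0 by rewrite /arc_c /arc_r; lra.
rewrite /base xE dist_int_small; last by rewrite ger0_norm; lra.
rewrite ger0_norm; last by lra.
rewrite (_ : _ / w0 = u); first by rewrite clamp_mid// u0.
by field; rewrite lt0r_neq0.
Qed.

Lemma th_reduce d : exists k e, d = shift k e /\ 0 <= th e < 2.
Proof.
exists (Num.floor (th d / 2)), (shift (- Num.floor (th d / 2)) d).
rewrite shiftNK th_shift; split => //.
have /andP[l u] := floor_itv (th d / 2); move: u; rewrite intrD intrN => u.
by apply/andP; split; lra.
Qed.

Lemma slope_shift k d : slope (th (shift k d)) = slope (th d).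
Proof. by rewrite /slope th_shift chi_double. Qed.

(** The gaps with [d.2 = 0] are the two over the jumps of [slope], up to
    translation. *)
Variant base_on_gap_spec d : Prop :=
| BaseConst of d.2 != 0 & (forall u, 0 <= u <= 1 -> base (lpt d + u * w d) = slope (th d))
| BaseDown of d.2 = 0 & (forall u, 0 <= u <= 1 -> base (lpt d + u * w d) = 2 - 3 / 2 * u)
| BaseUp of d.2 = 0 & (forall u, 0 <= u <= 1 -> base (lpt d + u * w d) = 2^-1 + 3 / 2 * u).

Lemma base_on_gap d : base_on_gap_spec d.
Proof.
have [k [e [-> /andP[e0 e2]]]] := th_reduce d.
have H u : base (lpt (shift k e) + u * w (shift k e)) = base (lpt e + u * w e).
  by rewrite lpt_shift w_shift addrAC baseD.
have th0 m : th (m, 0) = m%:~R by rewrite /th/= mul0r addr0.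
have th00 : th (0, 0) = 0 by rewrite th0.
have th10 : th (1, 0) = 1 by rewrite th0.
have in_gap u : 0 <= u <= 1 -> lpt e <= lpt e + u * w e <= rpt e.
  move=> /andP[u0 u1]; rewrite /rpt lerDl lerD2l mulr_ge0 ?ler_piMl//; exact/ltW/w_gt0.
move: e0; rewrite le_eqVlt => /predU1P[e0|e0].
  have eE : e = (0, 0) by apply: th_inj; rewrite th00.
  apply: BaseDown; rewrite eE// => u u01.
  by rewrite -eE H eE lpt00 add0r base_gap0.
have [e1|e1|e1] := ltrgtP (th e) 1.
- apply: BaseConst => [|u u01].
    apply/eqP => /= e20; move: e0 e1; rewrite (surjective_pairing e) e20 th0 ltr0z ltrz1; lia.
  rewrite H slope_shift slopeE /chi (_ : Num.floor _ = 0).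
    rewrite base_arc1//.
    have := in_gap _ u01 => /andP[g1 g2].
    have := rpt_lt_lpt (etrans (congr1 (fun x => x < th e) th00) e0).
    have := rpt_lt_lpt (etrans (congr1 (fun x => th e < x) th10) e1).
    by rewrite /rpt -/w0 -/l1 lpt00 add0r in g2 *; move=> *; apply/andP; split; lra.
  by apply: floor_def; rewrite ltW.
- apply: BaseConst => [|u u01].
    apply/eqP => /= e20; move: e2 e1; rewrite (surjective_pairing e) e20 th0 ltr1z.
    by rewrite (_ : 2 = 2%:~R)// ltr_int; lia.
  rewrite H slope_shift slopeE /chi (_ : Num.floor _ = 1).
    rewrite base_arc2//.
    have := in_gap _ u01 => /andP[g1 g2].
    have := rpt_lt_lpt (etrans (congr1 (fun x => x < th e) th10) e1).
    have th20 : th (shift 1 (0, 0)) = 2 by rewrite th_shift th00; lra.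
    have := rpt_lt_lpt (etrans (congr1 (fun x => th e < x) th20) e2).
    rewrite lpt_shift lpt00 add0r /rpt -/l1 w01 -/w0 in g2 *.
    by move=> *; apply/andP; split; lra.
  by apply: floor_def; rewrite ltW//; lra.
have eE : e = (1, 0) by apply: th_inj; rewrite th10.
apply: BaseUp; rewrite eE// => u u01.
by rewrite -eE H eE -/l1 w01 base_gap1.
Qed.

Definition value_left d := base (lpt d).
Definition value_right d := base (rpt d).

Lemma base_lin d u : 0 <= u <= 1 ->
  base (lpt d + u * w d) = value_left d + (value_right d - value_left d) * u.
Proof.
have eM : value_left d = base (lpt d + 0 * w d) by rewrite mul0r addr0.
have eP : value_right d = base (lpt d + 1 * w d) by rewrite mul1r.
have i0 : ((0 : R) <= 0) && ((0 : R) <= 1) by rewrite lexx ler01.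
have i1 : ((0 : R) <= 1) && ((1 : R) <= 1) by rewrite lexx ler01.
by move=> u01; rewrite eM eP; case: (base_on_gap d) => _ H; rewrite !H//; ring.
Qed.

Lemma ends_slope d : d.2 != 0 -> value_left d = slope (th d) /\ value_right d = slope (th d).
Proof.
have eM : value_left d = base (lpt d + 0 * w d) by rewrite mul0r addr0.
have eP : value_right d = base (lpt d + 1 * w d) by rewrite mul1r.
rewrite eM eP; case: (base_on_gap d) => dn H d0; try by rewrite dn in d0.
by rewrite !H ?lexx ?ler01.
Qed.

(** What is lacking to the mean of [base] over the gap [d], which must be
    [w (step d) / w d] for the gap to be mapped onto the next one. *)
Definition mean_defect d := w (step d) / w d - (value_left d + value_right d) / 2.

Lemma mean_defect_bounds d : [/\ value_left d = slope (th d), value_right d = slope (th d),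
    - (slope (th d) / 2) <= mean_defect d & mean_defect d <= slope (th d)] \/
  [/\ mean_defect d = - 4^-1, value_left d + value_right d = 5 / 2,
    2^-1 <= value_left d & 2^-1 <= value_right d].
Proof.
have eM : value_left d = base (lpt d + 0 * w d) by rewrite mul0r addr0.
have eP : value_right d = base (lpt d + 1 * w d) by rewrite mul1r.
have i0 : ((0 : R) <= 0) && ((0 : R) <= 1) by rewrite lexx ler01.
have i1 : ((0 : R) <= 1) && ((1 : R) <= 1) by rewrite lexx ler01.
rewrite /mean_defect eM eP.
have r1 : d.2 = 0 -> w (step d) / w d = 1.
  case: d {eM eP} => m n /= ->.
  by rewrite /step/= add0r w_step0 divff// lt0r_neq0.
case: (base_on_gap d) => dn H; [left|right|right]; rewrite !H//.
- by have /andP[] := w_step_bounds dn => *; split => //; lra.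
- by rewrite r1//; split; lra.
- by rewrite r1//; split; lra.
Qed.

Lemma value_left_shift k d : value_left (shift k d) = value_left d.
Proof. by rewrite /value_left lpt_shift baseD. Qed.

Lemma value_right_shift k d : value_right (shift k d) = value_right d.
Proof. by rewrite /value_right rpt_shift baseD. Qed.

Lemma step_shift k d : step (shift k d) = shift k (step d). Proof. by []. Qed.

Lemma mean_defect_shift k d : mean_defect (shift k d) = mean_defect d.
Proof. by rewrite /mean_defect step_shift !w_shift value_left_shift value_right_shift. Qed.

(** On the gap [d], and its translates, six times the defect times [u (1 - u)],
    a parabola of mean equal to the defect; zero elsewhere.  This form is
    visibly continuous and periodic. *)
Definition bump d (t : R) : R :=
  6 * mean_defect d * pos_part (4^-1 - (dist_int (t - (lpt d + w d / 2)) / w d) ^+ 2).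

Lemma bump_shift k d t : bump (shift k d) t = bump d t.
Proof.
rewrite /bump mean_defect_shift w_shift lpt_shift.
rewrite (_ : t - (lpt d + k%:~R + w d / 2) = t - (lpt d + w d / 2) + (- k)%:~R).
  by rewrite dist_intD.
by rewrite intrN; ring.
Qed.

Lemma w_lt1 d : w d < 1.
Proof.
have : rpt d < lpt (shift 1 d) by apply: rpt_lt_lpt; rewrite th_shift; lra.
by rewrite /rpt lpt_shift ltrD2l.
Qed.

Lemma bump_gap d u : 0 <= u <= 1 -> bump d (lpt d + u * w d) = 6 * mean_defect d * (u * (1 - u)).
Proof.
move=> /andP[u0 u1]; have wd := w_gt0 d; have wd1 := w_lt1 d.
have e : lpt d + u * w d - (lpt d + w d / 2) = (u - 2^-1) * w d by ring.
have n : `|u - 2^-1| <= 2^-1 by rewrite ler_norml; apply/andP; split; lra.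
rewrite /bump e dist_int_small; last first.
  rewrite normrM (gtr0_norm wd); apply: le_trans n.
  by rewrite ler_piMr ?normr_ge0// ltW.
rewrite normrM (gtr0_norm wd) mulfK ?lt0r_neq0// real_normK ?num_real//.
congr (_ * _); rewrite pos_part_ge0; first by field.
by nra.
Qed.

Lemma bump_out d t : (forall k, ~ gap (shift k d) t) -> bump d t = 0.
Proof.
move=> out; rewrite /bump pos_part_le0 ?mulr0//.
have wd := w_gt0 d; rewrite subr_le0.
suff h : w d / 2 <= dist_int (t - (lpt d + w d / 2)).
  have : 2^-1 <= dist_int (t - (lpt d + w d / 2)) / w d by rewrite ler_pdivlMr// mulrC.
  by rewrite expr2; nra.
rewrite leNgt; apply/negP; rewrite /dist_int; set k := Num.floor _ => h.
apply: (out k); rewrite /gap/= lpt_shift rpt_shift /rpt.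
by move: h; rewrite ltr_norml => /andP[h1 h2]; apply/andP; split; lra.
Qed.

Lemma bump_continuous d : continuous (bump d).
Proof.
move=> t; apply: cvgM; first exact: cvg_cst.
apply: (@continuous_comp _ _ _ (fun t => 4^-1 - (dist_int (t - (lpt d + w d / 2)) / w d) ^+ 2));
  last exact: pos_part_continuous.
apply: cvgB; first exact: cvg_cst.
apply: (@continuous_comp _ _ _ (fun t => dist_int (t - (lpt d + w d / 2)) / w d) (fun x => x ^+ 2)); last exact: exprn_continuous.
apply: cvgM; last exact: cvg_cst.
apply: (@continuous_comp _ _ _ (fun t => t - (lpt d + w d / 2))); last exact: dist_int_continuous.
by apply: cvgB; [exact: cvg_id|exact: cvg_cst].
Qed.

(** Off the gaps the default value is harmless, as [bump] vanishes there. *)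
Definition gap_at (t : R) : int * int := xget (0, 0) [set d | gap d t].

Lemma gap_atE d t : gap d t -> gap_at t = d.
Proof.
move=> dt; rewrite /gap_at; case: xgetP => [e _ et|/(_ d)//].
exact: gap_inj et dt.
Qed.

Definition p (t : R) : R := base t + bump (gap_at t) t.

Lemma p_out t : (forall d, ~ gap d t) -> p t = base t.
Proof. by move=> out; rewrite /p bump_out ?addr0// => k; exact: out. Qed.

Lemma gap_param d t : gap d t -> exists2 u, 0 <= u <= 1 & t = lpt d + u * w d.
Proof.
move=> /andP[t1 t2]; have wd := w_gt0 d; exists ((t - lpt d) / w d).
  rewrite divr_ge0 ?subr_ge0 ?(ltW wd)//= ler_pdivrMr// mul1r.
  by move: t2; rewrite /rpt; lra.
by rewrite divfK ?lt0r_neq0//; ring.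
Qed.

Lemma param_gap d u : 0 <= u <= 1 -> gap d (lpt d + u * w d).
Proof.
move=> /andP[u0 u1]; rewrite /gap/= /rpt lerDl lerD2l mulr_ge0 ?ler_piMl//; exact/ltW/w_gt0.
Qed.

Lemma p_gap d u : 0 <= u <= 1 ->
  p (lpt d + u * w d) =
    value_left d + (value_right d - value_left d) * u + 6 * mean_defect d * (u * (1 - u)).
Proof.
by move=> u01; rewrite /p (gap_atE (param_gap d u01)) base_lin// bump_gap.
Qed.

Lemma pD (k : int) t : p (t + k%:~R) = p t.
Proof.
have [[d dt]|nt] := pselect (exists d, gap d t).
  have dt' : gap (shift k d) (t + k%:~R) by rewrite gap_shift.
  rewrite /p (gap_atE dt) (gap_atE dt') baseD bump_shift; congr (_ + _).
  by rewrite /bump addrAC dist_intD.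
rewrite !p_out ?baseD// => d dt; apply: nt; first by exists d.
by exists (shift (- k) d); apply/(gap_shift k); rewrite shiftNK.
Qed.

(** Positivity is what makes the map a diffeomorphism. *)
Lemma p_bounds t : 8^-1 <= p t <= 5.
Proof.
have [[d /gap_param[u u01 ->]]|nt] := pselect (exists d, gap d t); last first.
  rewrite p_out; last by move=> d dt; apply: nt; exists d.
  by have /andP[] := base_itv t => *; apply/andP; split; lra.
rewrite p_gap//; case/andP: u01 => u0 u1.
have v1 : u * (1 - u) <= 4^-1 by have := sqr_ge0 (u - 2^-1); rewrite expr2; lra.
have v0 : 0 <= u * (1 - u) by rewrite mulr_ge0// subr_ge0.
case: (mean_defect_bounds d) => [[-> -> k1 k2]|[kE ee em2 ep2]].
  have s12 : 2^-1 <= slope (th d) <= 2.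
    by rewrite slopeE; case: ifP => _; apply/andP; split; lra.
  case/andP: s12 => s1 s2.
  have : - (slope (th d) / 2) * (u * (1 - u)) <= mean_defect d * (u * (1 - u)) by rewrite ler_wpM2r.
  have : mean_defect d * (u * (1 - u)) <= slope (th d) * (u * (1 - u)) by rewrite ler_wpM2r.
  have : slope (th d) * (u * (1 - u)) <= slope (th d) * 4^-1 by rewrite ler_wpM2l//; lra.
  by rewrite subrr mul0r addr0 => *; apply/andP; split; lra.
have -> : value_left d = 5 / 2 - value_right d by lra.
rewrite kE; have : value_right d <= 2 by lra.
by move=> *; apply/andP; split; nra.
Qed.

Lemma bump_le d t : `|bump d t| <= 3 / 2 * `|mean_defect d|.
Proof.
rewrite /bump; set y := _ ^+ 2.
have y0 : 0 <= y by rewrite sqr_ge0.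
have /andP[b0 b1] : 0 <= pos_part (4^-1 - y) <= 4^-1.
  have [h|h] := leP 0 (4^-1 - y); first by rewrite pos_part_ge0// h lerBlDr lerDl.
  by rewrite pos_part_le0; [apply/andP; split; lra|exact: ltW].
rewrite normrM normrM (ger0_norm b0) (ger0_norm (ler0n R 6)).
have : 6 * `|mean_defect d| * pos_part (4^-1 - y) <= 6 * `|mean_defect d| * 4^-1.
  by rewrite ler_wpM2l// mulr_ge0.
by lra.
Qed.

Lemma mean_defect_small eps : 0 < eps -> exists N0 : nat, forall d,
  (N0 < `|d.2|)%N -> `|mean_defect d| <= eps.
Proof.
move=> /w_step_cvg[N0 H]; exists N0 => d dN; have := H d dN.
have dn : d.2 != 0 by apply: contraTneq dN => ->.
have [e1 e2] := ends_slope dn.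
by rewrite /mean_defect e1 e2 (_ : (_ + _) / 2 = slope (th d)); last by field.
Qed.

(** [base] plus finitely many bumps is continuous, and approximates [p]
    uniformly since the other bumps are small and disjoint. *)
Lemma p_continuous : continuous p.
Proof.
move=> t; apply/cvgrPdist_lt => e e0.
have [N0 HN] : exists N0 : nat, forall d, (N0 < `|d.2|)%N -> `|mean_defect d| <= e / 6.
  by apply: mean_defect_small; rewrite divr_gt0.
(* Representatives, up to translation, of the gaps with [`|d.2| <= N0]. *)
pose rep (x : 'I_2 * 'I_(2 * N0).+1) : int * int := (x.1%:Z, x.2%:Z - N0%:Z).
pose S t := base t + \sum_x bump (rep x) t.
have pS s : `|p s - S s| <= e / 4.
  have [[d ds]|ns] := pselect (exists d, gap d s); last first.
    rewrite p_out; last by move=> d ds; apply: ns; exists d.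
    rewrite /S big1 ?addr0 ?subrr ?normr0 ?divr_ge0 ?ltW// => x _.
    by apply: bump_out => k ks; apply: ns; exists (shift k (rep x)).
  have out x : (forall k, shift k (rep x) <> d) -> bump (rep x) s = 0.
    by move=> xd; apply: bump_out => k /(gap_inj ds)/esym; exact: xd.
  rewrite /p (gap_atE ds) /S opprD addrACA subrr add0r.
  have [dN|Nd] := ltnP N0 `|d.2|.
    rewrite big1 ?subr0 => [|x _].
      by apply: le_trans (bump_le d s) _; have := HN d dN; lra.
    apply: out => k xd; have e2 : x.2%:Z - N0%:Z = d.2 by rewrite -xd.
    by have := ltn_ord x.2; lia.
  have i2 : (`|(d.1 %% 2)%Z| < 2)%N by lia.
  have iN : (absz (d.2 + N0%:Z)%R < (2 * N0).+1)%N by lia.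
  pose x0 : 'I_2 * 'I_(2 * N0).+1 := (Ordinal i2, Ordinal iN).
  have x0d : shift (d.1 %/ 2)%Z (rep x0) = d.
    by rewrite /shift /rep/= [RHS]surjective_pairing; congr pair; lia.
  rewrite (bigD1 x0)//= big1 ?addr0.
    by rewrite -{1}x0d bump_shift subrr normr0 divr_ge0// ltW.
  move=> x xx0; apply: out => k xd; move/negP: xx0; apply; apply/eqP.
  have e1 : x.1%:Z + 2 * k = d.1 by rewrite -xd.
  have e2 : x.2%:Z - N0%:Z = d.2 by rewrite -xd.
  rewrite [LHS]surjective_pairing; congr pair; apply: val_inj => /=.
    by have := ltn_ord x.1; lia.
  by lia.
have Sc : {for t, continuous S}.
  apply: cvgD; first exact: base_continuous.
  elim: (index_enum _) => [|x r IH].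
    by under eq_fun do rewrite big_nil; rewrite big_nil; exact: cvg_cst.
  under eq_fun do rewrite big_cons; rewrite big_cons.
  by apply: cvgD IH; exact: bump_continuous.
have /cvgrPdist_lt/(_ (e / 2) (divr_gt0 e0 (ltr0n _ 2))) := Sc.
apply: filterS => s Sts.
rewrite (_ : p t - p s = (p t - S t) + (S t - S s) - (p s - S s)); last by ring.
have h1 := pS t; have h2 := pS s.
have h3 := ler_normB ((p t - S t) + (S t - S s)) (p s - S s).
have h4 := ler_normD (p t - S t) (S t - S s).
lra.
Qed.

(** * The lift *)

(** The antiderivative of [p] on the gap [d] that starts at the left end of the
    next gap; it ends at the right end of the next gap by the choice of
    [mean_defect]. *)
Definition glue d (t : R) : R :=
  let u := (t - lpt d) / w d in
  lpt (step d) + w d * (value_left d * u + (value_right d - value_left d) * u ^+ 2 / 2 +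
    mean_defect d * (3 * u ^+ 2 - 2 * u ^+ 3)).

Lemma glue_lpt d : glue d (lpt d) = lpt (step d).
Proof. by rewrite /glue subrr mul0r; ring. Qed.

Lemma glue_rpt d : glue d (rpt d) = rpt (step d).
Proof.
have wd : w d != 0 by rewrite lt0r_neq0.
have u1 : (rpt d - lpt d) / w d = 1 by rewrite /rpt; field.
by rewrite /glue u1 /rpt /mean_defect; field.
Qed.

(** On a gap [p] is a quadratic polynomial, for which Simpson's rule is exact,
    so the increment of [glue] is a weighted mean of three values of [p]. *)
Lemma glue_diff d s t m M : gap d s -> gap d t -> s <= t ->
  (forall x, s <= x <= t -> m <= p x <= M) ->
  m * (t - s) <= glue d t - glue d s <= M * (t - s).
Proof.
move=> ds dt st mM.
have [u u01 sE] := gap_param ds; have [v v01 tE] := gap_param dt.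
have wd := w_gt0 d.
have /andP[s1 s2] : m <= p s <= M by apply: mM; rewrite lexx.
have /andP[t1 t2] : m <= p t <= M by apply: mM; rewrite lexx st.
have /andP[h1 h2] : m <= p ((s + t) / 2) <= M by apply: mM; apply/andP; split; lra.
have -> : glue d t - glue d s = (t - s) * ((p s + 4 * p ((s + t) / 2) + p t) / 6).
  have e : (s + t) / 2 = lpt d + (u + v) / 2 * w d by rewrite sE tE; field.
  have uv01 : 0 <= (u + v) / 2 <= 1.
    by move/andP: u01 => [? ?]; move/andP: v01 => [? ?]; apply/andP; split; lra.
  have := p_gap d u01; rewrite -sE => ->; have := p_gap d v01; rewrite -tE => ->.
  rewrite e p_gap// /glue.
  have -> : (t - lpt d) / w d = v by rewrite tE; field; rewrite lt0r_neq0.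
  have -> : (s - lpt d) / w d = u by rewrite sE; field; rewrite lt0r_neq0.
  have -> : t - s = (v - u) * w d by rewrite sE tE; ring.
  by field.
have ts : 0 <= t - s by rewrite subr_ge0.
by apply/andP; split; nra.
Qed.

Lemma step_between d e : strictly_between (step d) (step e) = step @` strictly_between d e.
Proof.
apply/seteqP; split => [c|_ [c dce <-]]; last first.
  by rewrite /strictly_between/= !th_step !ltrD2r.
rewrite /strictly_between/= => dce; exists (c.1, c.2 - 1).
  have : th (step (c.1, c.2 - 1)) = th c by rewrite /step/= subrK -surjective_pairing.
  by rewrite th_step /= => e1; move: dce; rewrite -e1 !th_step !ltrD2r.
by rewrite /step/= subrK -surjective_pairing.
Qed.

Lemma mass_step_between d e : th d < th e ->
  (\esum_(c in strictly_between d e) (w (step c))%:E = (lpt (step e) - rpt (step d))%:E)%E.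
Proof.
move=> de; rewrite -mass_strictly_between ?th_step ?ltrD2r// step_between /mass esum_image//.
by move=> [m n] [m' n'] _ _ [-> /addIr ->].
Qed.

(** The increment from one gap to another is the total length of the gaps in
    between after the step, plus the two ends, and the bounds hold on each of
    these gaps. *)
Lemma glue_diff_across s t m M d e : gap d s -> gap e t -> s <= t ->
  (forall x, s <= x <= t -> m <= p x <= M) ->
  m * (t - s) <= glue e t - glue d s <= M * (t - s).
Proof.
move=> ds et st mM; have [de|ed|/th_inj de] := ltrgtP (th d) (th e); last first.
- by rewrite -de in et *; exact: glue_diff.
- by have := rpt_lt_lpt ed; case/andP: ds => ds _; case/andP: et => _ et; lra.
have dr : gap d (rpt d) by rewrite /gap/= lexx ltW// lt_lpt_rpt.
have el : gap e (lpt e) by rewrite /gap/= lexx ltW// lt_lpt_rpt.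
have le_de := rpt_lt_lpt de.
have /andP[ds1 ds2] := ds; have /andP[et1 et2] := et.
have /andP[a1 a2] := glue_diff ds dr ds2 (fun x h => mM x ltac:(by move/andP: h => [h1 h2]; apply/andP; split; lra)).
have /andP[b1 b2] := glue_diff el et et1 (fun x h => mM x ltac:(by move/andP: h => [h1 h2]; apply/andP; split; lra)).
rewrite glue_rpt in a1 a2; rewrite glue_lpt in b1 b2.
have inner c : strictly_between d e c -> m * w c <= w (step c) <= M * w c.
  move=> /andP[dc ce].
  have cl : gap c (lpt c) by rewrite /gap/= lexx ltW// lt_lpt_rpt.
  have cr : gap c (rpt c) by rewrite /gap/= lexx ltW// lt_lpt_rpt.
  have g1 := rpt_lt_lpt dc; have g2 := rpt_lt_lpt ce; have g3 := lt_lpt_rpt c.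
  have := glue_diff cl cr (ltW g3) (fun x h => mM x ltac:(by move/andP: h => [h1 h2]; apply/andP; split; lra)).
  rewrite glue_lpt glue_rpt.
  have -> : rpt c - lpt c = w c by rewrite /rpt; ring.
  by have -> : rpt (step c) - lpt (step c) = w (step c) by rewrite /rpt; ring.
have w0c c : 0 <= w c by exact/ltW/w_gt0.
have /andP[ps1 ps2] := mM s ltac:(by rewrite lexx st).
have /andP[ps3 _] := p_bounds s.
have M0 : 0 <= M by lra.
have mass0 : 0 <= lpt (step e) - rpt (step d).
  by rewrite subr_ge0; apply/ltW/rpt_lt_lpt; rewrite !th_step ltrD2r.
have up : lpt (step e) - rpt (step d) <= M * (lpt e - rpt d).
  rewrite -lee_fin EFinM -mass_step_between// -mass_strictly_between//.
  by apply: esum_scale_le => // c /inner /andP[].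
have lo : m * (lpt e - rpt d) <= lpt (step e) - rpt (step d).
  have [m0|m0] := leP m 0.
    by apply: le_trans mass0; rewrite mulr_le0_ge0// subr_ge0 ltW.
  rewrite -ler_pdivlMl// -lee_fin EFinM -mass_step_between// -mass_strictly_between//.
  apply: esum_scale_le => // [|c /inner /andP[h _]]; first by rewrite invr_ge0 ltW.
  by rewrite ler_pdivlMl.
by apply/andP; split; lra.
Qed.

(** The translation property is a consequence: the derivative is periodic, and
    the value at one gap fixes the constant. *)
Lemma lift_exists : exists F : R -> R,
  [/\ forall x : R, is_derive x 1 F (p x), forall t (k : int), F (t + k%:~R) = F t + k%:~R,
      forall d, F (lpt d) = lpt (step d) & forall d, F (rpt d) = rpt (step d)].
Proof.
have [||||F [FV dF]] := @antiderivative_from_dense R [set t | exists d, gap d t]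
  (fun t => glue (gap_at t) t) p 5.
- move=> s t st; have [d [d1 d2]] := gaps_dense st.
  have dd := lt_lpt_rpt d.
  pose a := Num.max s (lpt d); pose b := Num.min t (rpt d).
  have ab : a < b by rewrite lt_min !gt_max st d1 d2 dd.
  have sa : s <= a by rewrite le_max lexx.
  have da : lpt d <= a by rewrite le_max lexx orbT.
  have bt : b <= t by rewrite ge_min lexx.
  have bd : b <= rpt d by rewrite ge_min lexx orbT.
  exists ((a + b) / 2); last by apply/andP; split; lra.
  by exists d; apply/andP; split; lra.
- by move=> x; have /andP[] := p_bounds x => *; apply/andP; split; lra.
- exact: p_continuous.
- move=> s t m M [d ds] [e et] st mM; rewrite (gap_atE ds) (gap_atE et).
  exact: glue_diff_across.
have gl d : gap d (lpt d) by rewrite /gap/= lexx ltW// lt_lpt_rpt.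
have gr d : gap d (rpt d) by rewrite /gap/= lexx ltW// lt_lpt_rpt.
have Fl d : F (lpt d) = lpt (step d).
  by rewrite FV ?(gap_atE (gl d)) ?glue_lpt//; exists d; exact: gl.
have Fr d : F (rpt d) = rpt (step d).
  by rewrite FV ?(gap_atE (gr d)) ?glue_rpt//; exists d; exact: gr.
exists F; split => // t k.
have D (x : R) : is_derive x 1 (fun t : R => F (t + k%:~R) - F t) 0.
  have g1 : is_derive x 1 (fun t : R => t + k%:~R) 1.
    have := is_deriveD (is_derive_id x 1) (is_derive_cst (k%:~R : R) x 1).
    by rewrite addr0.
  have h1 : is_derive x 1 (fun t : R => F (t + k%:~R)) (p (x + k%:~R) * 1).
    exact: (@is_derive1_comp _ F (fun t : R => t + k%:~R) x _ _ (dF _) g1).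
  have := is_deriveB h1 (dF x).
  by rewrite pD mulr1 subrr.
have := is_derive_0_is_cst (lpt (0, 0)) t D.
by rewrite -lpt_shift !Fl step_shift lpt_shift; lra.
Qed.

(** * The invariant set and its minimality *)

Variable F : R -> R.
Hypothesis dF : forall x : R, is_derive x 1 F (p x).
Hypothesis FD : forall t (k : int), F (t + k%:~R) = F t + k%:~R.
Hypothesis F_lpt : forall d, F (lpt d) = lpt (step d).
Hypothesis F_rpt : forall d, F (rpt d) = rpt (step d).

Let p_ge x : 8^-1 <= p x. Proof. by have /andP[] := p_bounds x. Qed.
Let c8 : 0 < 8^-1 :> R. Proof. by rewrite invr_gt0. Qed.
Let F_lt : {mono F : x y / x < y}. Proof. exact: lift_mono dF c8 p_ge. Qed.
Let F_le : {mono F : x y / x <= y}. Proof. by apply: le_mono => x y; rewrite F_lt. Qed.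

Let G : R -> R := projT1 (cid (lift_inverse dF c8 p_ge FD)).
Let FK : cancel F G. Proof. by rewrite /G; case: cid => /= ? []. Qed.
Let GK : cancel G F. Proof. by rewrite /G; case: cid => /= ? []. Qed.
Let G_le : {mono G : x y / x <= y}. Proof. by move=> x y; rewrite -F_le !GK. Qed.

Definition unstep (d : int * int) : int * int := (d.1, d.2 - 1).

Lemma unstepK d : step (unstep d) = d.
Proof. by rewrite /step/= subrK -surjective_pairing. Qed.

Definition gaps : set R := [set t | exists d, lpt d < t < rpt d].
Definition cantor_line : set R := ~` gaps.

Lemma gapsD (k : int) t : gaps (t + k%:~R) <-> gaps t.
Proof.
split=> -[d dt]; last by exists (shift k d); rewrite lpt_shift rpt_shift !ltrD2r.
exists (shift (- k) d); rewrite lpt_shift rpt_shift intrN.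
by rewrite ltrBlDr ltrBrDr.
Qed.

(** [F] permutes the gaps. *)
Lemma gaps_lift t : gaps (F t) <-> gaps t.
Proof.
split=> -[d dt]; last by exists (step d); rewrite -F_lpt -F_rpt !F_lt.
by exists (unstep d); rewrite -F_lt F_lpt -[X in _ && X]F_lt F_rpt unstepK.
Qed.

Definition cantor_circle : set (circle R) := @circle_proj R @` cantor_line.

Lemma cantor_circleE t : cantor_circle (circle_proj t) <-> cantor_line t.
Proof.
split=> [[s Ks /circle_projP[k sE]] tU|]; last by exists t.
by apply: Ks; rewrite sE gapsD.
Qed.

Let f := circle_map F.
Let fE x : f (circle_proj x) = circle_proj (F x). Proof. exact: circle_mapE. Qed.

Lemma cantor_circle_invariant : f @` cantor_circle = cantor_circle.
Proof.
apply/seteqP; split => [_ [_ [t Kt <-] <-]|_ [t Kt <-]].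
  by rewrite fE; apply/cantor_circleE => /gaps_lift.
exists (circle_proj (G t)); last by rewrite fE GK.
by apply/cantor_circleE; rewrite /cantor_line/setC/= -gaps_lift GK.
Qed.

Definition iterz (n : int) : R -> R :=
  match n with Posz k => iter k F | Negz k => iter k.+1 G end.

Definition turn (n : int) (d : int * int) : int * int := (d.1, d.2 + n).

Lemma iterz_le n : {mono iterz n : x y / x <= y}.
Proof.
case: n => n x y /=; first by elim: n => //= n <-; rewrite F_le.
by rewrite G_le; elim: n => //= n <-; rewrite G_le.
Qed.

Let iterF_lpt n d : iter n F (lpt d) = lpt (turn n d).
Proof.
elim: n => [|n IH]; first by rewrite /turn addr0 -surjective_pairing.
by rewrite iterS IH F_lpt /step /turn/= -addrA; congr (lpt (_, _ + _)); lia.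
Qed.

Let iterFK n : cancel (iter n F) (iter n G).
Proof. by elim: n => // n IH x; rewrite iterSr /= FK IH. Qed.

Let iterGK n : cancel (iter n G) (iter n F).
Proof. by elim: n => // n IH x; rewrite iterSr /= GK IH. Qed.

Lemma turnNK n d : turn n (turn (- n) d) = d.
Proof. by rewrite /turn/= subrK -surjective_pairing. Qed.

Lemma iterz_lpt n d : iterz n (lpt d) = lpt (turn n d).
Proof.
case: n => n; first exact: iterF_lpt.
rewrite -[in LHS](turnNK n.+1 d) -iterF_lpt [iterz _ _](iterFK n.+1).
by rewrite NegzE.
Qed.

Lemma iterz_orbit n x : full_orbit f (circle_proj x) (circle_proj (iterz n x)).
Proof.
have it k y : iter k f (circle_proj y) = circle_proj (iter k F y).
  by elim: k => //= k ->; rewrite fE.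
case: n => n; first by exists n; left; rewrite it.
by exists n.+1; right; rewrite it iterGK.
Qed.

Lemma lpt_bounds x : lpt (2 * (Num.floor x - 1), 0) < x /\ x < lpt (2 * (Num.floor x + 1), 0).
Proof.
have e k : lpt (2 * k, 0) = k%:~R.
  by rewrite (_ : (2 * k, 0) = shift k (0, 0)) ?lpt_shift ?lpt00 /shift/= ?add0r.
have /andP[l u] := floor_itv x; rewrite !e; split=> //.
by rewrite intrB; lra.
Qed.

Lemma cantor_line_side t d : cantor_line t -> rpt d <= t \/ t <= lpt d.
Proof.
move=> Kt; have [|dt] := leP (rpt d) t; first by left.
by have [|td] := leP t (lpt d); [right|case: Kt; exists d; rewrite td].
Qed.

(** A point of the invariant set is enclosed between two gaps that are close in
    the rotation, though perhaps far apart on the line.  The gaps over the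
    multiples of a small element of the group generated by 2 and [alpha] run
    through the line, and the point lies between two consecutive ones. *)
Lemma cantor_line_rotation t eps : cantor_line t -> 0 < eps ->
  exists d e, [/\ rpt d <= t, t <= lpt e & th e - th d < eps].
Proof.
move=> Kt e0; have [a [n /andP[g0 ge]]] := small e0.
set g := _ + _ in g0 ge.
pose c (j : int) : int * int := (2 * (j * a), j * n).
have thc j : th (c j) = j%:~R * g by rewrite /th /c /g/= !intrM; ring.
have [b1 b2] := lpt_bounds t.
set dl := (2 * (Num.floor t - 1), 0) in b1.
set du := (2 * (Num.floor t + 1), 0) in b2.
pose j0 := Num.floor (th dl / g) - 1; pose j1 := Num.floor (th du / g) + 1.
have h0 : rpt (c j0) <= t.
  case: (cantor_line_side (c j0) Kt) => // tl.
  have : lpt (c j0) <= lpt dl.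
    apply: pos_mono; rewrite thc -ler_pdivlMr//; have := floor_le (th dl / g).
    by rewrite /j0 intrB; lra.
  by lra.
have h1 : t <= lpt (c j1).
  case: (cantor_line_side (c j1) Kt) => // tl.
  have : lpt du <= lpt (c j1).
    apply: pos_mono; rewrite thc -ler_pdivrMr//; have := floorD1_gt (th du / g).
    by move/ltW.
  by have := lt_lpt_rpt (c j1); lra.
have step_j (m : nat) : t <= lpt (c (j0 + m%:Z)) ->
    exists j, rpt (c j) <= t /\ t <= lpt (c (j + 1)).
  elim: m => [|m IH]; first by rewrite addr0; have := lt_lpt_rpt (c j0); lra.
  move=> tm; case: (cantor_line_side (c (j0 + m%:Z)) Kt) => [h|/IH//].
  by exists (j0 + m%:Z); split => //; move: tm; rewrite intS (addrC 1) addrA.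
have j01 : j0 <= j1.
  rewrite -(ler_int R) -(ler_pM2r g0) -!thc; apply: ltW; rewrite th_lt_lpt.
  by have := lt_lpt_rpt (c j0); have := lt_lpt_rpt (c j1); lra.
have [|j [j1' j2']] := step_j `|j1 - j0|%N.
  by rewrite gez0_abs ?subr_ge0// (addrC j0) subrK.
exists (c j), (c (j + 1)); split => //.
by rewrite !thc intrD mulrDl mul1r addrAC subrr add0r.
Qed.

(** Near any point of the invariant set there are two distinct gaps; if the
    point is the left end of a gap, both are found on its left. *)
Lemma cantor_line_gaps t eps : cantor_line t -> 0 < eps ->
  exists d e, [/\ th d < th e, t - eps < rpt d & lpt e < t + eps].
Proof.
move=> Kt e0.
have rlt d e : lpt d < rpt e -> th d <= th e.
  by move=> h; rewrite leNgt; apply/negP => /rpt_lt_lpt; lra.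
have [[c tc]|no] := pselect (exists c, t = lpt c).
  have rt d : lpt d < t -> rpt d < t.
    by rewrite tc => dc; apply: rpt_lt_lpt; rewrite th_lt_lpt.
  have [|d [d1 d2]] := @gaps_dense (t - eps) t; first by rewrite ltrBlDr ltrDl.
  have [|e [e1 e2]] := @gaps_dense (rpt d) t; first exact: rt.
  exists d, e; split => //; last by lra.
  rewrite lt_neqAle; apply/andP; split; last by apply: rlt; have := lt_lpt_rpt d; lra.
  by apply/eqP => /th_inj de; rewrite de in e2; lra.
have lt d : t < rpt d -> t < lpt d.
  move=> td; case: (cantor_line_side d Kt) => [|tl]; first lra.
  by rewrite lt_neqAle tl andbT; apply/eqP => tE; apply: no; exists d.
have [|e [e1 e2]] := @gaps_dense t (t + eps); first by rewrite ltrDl.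
have [|d [d1 d2]] := @gaps_dense t (lpt e); first exact: lt.
exists d, e; split => //; last by have := lt _ d2; have := lt_lpt_rpt d; lra.
by rewrite th_lt_lpt.
Qed.

(** To bring [x] close to [y], take two gaps [d'] and [e'] near [y], and two gaps
    around [x] at a rotation distance smaller than that of [d'] and [e'].
    A power of the rotation moves the latter between the former, and the same
    iterate of the lift moves [x] with them. *)
Lemma cantor_circle_minimal : minimal_on f cantor_circle.
Proof.
move=> _ [x Kx <-] _ [y Ky <-] B; rewrite nbhsE => -[W [oW Wy] WB].
have /nbhs_ballP[eps /= eps0 Weps] : nbhs y (@circle_proj R @^-1` W).
  by apply: open_nbhs_nbhs; split.
have [d' [e' [de' d'y e'y]]] := cantor_line_gaps Ky eps0.
have [d [e [dx xe ed]]] := cantor_line_rotation Kx (etrans (subr_gt0 (th d') (th e')) de').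
have [|q [q2 /andP[q3 q4]]] := @orbit_dense (th d' - th d) (th e' - th e); first by lra.
pose k := (q.1 %/ 2)%Z.
have thq c : th (shift k (turn q.2 c)) = th c + th q.
  by rewrite th_shift /th /= q2 -/k intrM !intrD; ring.
have l1' : rpt d' < iterz q.2 x + k%:~R.
  apply: (@lt_le_trans _ _ (lpt (shift k (turn q.2 d)))).
    by apply: rpt_lt_lpt; rewrite thq; lra.
  rewrite lpt_shift lerD2r -iterz_lpt iterz_le.
  by have := lt_lpt_rpt d; lra.
have l2' : iterz q.2 x + k%:~R < lpt e'.
  apply: (@le_lt_trans _ _ (lpt (shift k (turn q.2 e)))).
    by rewrite lpt_shift lerD2r -iterz_lpt iterz_le.
  by rewrite -th_lt_lpt thq; lra.
exists (circle_proj (iterz q.2 x)); split; first exact: iterz_orbit.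
rewrite -(circle_projD _ k); apply: WB; apply: Weps.
by rewrite /ball/= ltr_norml; apply/andP; split; lra.
Qed.

(** * Topology of the invariant set *)

Lemma gaps_dense_open s t : s < t -> exists c, [/\ gaps c & s < c < t].
Proof.
move=> st; have [d [d1 d2]] := gaps_dense st; have dd := lt_lpt_rpt d.
pose a := Num.max s (lpt d); pose b := Num.min t (rpt d).
have ab : a < b by rewrite lt_min !gt_max st d1 d2 dd.
have sa : s <= a by rewrite le_max lexx.
have da : lpt d <= a by rewrite le_max lexx orbT.
have bt : b <= t by rewrite ge_min lexx.
have bd : b <= rpt d by rewrite ge_min lexx orbT.
exists ((a + b) / 2); split; last by apply/andP; split; lra.
by exists d; apply/andP; split; lra.
Qed.

Lemma cantor_line_lpt d : cantor_line (lpt d).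
Proof.
move=> [e /andP[e1 e2]]; have := rpt_lt_lpt (etrans (th_lt_lpt e d) e1).
by lra.
Qed.

Lemma cantor_line_rpt d : cantor_line (rpt d).
Proof.
move=> [e /andP[e1 e2]]; have [de|ed] := ltP (th d) (th e).
  by have := rpt_lt_lpt de; lra.
have := pos_mono ed; rewrite -/(lpt e) -/(lpt d) le_eqVlt => /predU1P[ee|ed'].
  have : e = d by apply/th_inj/eqP; rewrite eq_le ed leNgt th_lt_lpt ee ltxx.
  by move=> ed'; rewrite ed' ltxx in e2.
by have := rpt_lt_lpt (etrans (th_lt_lpt e d) ed'); have := lt_lpt_rpt d; lra.
Qed.

(** One period of the invariant set.  It runs from the right end of the gap of 0
    to the left end of its translate, so that it is clopen in the
    invariant set and the circle is cut inside a gap. *)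
Definition cantor_window : set R := cantor_line `&` [set t | w0 <= t <= 1].

Lemma cantor_line_window t : cantor_line t -> 0 < t < 1 + w0 -> cantor_window t.
Proof.
move=> Kt /andP[t0 t1]; split=> //=.
have := cantor_line_side (0, 0) Kt; have := cantor_line_side (shift 1 (0, 0)) Kt.
rewrite lpt_shift rpt_shift /rpt lpt00 !add0r -/w0.
have ww : 0 < w0 by exact: w_gt0.
by move=> [] ? [] ?; apply/andP; split; lra.
Qed.

Lemma open_gaps : open gaps.
Proof.
rewrite (_ : gaps = \bigcup_(d in [set: int * int]) `]lpt d, rpt d[%classic).
  by apply: bigcup_open => d _; exact: interval_open.
apply/seteqP; split => [t [d dt]|t [d _ /=]]; first by exists d => //=; rewrite in_itv.
by rewrite in_itv => dt; exists d.
Qed.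

Lemma compact_cantor_window : compact cantor_window.
Proof.
apply: (@subclosed_compact _ _ `[w0, 1]%classic); last 2 first.
- exact: segment_compact.
- by move=> t [_]; rewrite /= in_itv.
apply: closedI; first by apply: open_closedC; exact: open_gaps.
rewrite (_ : [set t | _] = `[w0, 1]%classic); first exact: interval_closed.
by apply/seteqP; split => t /=; rewrite in_itv.
Qed.

(** The ends of the gaps near [x] belong to the invariant set. *)
Lemma perfect_cantor_window x eps : cantor_window x -> 0 < eps ->
  exists y, [/\ cantor_window y, y != x & `|x - y| < eps].
Proof.
move=> [Kx /andP[x0 x1]] eps0; have ww : 0 < w0 by exact: w_gt0.
have e0 : 0 < Num.min eps w0 by rewrite lt_min eps0.
have le1 : Num.min eps w0 <= eps by rewrite ge_min lexx.
have le2 : Num.min eps w0 <= w0 by rewrite ge_min lexx orbT.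
have [d [e [de xd ex]]] := cantor_line_gaps Kx e0.
have rl := rpt_lt_lpt de.
have Wd : cantor_window (rpt d).
  by apply: cantor_line_window; [exact: cantor_line_rpt|apply/andP; split; lra].
have We : cantor_window (lpt e).
  by apply: cantor_line_window; [exact: cantor_line_lpt|apply/andP; split; lra].
have [dx|dx] := eqVneq (rpt d) x; [exists (lpt e)|exists (rpt d)]; split => //.
- by rewrite -dx gt_eqF.
- by rewrite ltr_norml; apply/andP; split; lra.
- by rewrite ltr_norml; apply/andP; split; lra.
Qed.

(** On the invariant set this inverts the projection of [cantor_window]. *)
Definition unroll (z : circle R) : R :=
  repr z - (Num.floor (repr z - w0))%:~R.

Lemma unrollK z : circle_proj (unroll z) = z.
Proof. by rewrite /unroll -intrN circle_projD circle_proj_repr. Qed.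

Lemma unroll_window z : cantor_circle z -> cantor_window (unroll z).
Proof.
rewrite -{1}(unrollK z) => /cantor_circleE Kz; apply: cantor_line_window => //.
have /andP[l u] := floor_itv (repr z - w0); move: u; rewrite intrD => u.
have ww : 0 < w0 by exact: w_gt0.
by rewrite /unroll; apply/andP; split; lra.
Qed.

Lemma window_proj_inj s t : cantor_window s -> cantor_window t ->
  circle_proj s = circle_proj t -> s = t.
Proof.
move=> [_ /andP[s1 s2]] [_ /andP[t1 t2]] /circle_projP[k sE].
have ww : 0 < w0 by exact: w_gt0.
suff k0 : k = 0 by rewrite sE k0 addr0.
have : -1 < k%:~R :> R by lra.
have : k%:~R < 1 :> R by lra.
by rewrite ltrz1 -[-1]/((-1)%:~R) ltr_int => /int_eq0; apply.
Qed.

Lemma unroll_proj t : cantor_window t -> unroll (circle_proj t) = t.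
Proof.
move=> Wt; apply: window_proj_inj => //; last exact: unrollK.
by apply: unroll_window; apply/cantor_circleE; case: Wt.
Qed.

(** Near the ends of the window continuity comes from the gap: a point of the
    invariant set that projects close to an end is in the window itself. *)
Lemma unroll_cvg z : cantor_circle z ->
  unroll @ within cantor_circle (nbhs z) --> within cantor_window (nbhs (unroll z)).
Proof.
move=> Kz B; rewrite /within /= => /nbhs_ballP[eps /= eps0 epsB].
have ww : 0 < w0 by exact: w_gt0.
pose t := unroll z; pose e := Num.min eps w0.
have e0 : 0 < e by rewrite lt_min eps0.
have le1 : e <= eps by rewrite ge_min lexx.
have le2 : e <= w0 by rewrite ge_min lexx orbT.
have [Kt /andP[t0 t1]] := unroll_window Kz; rewrite -/t in Kt t0 t1.
have : nbhs z (@circle_proj R @` `]t - e, t + e[%classic).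
  apply: open_nbhs_nbhs; split; first by apply: circle_proj_open; exact: interval_open.
  by exists t; rewrite ?unrollK//= in_itv/= ltrBlDr ltrDl e0.
apply: filterS => z' [s sI <-] /cantor_circleE Ks.
move: sI; rewrite /= in_itv/= => /andP[s1 s2].
have Ws : cantor_window s by apply: cantor_line_window => //; apply/andP; split; lra.
rewrite unroll_proj//; apply: epsB => //.
by rewrite /ball/= -/t ltr_norml; apply/andP; split; lra.
Qed.

Lemma homeomorphic_cantor_circle : homeomorphic_sets [set: cantor_space] cantor_circle.
Proof.
have W0 : cantor_window w0.
  apply: cantor_line_window; last first.
    have ww : 0 < w0 by exact: w_gt0.
    by apply/andP; split; lra.
  by have := @cantor_line_rpt (0, 0); rewrite /rpt lpt00 add0r.
have [|h [g [hbij hc gc gh]]] :=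
  homeomorphic_cantor_subset W0 compact_cantor_window perfect_cantor_window.
  move=> x y _ _ xy; have [c [gc cxy]] := gaps_dense_open xy.
  by exists c; split => // -[].
have [hA hinj hsurj] := hbij.
exists (@circle_proj R \o h), (g \o unroll); split.
- split => [x _|x y _ _ /= e|z Kz].
  + by apply/cantor_circleE; case: (hA x).
  + by apply: hinj; rewrite ?inE//; apply: window_proj_inj => //; apply: hA.
  + have [x _ hx] := hsurj _ (unroll_window Kz).
    by exists x => //=; rewrite hx unrollK.
- apply/subspace_continuousP => x _.
  apply: cvg_comp; last exact: circle_proj_continuous.
  by move/subspace_continuousP : hc; apply.
- apply/subspace_continuousP => z Kz.
  apply: cvg_comp; first exact: unroll_cvg.
  by move/subspace_continuousP : gc; apply; exact: unroll_window.
- by move=> x _ /=; rewrite unroll_proj; [exact: gh|exact: hA].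
Qed.

(** * Components of the complement *)

Definition arc d : set (circle R) := @circle_proj R @` `]lpt d, rpt d[%classic.

Lemma in_arc d t : lpt d < t < rpt d -> arc d (circle_proj t).
Proof. by move=> dt; exists t => //=; rewrite in_itv. Qed.

Lemma arc_overlap d e z : arc d z -> arc e z -> exists k, e = shift k d.
Proof.
move=> [t /= td <-] [s /= se /circle_projP[k sE]]; exists k.
move: td se; rewrite !in_itv/= => /andP[d1 d2] /andP[e1 e2].
apply: (@gap_inj _ _ s); first by rewrite /gap/= !ltW.
by rewrite sE gap_shift /gap/= !ltW.
Qed.

Lemma arc_shift k d : arc (shift k d) = arc d.
Proof.
apply/seteqP; split => [_ [t /= td <-]|_ [t /= td <-]].
  rewrite -(circle_projD t (- k)); apply: in_arc; move: td.
  by rewrite in_itv/= lpt_shift rpt_shift intrN ltrBDr ltrBlDr.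
rewrite -(circle_projD t k); apply: in_arc; move: td.
by rewrite in_itv/= lpt_shift rpt_shift !ltrD2r.
Qed.

Lemma arc_compl z : (~` cantor_circle) z <-> exists d, arc d z.
Proof.
rewrite -(circle_proj_repr z); split=> [nK|[d [t /= td <-]]].
  have [d dt] : gaps (repr z) by apply: contrapT => ng; apply: nK; apply/cantor_circleE.
  by exists d; exact: in_arc.
by move=> /cantor_circleE; apply; exists d; move: td; rewrite in_itv.
Qed.

Lemma arc_open d : open (arc d).
Proof. by apply: circle_proj_open; exact: interval_open. Qed.

Lemma arc_connected d : connected (arc d).
Proof.
apply: connected_continuous_connected; last first.
  exact/continuous_subspaceT/circle_proj_continuous.
by apply/connected_intervalP; exact: interval_is_interval.
Qed.

(** An arc is connected, and open and closed in the complement, as the union of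
    the other arcs is open. *)
Lemma component_arc d z : arc d z -> connected_component (~` cantor_circle) z = arc d.
Proof.
move=> dz; apply/seteqP; split; last first.
  apply: connected_component_max => //; last exact: arc_connected.
  by move=> y dy; apply/arc_compl; exists d.
set C := connected_component _ _.
have CK : C `<=` ~` cantor_circle := @connected_component_sub _ _ _.
have Cz : C z by apply: connected_component_refl; apply/arc_compl; exists d.
suff -> : C = C `&` arc d by move=> y [].
apply/esym; apply: (@component_connected _ (~` cantor_circle) z).
- by exists z.
- by exists (arc d) => //; exact: arc_open.
exists (~` \bigcup_(e in [set e | ~ exists k, e = shift k d]) arc e).
  by apply: open_closedC; apply: bigcup_open => e _; exact: arc_open.
apply/seteqP; split => y [Cy dy]; split=> //.
  by move=> [e /= ne ye]; apply: ne; exact: arc_overlap dy ye.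
have /arc_compl[e ye] := CK _ Cy.
have [[k ek]|ne] := pselect (exists k, e = shift k d).
  by rewrite -(arc_shift k) -ek.
by case: dy; exists e.
Qed.

Lemma arc_has_length d : open_arc_of_length (arc d) (w d).
Proof. by split; [rewrite w_gt0 ltW// w_lt1|exists (lpt d)]. Qed.

(** One index for each gap of the circle. *)
Definition gap_reps : set (int * int) := [set d | 0 <= d.1 < 2].

Lemma gap_reps_shift d : exists k, gap_reps (shift k d).
Proof. by exists (- (d.1 %/ 2)%Z); rewrite /gap_reps/=; lia. Qed.

Lemma gap_reps_inj d e k : gap_reps d -> gap_reps e -> e = shift k d -> e = d.
Proof.
rewrite /gap_reps/= => d01 e01 eE; move: e01; rewrite eE /shift/= => e01.
by rewrite (_ : k = 0) ?mulr0 ?addr0 -?surjective_pairing//; lia.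
Qed.

Hypothesis w_small : forall eps, 0 < eps -> finite_set [set d | gap_reps d /\ eps <= w d].
Hypothesis w_window : forall eps, 0 < eps -> exists2 eta, 0 < eta < eps &
  forall d, w d <= eta \/ 2 * eta <= w d.

Lemma gap_reps_infinite : infinite_set gap_reps.
Proof.
move=> fin; apply: infinite_nat.
have -> : [set: nat] = (fun n : nat => (0 : int, n%:Z)) @^-1` gap_reps.
  by apply/seteqP; split => // n _.
by apply: finite_preimage => // m n _ _ [].
Qed.

Lemma component_arc_of z : (~` cantor_circle) z -> exists d,
  gap_reps d /\ connected_component (~` cantor_circle) z = arc d.
Proof.
move=> /arc_compl[d dz]; have [k dk] := gap_reps_shift d.
by exists (shift k d); split => //; rewrite arc_shift; exact: component_arc.
Qed.

Lemma arc_component d : components (~` cantor_circle) (arc d).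
Proof.
have dd := lt_lpt_rpt d.
have dm : arc d (circle_proj ((lpt d + rpt d) / 2)).
  by apply: in_arc; apply/andP; split; lra.
by exists (circle_proj ((lpt d + rpt d) / 2)); [apply/arc_compl; exists d|exact: component_arc].
Qed.

Lemma cantor_circle_lengths : exists lambda, decreasing_gap_lengths cantor_circle lambda.
Proof.
have [s [[sD sinj ssurj] sdec]] :=
  decreasing_enumeration gap_reps_infinite (fun d _ => w_gt0 d) w_small.
exists (w \o s), (arc \o s); split => [|i|i]; [|exact: arc_has_length|exact: sdec].
split => [i _|i j _ _ /= e|A [z /component_arc_of[d [dr dA]] zA]].
- exact: arc_component.
- apply: sinj; rewrite ?inE//.
  have dd := lt_lpt_rpt (s i).
  have dm : arc (s i) (circle_proj ((lpt (s i) + rpt (s i)) / 2)).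
    by apply: in_arc; apply/andP; split; lra.
  have dm' : arc (s j) (circle_proj ((lpt (s i) + rpt (s i)) / 2)) by rewrite -e.
  have [k kE] := arc_overlap dm dm'.
  exact: (esym (gap_reps_inj (sD i I) (sD j I) kE)).
- have [i _ iE] := ssurj d dr.
  by exists i => //=; rewrite iE -dA.
Qed.

(** Any decreasing list consists of the lengths [w d], which avoid arbitrarily
    small windows. *)
Lemma cantor_circle_ratios lambda : decreasing_gap_lengths cantor_circle lambda ->
  (1 < limn_esup (fun i => (lambda i / lambda i.+1)%:E))%E /\
  ~ ((fun i => lambda i / lambda i.+1) @ \oo --> (1 : R)).
Proof.
move=> [J [[JC Jinj Jsurj] Jlen Jdec]].
have lw i : exists d, lambda i = w d.
  have [z /component_arc_of[d [_ dA]] zJ] := JC i I.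
  exists d; apply: (@arc_length_unique _ (J i)) => //.
  by rewrite -zJ dA; exact: arc_has_length.
have wl d : exists i, lambda i = w d.
  have [i _ iE] := Jsurj _ (arc_component d).
  exists i; apply: (@arc_length_unique _ (J i)) => //.
  by rewrite iE; exact: arc_has_length.
have lpos i : 0 < lambda i by have [d ->] := lw i.
have lwin eps : 0 < eps -> exists eta,
  [/\ 0 < eta, eta < eps, forall i, lambda i <= eta \/ 2 * eta <= lambda i &
      exists i, lambda i <= eta].
  move=> /w_window[eta /andP[eta0 eta_eps] H]; exists eta; split => //.
    by move=> i; have [d ->] := lw i.
  apply: contrapT => no; apply: gap_reps_infinite.
  apply: sub_finite_set (w_small eta0) => d dr; split => //.
  rewrite leNgt; apply/negP => dl; apply: no.
  by have [i iE] := wl d; exists i; rewrite iE ltW.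
split; first exact: ratio_limsup.
exact: ratio_not_cvg1.
Qed.

Lemma denjoy_example : exists (f : circle R -> circle R) (K : set (circle R)),
    [/\ circle_C1_diffeo f,
        orientation_preserving f,
        minimal_invariant_Cantor_set f K,
        exists lambda : nat -> R, decreasing_gap_lengths K lambda
      & forall lambda : nat -> R, decreasing_gap_lengths K lambda ->
          (1 < limn_esup (fun i => (lambda i / lambda i.+1)%:E))%E /\
          ~ ((fun i => lambda i / lambda i.+1) @ \oo --> (1 : R))].
Proof.
exists f, cantor_circle.
have [fd fo] := lift_circle_diffeo dF p_continuous c8 p_ge FD.
split => //.
- split; [exact: homeomorphic_cantor_circle|exact: cantor_circle_invariant|exact: cantor_circle_minimal].
- exact: cantor_circle_lengths.
- exact: cantor_circle_ratios.
Qed.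

End Blowup.

(** * Normalized lengths and the example *)

Section NormalizedWeights.
Variables (R : realType) (alpha : R).
Hypothesis alphaP : liouville alpha.

(** Telescoping with [2 / (j + 1) - 2 / (j + 2)]. *)
Lemma sum_inv_squares_le n : \sum_(0 <= j < n) (j.+1%:R ^+ 2)^-1 <= 2 :> R.
Proof.
suff : \sum_(0 <= j < n) (j.+1%:R ^+ 2)^-1 <= 2 - 2 / n.+1%:R :> R.
  by move=> /le_trans; apply; rewrite gerBl divr_ge0.
elim: n => [|n IH]; first by rewrite big_geq// divr1 subrr.
rewrite big_nat_recr//= (le_trans (lerD IH (lexx _)))//.
have x1 : 1 <= n.+1%:R :> R by rewrite ler1n.
rewrite -[n.+2%:R]natr1; move: (n.+1%:R : R) x1 => x x1.
have x0 : 0 < x by lra.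
rewrite -subr_ge0 (_ : _ - _ = (x - 1) / (x ^+ 2 * (x + 1))).
  by rewrite divr_ge0 ?mulr_ge0 ?exprn_ge0//; lra.
by field; rewrite !lt0r_neq0//; lra.
Qed.

(* The weights decay in [n], and [fold_index] takes each value twice on each of
   the two orbits, so four codes are spent on each value. *)
Let code (d : int * int) : nat := (4 * fold_index d.2 + 2 * (0 < d.2)%R + odd `|d.1|)%N.

Let code_inj : {in between alpha 0 2 &, injective code}.
Proof.
move=> [m n] [m' n']; rewrite !inE /between /th /code /= => mn mn' e.
have nn : n = n' by move: e; case: n {mn} => [[|N]|N]; case: n' {mn'} => [[|N']|N'] /=; lia.
move: mn'; rewrite -nn => mn'; congr (_, _).
have : (odd `|m| = odd `|m'|)%N by move: e; rewrite nn; lia.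
have : -2%:~R < (m - m')%:~R :> R by rewrite intrB; lra.
have : (m - m')%:~R < 2%:~R :> R by rewrite intrB; lra.
by rewrite -intrN !ltr_int; lia.
Qed.

Lemma weight_summable : (\esum_(d in between alpha 0 2) (weight alpha d)%:E < +oo)%E.
Proof.
have [C C0 CP] := weight_decay alphaP.
pose a (j : nat) : \bar R := (16 * C * (j.+1%:R ^+ 2)^-1)%:E.
have a0 j : (0 <= a j)%E by rewrite lee_fin mulr_ge0 ?mulr_ge0 ?invr_ge0 ?exprn_ge0// ltW.
apply: (@le_lt_trans _ _ (\esum_(d in between alpha 0 2) a (code d))%E).
  apply: le_esum => -[m n] _; rewrite lee_fin; apply: le_trans (CP m n) _.
  rewrite -[16 * C]mulrC -mulrA ler_pM2l//.
  have N0 : 0 < (fold_index n).+1%:R ^+ 2 :> R by rewrite exprn_gt0.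
  have c0 : 0 < (code (m, n)).+1%:R ^+ 2 :> R by rewrite exprn_gt0.
  rewrite -[leLHS]mul1r ler_pdivlMr// mulrAC mul1r ler_pdivrMr//.
  rewrite (_ : 16 = 4 ^+ 2); last by ring.
  rewrite -exprMn lerXn2r ?nnegrE ?mulr_ge0// -natrM ler_nat /code/=; lia.
rewrite -(@reindex_esum _ _ _ _ (code @` between alpha 0 2))//; last exact: inj_bij.
apply: (@le_lt_trans _ _ (\esum_(j in [set: nat]) a j)%E).
  apply: ge_ereal_sup => _ [A [finA _] <-]; apply: ereal_sup_ubound.
  by exists A.
rewrite -nneseries_esumT//; apply: (@le_lt_trans _ _ (32 * C)%:E); last exact: ltry.
apply: lime_le; first exact: is_cvg_nneseries.
apply: nearW => n; rewrite sumEFin lee_fin -mulr_sumr.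
by have := sum_inv_squares_le n; nra.
Qed.

Let total : R := fine (\esum_(d in between alpha 0 2) (weight alpha d)%:E)%E.

Let totalE : (\esum_(d in between alpha 0 2) (weight alpha d)%:E = total%:E)%E.
Proof.
rewrite fineK// ge0_fin_numE ?weight_summable// esum_ge0// => d _.
by rewrite lee_fin ltW// weight_gt0.
Qed.

Let total_gt0 : 0 < total.
Proof.
rewrite -lte_fin -totalE; apply: (@lt_le_trans _ _ (weight alpha (0, 0))%:E).
  by rewrite lte_fin weight_gt0.
apply: esum_ge; exists [set (0, 0)]; last by rewrite fsbig_set1.
by split => // _ ->; rewrite /between /th /= mul0r addr0; apply/andP; split; lra.
Qed.

(** The circle of the example has length 1, and the gaps fill it. *)
Definition gap_length (d : int * int) : R := weight alpha d / total.

Lemma gap_length_gt0 d : 0 < gap_length d.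
Proof. by rewrite divr_gt0// weight_gt0. Qed.

Lemma gap_length_ratio d e : gap_length d / gap_length e = weight alpha d / weight alpha e.
Proof. by rewrite /gap_length; field; rewrite !lt0r_neq0// weight_gt0. Qed.

Lemma gap_length_shift k d : gap_length (shift k d) = gap_length d.
Proof. by case: d => m n; rewrite /gap_length /shift/= weight_shift. Qed.

Lemma gap_length_total : (\esum_(d in between alpha 0 2) (gap_length d)%:E = 1)%E.
Proof.
have t0 := ltW total_gt0.
apply/eqP; rewrite eq_le; apply/andP; split.
  apply: (@le_trans _ _ (total^-1%:E * total%:E)%E).
    rewrite -totalE; apply: (@esum_scale_le _ _ gap_length (weight alpha)) => [|d|d _]; first by rewrite invr_ge0.
      exact/ltW/weight_gt0.
    by rewrite mulrC.
  by rewrite -EFinM mulVf// lt0r_neq0.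
rewrite -(@lee_pmul2l _ total%:E) ?lte_fin//.
rewrite mule1 -[leLHS]totalE; apply: esum_scale_le => // d; first exact/ltW/gap_length_gt0.
by move=> _; rewrite mulrCA divff ?mulr1// lt0r_neq0.
Qed.

Lemma gap_length_small eps : 0 < eps ->
  finite_set [set d | gap_reps d /\ eps <= gap_length d].
Proof.
move=> e0; have [C C0 CP] := weight_decay alphaP.
have e1 : 0 < eps * total by rewrite mulr_gt0.
pose N := Num.truncn (C / (eps * total)).
have big d : eps <= gap_length d -> (fold_index d.2 <= N)%N.
  case: d => m n; rewrite /gap_length ler_pdivlMr// => h.
  have {h} := le_trans h (CP m n); rewrite ler_pdivlMr ?exprn_gt0// => h /=.
  have : (fold_index n).+1%:R <= C / (eps * total).
    rewrite ler_pdivlMr// mulrC; apply: le_trans h; rewrite ler_pM2l//.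
    by rewrite expr2 ler_peMl// ler1n.
  move=> {}h; apply: ltnW; rewrite -ltnS -(ltr_nat R).
  by have /andP[_] := truncn_itv (ltW (divr_gt0 C0 e1)); exact: le_lt_trans h.
pose s := [seq (i, j) | i <- [:: 0 : int; 1],
                        j <- [seq (k%:Z - N.+1%:Z) | k <- iota 0 (2 * N.+2)]].
apply: (@sub_finite_set _ _ [set` s]); last exact: finite_seq.
move=> [m n] [/= m01 /big/= nN]; apply/allpairsP; exists (m, n); split => //.
  by move: m01; rewrite /gap_reps/= !inE; lia.
move: N {big s m01} nN => N nN.
apply/mapP; exists `|(n + N.+1%:Z)%R|%N; last by move: nN; rewrite /=; case: n => [[|j]|j] /=; lia.
by rewrite mem_iota; move: nN; rewrite /=; case: n => [[|j]|j] /=; lia.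
Qed.

Lemma gap_length_window eps : 0 < eps -> exists2 eta, 0 < eta < eps &
  forall d, gap_length d <= eta \/ 2 * eta <= gap_length d.
Proof.
move=> e0; have [|eta /andP[eta0 etae] etaP] := weight_window alphaP (eps := eps * total).
  by rewrite mulr_gt0.
exists (eta / total); first by rewrite divr_gt0//= ltr_pdivrMr.
move=> d; rewrite mulrA /gap_length !ler_pM2r ?invr_gt0//; exact: etaP.
Qed.

End NormalizedWeights.

Theorem theorem1p2 (R : realType) :
  exists (f : circle R -> circle R) (K : set (circle R)),
    [/\ circle_C1_diffeo f,
        orientation_preserving f,
        minimal_invariant_Cantor_set f K,
        exists lambda : nat -> R, decreasing_gap_lengths K lambda
      & forall lambda : nat -> R, decreasing_gap_lengths K lambda ->
          (1 < limn_esup (fun i => (lambda i / lambda i.+1)%:E))%E /\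
          ~ ((fun i => lambda i / lambda i.+1) @ \oo --> (1 : R))].
Proof.
have [alpha alphaP] := liouville_rotation R.
have irr := rotation_irrational alphaP.
have small := rotation_small alphaP.
have bounds d : d.2 != 0 -> slope (th alpha d) / 2 <=
    gap_length alpha (step d) / gap_length alpha d <= 2 * slope (th alpha d).
  by case: d => m n n0; rewrite gap_length_ratio//; exact: weight_ratio_bounds.
have cvg eps : 0 < eps -> exists N0 : nat, forall d : int * int, (N0 < `|d.2|)%N ->
    `|gap_length alpha (step d) / gap_length alpha d - slope (th alpha d)| <= eps.
  move=> /(weight_ratio_cvg alphaP)[N0 h]; exists N0 => -[m n] nN.
  by rewrite gap_length_ratio//; exact: h.
have w01 : gap_length alpha (1, 0) = gap_length alpha (0, 0).
  by rewrite /gap_length !weight00.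
have w0 m : gap_length alpha (m, 1) = gap_length alpha (m, 0).
  by rewrite /gap_length weight00 weight01.
have [F [dF FD Fl Fr]] := lift_exists irr small (gap_length_gt0 alphaP)
  (@gap_length_shift _ alpha) (gap_length_total alphaP) w01 w0 bounds cvg.
apply: (denjoy_example irr small (gap_length_gt0 alphaP)
  (@gap_length_shift _ alpha) (gap_length_total alphaP) w01 w0 bounds cvg dF FD Fl Fr).
  exact: gap_length_small.
exact: gap_length_window.
Qed.
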